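(* Let $(A,\Gamma^{+},\alpha)$ be a dynamical system, let $(A\times_{\alpha}^{\mathrm{piso}}\Gamma^{+},j_{A},j_{\Gamma^{+}})$ be its partial-isometric crossed product and $(A\times_{\alpha}^{\mathrm{iso}}\Gamma^{+},i_{A},i_{\Gamma^{+}})$ its isometric crossed product, and let $\phi:A\times_{\alpha}^{\mathrm{piso}}\Gamma^{+}\to A\times_{\alpha}^{\mathrm{iso}}\Gamma^{+}$ be the natural surjective homomorphism, satisfying $\phi(j_{\Gamma^{+}}(x)^{*}j_{A}(a)j_{\Gamma^{+}}(y))=i_{\Gamma^{+}}(x)^{*}i_{A}(a)i_{\Gamma^{+}}(y)$ for all $a\in A$, $x,y\in\Gamma^{+}$. Then $$\ker\phi=\overline{\operatorname{span}}\{j_{\Gamma^{+}}(x)^{*}\,j_{A}(a)\,(1-j_{\Gamma^{+}}(t)^{*}j_{\Gamma^{+}}(t))\,j_{\Gamma^{+}}(y) : a\in A,\ x,y,t\in\Gamma^{+}\}.$$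
   Context: $\Gamma$ is a totally ordered abelian group (discrete) and $\Gamma^{+}=\{x\in\Gamma:x\ge 0\}$ its positive cone. A dynamical system $(A,\Gamma^{+},\alpha)$ consists of a (not necessarily unital) $C^*$-algebra $A$ and an action (semigroup homomorphism) $\alpha:\Gamma^{+}\to\operatorname{End}(A)$ with $\alpha_0=\mathrm{id}_A$, such that every $\alpha_x$ is extendible, i.e. extends to a strictly continuous endomorphism $\overline{\alpha}_x$ of the multiplier algebra $M(A)$ (possibly $\overline{\alpha}_x(1_{M(A)})\ne 1_{M(A)}$). A partial-isometric representation of $\Gamma^{+}$ (on a Hilbert space, or in a multiplier algebra) is a map $V$ such that each $V_s$ is a partial isometry and $V_sV_t=V_{s+t}$ for all $s,t\in\Gamma^+$. A covariant partial-isometric representation of $(A,\Gamma^{+},\alpha)$ on a Hilbert space $H$ (or, similarly, in a $C^*$-algebra $B$, with $V$ taking values in $M(B)$) is a pair $(\pi,V)$ with $\pi$ a non-degenerate representation (homomorphism) of $A$ and $V$ a partial-isometric representation of $\Gamma^+$ such that $\pi(\alpha_s(a))=V_s\pi(a)V_s^*$ and $V_s^*V_s\pi(a)=\pi(a)V_s^*V_s$ for all $a\in A$, $s\in\Gamma^+$. The partial-isometric crossed product is the triple $(A\times_{\alpha}^{\mathrm{piso}}\Gamma^{+},j_A,j_{\Gamma^+})$, unique up to isomorphism, consisting of a $C^*$-algebra $B=A\times_{\alpha}^{\mathrm{piso}}\Gamma^{+}$, a non-degenerate homomorphism $j_A:A\to B$ and a partial-isometric representation $j_{\Gamma^+}:\Gamma^+\to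 M(B)$ such that: (i) $(j_A,j_{\Gamma^+})$ is a covariant partial-isometric representation in $B$; (ii) for every covariant partial-isometric representation $(\pi,V)$ on a Hilbert space $H$ there is a non-degenerate representation $\pi\times V$ of $B$ on $H$ with $(\pi\times V)\circ j_A=\pi$ and $\overline{(\pi\times V)}\circ j_{\Gamma^+}=V$; (iii) $B=\overline{\operatorname{span}}\{j_{\Gamma^+}(s)^*j_A(a)j_{\Gamma^+}(t):a\in A,\ s,t\in\Gamma^+\}$. (The bar denotes the extension to the multiplier algebra; it is known that such a triple exists.) An isometric representation of $\Gamma^+$ is a homomorphism $V$ into the isometries, and a covariant isometric representation of $(A,\Gamma^+,\alpha)$ is a pair $(\pi,V)$ with $\pi$ a non-degenerate representation of $A$ and $V$ an isometric representation with $\pi(\alpha_s(a))=V_s\pi(a)V_s^*$. The isometric crossed product $(A\times_{\alpha}^{\mathrm{iso}}\Gamma^{+},i_A,i_{\Gamma^+})$ is the $C^*$-algebra generated by a universal covariant isometric representation $(i_A,i_{\Gamma^+})$ (closed span of the elements $i_{\Gamma^+}(s)^*i_A(a)i_{\Gamma^+}(t)$): $(\pi,V)\mapsto\pi\times V$ is a bijection between covariant isometric representations and non-degenerate representations of $A\times_{\alpha}^{\mathrm{iso}}\Gamma^{+}$. It may be zero. Since $(i_A,i_{\Gamma^+})$ is also a covariant partial-isometric representation, it induces the surjection $\phi=i_A\times i_{\Gamma^+}$. *)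

(* Defs.v *)
From HB Require Import structures.
From mathcomp Require Import all_boot all_order all_algebra.
From mathcomp Require Import all_classical all_reals all_analysis.
From mathcomp Require Import complex.

Set Implicit Arguments.
Unset Strict Implicit.
Unset Printing Implicit Defensive.

Import Order.TTheory GRing.Theory Num.Theory.
Import numFieldNormedType.Exports.

Local Open Scope classical_set_scope.
Local Open Scope ring_scope.

Reserved Notation "x ** y" (at level 40, left associativity).

HB.mixin Record POrderedZmodule_isTotallyOrderedGroup G of
    Num.POrderedZmodule G := {
  og_le_total : forall x y : G, (x <= y) || (y <= x);
  og_leD2l : forall x y z : G, x <= y -> z + x <= z + y
}.

#[short(type="orderedGroupType")]
HB.structure Definition OrderedGroup :=
  {G of POrderedZmodule_isTotallyOrderedGroup G & Num.POrderedZmodule G}.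

Record posCone (G : orderedGroupType) :=
  PosCone { pos_val :> G; pos_ge0 : 0 <= pos_val }.

HB.instance Definition _ G := [isSub for @pos_val G].
HB.instance Definition _ G := [Choice of posCone G by <:].

Lemma posCone_closed (G : orderedGroupType) : addr_closed (fun x : G => 0 <= x).
Proof.
split=> [|x y]; rewrite !unfold_in ?lexx// => x0 y0.
by apply: (le_trans x0); rewrite -[leLHS]addr0; exact: og_leD2l.
Qed.

HB.instance Definition _ (G : orderedGroupType) :=
  GRing.SubChoice_isSubNmodule.Build G _ (posCone G) (@posCone_closed G).

(* Not necessarily unital. *)
HB.mixin Record Lmodule_isStarAlgebra (R : realType) A of
    GRing.Lmodule R[i] A := {
  smul : A -> A -> A;
  star : A -> A;
  smulA : associative smul;
  smulDl : left_distributive smul +%R;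
  smulDr : right_distributive smul +%R;
  smulZl : forall (c : R[i]) x y, smul (c *: x) y = c *: smul x y;
  smulZr : forall (c : R[i]) x y, smul x (c *: y) = c *: smul x y;
  starK : involutive star;
  starD : {morph star : x y / x + y};
  starZ : forall (c : R[i]) x, star (c *: x) = c^* *: star x;
  starM : forall x y, star (smul x y) = smul (star y) (star x)
}.

#[short(type="starAlgType")]
HB.structure Definition StarAlgebra (R : realType) :=
  {A of Lmodule_isStarAlgebra R A & GRing.Lmodule R[i] A}.

Notation "x ** y" := (smul x y) : ring_scope.

HB.mixin Record StarAlgebra_hasUnit (R : realType) A of StarAlgebra R A := {
  sone : A;
  smul1l : left_id sone smul;
  smul1r : right_id sone smul
}.

#[short(type="unitStarAlgType")]
HB.structure Definition UnitStarAlgebra (R : realType) :=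
  {A of StarAlgebra_hasUnit R A & StarAlgebra R A}.

HB.mixin Record StarAlgebra_isCStar (R : realType) A of
    StarAlgebra R A & CompleteNormedModule R[i] A := {
  normM_le : forall x y : A, `|x ** y| <= `|x| * `|y|;
  cstar_norm : forall x : A, `|star x ** x| = `|x| ^+ 2
}.

#[short(type="cstarAlgType")]
HB.structure Definition CStarAlgebra (R : realType) :=
  {A of StarAlgebra_isCStar R A & StarAlgebra R A
     & CompleteNormedModule R[i] A}.

(* *-homomorphisms, not required to preserve units. *)
Definition star_hom (R : realType) (A B : starAlgType R) (f : A -> B) :=
  [/\ linear f, {morph f : x y / x ** y} & {morph f : x / star x}].

Definition closed_span (K : numFieldType) (E : normedModType K) (S : set E) :
    set E :=
  closure [set x | exists (n : nat) (c : 'I_n -> K) (v : 'I_n -> E),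
    (forall i, S (v i)) /\ x = \sum_(i < n) c i *: v i].

Section MultiplierDef.
Variables (R : realType) (A : cstarAlgType R).

(* Double centralizers of [A] in the sense of Busby; [mull m a] stands for    *)
(* [m a] and [mulr m a] for [a m].  The single identity below forces both     *)
(* maps to be linear and bounded, and [mull m (a b) = (mull m a) b],          *)
(* [mulr m (a b) = a (mulr m b)].                                             *)
Record multiplier := Multiplier {
  mull : A -> A;
  mulr : A -> A;
  mulrl : forall a b, a ** mull b = mulr a ** b
}.

End MultiplierDef.

Section MultiplierTheory.
Variables (R : realType) (A : cstarAlgType R).
Implicit Types (a b x y : A) (m n p : multiplier A) (c : R[i]).

Lemma smul0l x : 0 ** x = 0 :> A.
Proof. by have := smulZl 0 (0 : A) x; rewrite !scale0r. Qed.

Lemma smul0r x : x ** 0 = 0 :> A.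
Proof. by have := smulZr 0 x (0 : A); rewrite !scale0r. Qed.

Lemma smulNl x y : (- x) ** y = - (x ** y) :> A.
Proof. by rewrite -scaleN1r smulZl scaleN1r. Qed.

Lemma smulNr x y : x ** (- y) = - (x ** y) :> A.
Proof. by rewrite -scaleN1r smulZr scaleN1r. Qed.

Lemma star_smul_eq0 x : star x ** x = 0 -> x = 0.
Proof.
move=> x0; have /eqP := cstar_norm x.
by rewrite x0 normr0 eq_sym expf_eq0 /= normr_eq0 => /eqP.
Qed.

Lemma smul_injr x y : (forall a, a ** x = a ** y) -> x = y.
Proof.
move=> xy; apply/eqP; rewrite -subr_eq0; apply/eqP/star_smul_eq0.
by rewrite smulDr smulNr xy subrr.
Qed.

Lemma smul_injl x y : (forall a, x ** a = y ** a) -> x = y.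
Proof.
move=> xy; apply: (can_inj (@starK _ A)); apply: smul_injr => a.
by apply: (can_inj (@starK _ A)); rewrite !starM !starK xy.
Qed.

Lemma mull_linear m : linear (mull m).
Proof.
move=> c x y; apply: smul_injr => a.
by rewrite mulrl !smulDr !smulZr !mulrl.
Qed.

Lemma mulr_linear m : linear (mulr m).
Proof.
move=> c x y; apply: smul_injl => a.
by rewrite -mulrl !smulDl !smulZl !mulrl.
Qed.

Lemma mullD m x y : mull m (x + y) = mull m x + mull m y.
Proof. by rewrite -[x]scale1r mull_linear !scale1r. Qed.

Lemma mulrrD m x y : mulr m (x + y) = mulr m x + mulr m y.
Proof. by rewrite -[x]scale1r mulr_linear !scale1r. Qed.

Lemma mull0 m : mull m 0 = 0.
Proof. by apply: smul_injr => a; rewrite mulrl !smul0r. Qed.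

Lemma mulrr0 m : mulr m 0 = 0.
Proof. by apply: smul_injl => a; rewrite -mulrl !smul0l. Qed.

Lemma mullZ m c x : mull m (c *: x) = c *: mull m x.
Proof. by rewrite -[c *: x]addr0 mull_linear mull0 addr0. Qed.

Lemma mulrrZ m c x : mulr m (c *: x) = c *: mulr m x.
Proof. by rewrite -[c *: x]addr0 mulr_linear mulrr0 addr0. Qed.

Lemma mullM m x y : mull m (x ** y) = mull m x ** y.
Proof. by apply: smul_injr => a; rewrite mulrl smulA -mulrl smulA. Qed.

Lemma mulrrM m x y : mulr m (x ** y) = x ** mulr m y.
Proof. by apply: smul_injl => a; rewrite -mulrl -!smulA mulrl. Qed.

Lemma multiplierP m n : mull m =1 mull n -> mulr m =1 mulr n -> m = n.
Proof.
case: m n => [l r lr] [l' r' lr'] /= /funext ll /funext rr.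
by move: lr lr'; rewrite ll rr => lr lr'; congr Multiplier; exact: Prop_irrelevance.
Qed.

HB.instance Definition _ := gen_eqMixin (multiplier A).
HB.instance Definition _ := gen_choiceMixin (multiplier A).

Fact mult_zero_subproof a b : a ** (0 : A) = 0 ** b.
Proof. by rewrite smul0l smul0r. Qed.
Definition mult_zero :=
  @Multiplier R A (fun=> 0) (fun=> 0) mult_zero_subproof.

Fact mult_opp_subproof m a b : a ** - mull m b = (- mulr m a) ** b.
Proof. by rewrite smulNl smulNr mulrl. Qed.
Definition mult_opp m := Multiplier (mult_opp_subproof m).

Fact mult_add_subproof m n a b :
  a ** (mull m b + mull n b) = (mulr m a + mulr n a) ** b.
Proof. by rewrite smulDl smulDr !mulrl. Qed.
Definition mult_add m n := Multiplier (mult_add_subproof m n).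

Fact mult_scale_subproof c m a b : a ** (c *: mull m b) = (c *: mulr m a) ** b.
Proof. by rewrite smulZl smulZr mulrl. Qed.
Definition mult_scale c m := Multiplier (mult_scale_subproof c m).

Fact mult_mul_subproof m n a b :
  a ** mull m (mull n b) = mulr n (mulr m a) ** b.
Proof. by rewrite !mulrl. Qed.
Definition mult_mul m n := Multiplier (mult_mul_subproof m n).

Fact mult_star_subproof m a b :
  a ** star (mulr m (star b)) = star (mull m (star a)) ** b.
Proof. by apply: (can_inj (@starK _ A)); rewrite !starM !starK mulrl. Qed.
Definition mult_star m := Multiplier (mult_star_subproof m).

Definition mult_one := @Multiplier R A id id (fun _ _ => erefl).

Fact mult_addA : associative mult_add.
Proof. by move=> m n p; apply: multiplierP => x /=; rewrite addrA. Qed.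
Fact mult_addC : commutative mult_add.
Proof. by move=> m n; apply: multiplierP => x /=; rewrite addrC. Qed.
Fact mult_add0 : left_id mult_zero mult_add.
Proof. by move=> m; apply: multiplierP => x /=; rewrite add0r. Qed.
Fact mult_addN : left_inverse mult_zero mult_opp mult_add.
Proof. by move=> m; apply: multiplierP => x /=; rewrite addNr. Qed.

HB.instance Definition _ := GRing.isZmodule.Build (multiplier A)
  mult_addA mult_addC mult_add0 mult_addN.

Fact mult_scaleA c d m : mult_scale c (mult_scale d m) = mult_scale (c * d) m.
Proof. by apply: multiplierP => x /=; rewrite scalerA. Qed.
Fact mult_scale1 : left_id 1 mult_scale.
Proof. by move=> m; apply: multiplierP => x /=; rewrite scale1r. Qed.
Fact mult_scaleDr : right_distributive mult_scale +%R.
Proof. by move=> c m n; apply: multiplierP => x /=; rewrite scalerDr. Qed.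
Fact mult_scaleDl m : {morph mult_scale^~ m : c d / c + d}.
Proof. by move=> c d; apply: multiplierP => x /=; rewrite scalerDl. Qed.

HB.instance Definition _ := GRing.Zmodule_isLmodule.Build R[i] (multiplier A)
  mult_scaleA mult_scale1 mult_scaleDr mult_scaleDl.

Fact mult_mulA : associative mult_mul.
Proof. by move=> m n p; apply: multiplierP. Qed.
Fact mult_mulDl : left_distributive mult_mul +%R.
Proof. by move=> m n p; apply: multiplierP => x //=; rewrite mulrrD. Qed.
Fact mult_mulDr : right_distributive mult_mul +%R.
Proof. by move=> m n p; apply: multiplierP => x //=; rewrite mullD. Qed.
Fact mult_mulZl c m n : mult_mul (c *: m) n = c *: mult_mul m n.
Proof. by apply: multiplierP => x //=; rewrite mulrrZ. Qed.
Fact mult_mulZr c m n : mult_mul m (c *: n) = c *: mult_mul m n.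
Proof. by apply: multiplierP => x //=; rewrite mullZ. Qed.
Fact mult_starK : involutive mult_star.
Proof. by move=> m; apply: multiplierP => x /=; rewrite !starK. Qed.
Fact mult_starD : {morph mult_star : m n / m + n}.
Proof. by move=> m n; apply: multiplierP => x /=; rewrite starD. Qed.
Fact mult_starZ c m : mult_star (c *: m) = c^* *: mult_star m.
Proof. by apply: multiplierP => x /=; rewrite starZ. Qed.
Fact mult_starM m n : mult_star (mult_mul m n) = mult_mul (mult_star n) (mult_star m).
Proof. by apply: multiplierP => x /=; rewrite !starK. Qed.

HB.instance Definition _ := Lmodule_isStarAlgebra.Build R (multiplier A)
  mult_mulA mult_mulDl mult_mulDr mult_mulZl mult_mulZr
  mult_starK mult_starD mult_starZ mult_starM.

Fact mult_mul1l : left_id mult_one (@smul R (multiplier A)).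
Proof. by move=> m; apply: multiplierP. Qed.
Fact mult_mul1r : right_id mult_one (@smul R (multiplier A)).
Proof. by move=> m; apply: multiplierP. Qed.

HB.instance Definition _ := StarAlgebra_hasUnit.Build R (multiplier A)
  mult_mul1l mult_mul1r.

Fact mult_embed_subproof x a b : a ** (x ** b) = (a ** x) ** b.
Proof. exact: smulA. Qed.

Definition mult_embed x : multiplier A := Multiplier (mult_embed_subproof x).

(* The element [m a n] of [A]. *)
Definition sandwich m a n : A := mulr n (mull m a).

Lemma mult_embed_sandwich m a n :
  mult_embed (sandwich m a n) = m ** mult_embed a ** n.
Proof.
apply: multiplierP => x /=; first by rewrite /sandwich -mulrl mullM.
by rewrite /sandwich -mulrl mulrrM.
Qed.

Lemma mult_embed_star_hom : star_hom mult_embed.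
Proof.
split=> [c x y|x y|x]; apply: multiplierP => a /=.
- by rewrite smulDl smulZl.
- by rewrite smulDr smulZr.
- by rewrite smulA.
- by rewrite smulA.
- by rewrite starM starK.
- by rewrite starM starK.
Qed.

Lemma mult_embed_inj : injective mult_embed.
Proof.
move=> x y xy; apply: smul_injl => a.
by have /(congr1 (@mull R A)) /(congr1 (@^~ a)) := xy.
Qed.

(* Convergence for the strict topology, the topology generated by the         *)
(* seminorms [m |-> `|m a|] and [m |-> `|a m|].                               *)
Definition strict_cvg (F : set_system (multiplier A)) m :=
  forall a, (fun n => mull n a) @ F --> mull m a /\
            (fun n => mulr n a) @ F --> mulr m a.

End MultiplierTheory.

Definition strictly_continuous (R : realType) (A B : cstarAlgType R)
    (f : multiplier A -> multiplier B) :=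
  forall (F : set_system (multiplier A)) (m : multiplier A),
    Filter F -> strict_cvg F m -> strict_cvg (f @ F) (f m).

Definition extendible (R : realType) (A : cstarAlgType R) (f : A -> A) :=
  exists fbar : multiplier A -> multiplier A,
    [/\ star_hom fbar, strictly_continuous fbar &
        forall a, fbar (mult_embed a) = mult_embed (f a)].

HB.mixin Record CompleteNormedModule_isHilbert (R : realType) H of
    CompleteNormedModule R[i] H := {
  inner : H -> H -> R[i];
  inner_linear : forall (c : R[i]) x y z,
    inner (c *: x + y) z = c * inner x z + inner y z;
  inner_conj : forall x y, inner y x = (inner x y)^*;
  inner_norm : forall x, inner x x = `|x| ^+ 2
}.

#[short(type="hilbertType")]
HB.structure Definition Hilbert (R : realType) :=
  {H of CompleteNormedModule_isHilbert R H & CompleteNormedModule R[i] H}.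

(* B(H); the adjoint, which every bounded operator has and which is unique    *)
(* ([bopP] below), is bundled to avoid the Riesz representation theorem.      *)
Record bop (R : realType) (H : hilbertType R) := Bop {
  bapp :> H -> H;
  badj : H -> H;
  bapp_linear : linear bapp;
  badj_linear : linear badj;
  bapp_continuous : continuous bapp;
  badj_continuous : continuous badj;
  badjP : forall x y, inner (bapp x) y = inner x (badj y)
}.

Section BoundedOperators.
Variables (R : realType) (H : hilbertType R).
Implicit Types (x y z : H) (S T U : bop H) (c : R[i]).

Lemma innerDl x y z : inner (x + y) z = inner x z + inner y z.
Proof. by rewrite -[x in LHS]scale1r inner_linear mul1r. Qed.
Lemma innerDr x y z : inner z (x + y) = inner z x + inner z y.
Proof. by rewrite inner_conj innerDl rmorphD /= -!inner_conj. Qed.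
Lemma inner0l z : inner 0 z = 0.
Proof. by apply: (addrI (inner 0 z)); rewrite -innerDl !addr0. Qed.
Lemma innerZl c x z : inner (c *: x) z = c * inner x z.
Proof. by rewrite -[c *: x]addr0 inner_linear inner0l addr0. Qed.
Lemma innerZr c x z : inner z (c *: x) = c^* * inner z x.
Proof. by rewrite inner_conj innerZl rmorphM /= -inner_conj. Qed.
Lemma innerNl x z : inner (- x) z = - inner x z.
Proof. by rewrite -scaleN1r innerZl mulN1r. Qed.
Lemma innerNr x z : inner z (- x) = - inner z x.
Proof. by rewrite inner_conj innerNl rmorphN /= -inner_conj. Qed.
Lemma inner0r z : inner z 0 = 0.
Proof. by rewrite inner_conj inner0l rmorph0. Qed.

Lemma inner_inj x y : (forall z, inner z x = inner z y) -> x = y.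
Proof.
move=> xy; apply/eqP; rewrite -subr_eq0 -normr_eq0 -sqrf_eq0 -inner_norm.
by rewrite innerDr innerNr xy subrr.
Qed.

Lemma bopP S T : S =1 T -> S = T.
Proof.
case: S T => [f g fl gl fc gc fg] [f' g' fl' gl' fc' gc' fg'] /= /funext ff.
move: fl fc fg fl' fc' fg'; rewrite ff => fl fc fg fl' fc' fg'.
have gg : g = g'.
  by apply/funext => y; apply: inner_inj => x; rewrite -fg -fg'.
by move: gl gc fg gl' gc' fg'; rewrite gg => *; congr Bop; exact: Prop_irrelevance.
Qed.

HB.instance Definition _ := gen_eqMixin (bop H).
HB.instance Definition _ := gen_choiceMixin (bop H).

Definition bop_zero : bop H.
Proof.
exists (fun=> 0) (fun=> 0) => [c x y|c x y|x|x|x y].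
- by rewrite scaler0 addr0.
- by rewrite scaler0 addr0.
- exact: cvg_cst.
- exact: cvg_cst.
- by rewrite inner0l inner0r.
Defined.

Definition bop_opp T : bop H.
Proof.
exists (fun x => - T x) (fun x => - badj T x) => [c x y|c x y|x|x|x y].
- by rewrite bapp_linear opprD scalerN.
- by rewrite badj_linear opprD scalerN.
- by apply: cvgN; exact: bapp_continuous.
- by apply: cvgN; exact: badj_continuous.
- by rewrite innerNl innerNr badjP.
Defined.

Definition bop_add S T : bop H.
Proof.
exists (fun x => S x + T x) (fun x => badj S x + badj T x)
  => [c x y|c x y|x|x|x y].
- by rewrite !bapp_linear scalerDr addrACA.
- by rewrite !badj_linear scalerDr addrACA.
- by apply: cvgD; exact: bapp_continuous.
- by apply: cvgD; exact: badj_continuous.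
- by rewrite innerDl innerDr !badjP.
Defined.

Definition bop_scale c T : bop H.
Proof.
exists (fun x => c *: T x) (fun x => c^* *: badj T x) => [d x y|d x y|x|x|x y].
- by rewrite bapp_linear scalerDr !scalerA mulrC.
- by rewrite badj_linear scalerDr !scalerA mulrC.
- by apply: cvgZr; exact: bapp_continuous.
- by apply: cvgZr; exact: badj_continuous.
- by rewrite innerZl innerZr conjCK badjP.
Defined.

Definition bop_mul S T : bop H.
Proof.
exists (fun x => S (T x)) (fun x => badj T (badj S x)) => [c x y|c x y|x|x|x y].
- by rewrite !bapp_linear.
- by rewrite !badj_linear.
- by apply: continuous_comp; exact: bapp_continuous.
- by apply: continuous_comp; exact: badj_continuous.
- by rewrite !badjP.
Defined.

Definition bop_star T : bop H.
Proof.
exists (badj T) T; [exact: badj_linear | exact: bapp_linear |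
  exact: badj_continuous | exact: bapp_continuous |].
by move=> x y; rewrite inner_conj -badjP -inner_conj.
Defined.

Definition bop_one : bop H.
Proof. by exists id id => // x; exact: cvg_id. Defined.

Fact bop_addA : associative bop_add.
Proof. by move=> S T U; apply: bopP => x /=; rewrite addrA. Qed.
Fact bop_addC : commutative bop_add.
Proof. by move=> S T; apply: bopP => x /=; rewrite addrC. Qed.
Fact bop_add0 : left_id bop_zero bop_add.
Proof. by move=> S; apply: bopP => x /=; rewrite add0r. Qed.
Fact bop_addN : left_inverse bop_zero bop_opp bop_add.
Proof. by move=> S; apply: bopP => x /=; rewrite addNr. Qed.

HB.instance Definition _ := GRing.isZmodule.Build (bop H)
  bop_addA bop_addC bop_add0 bop_addN.

Fact bop_scaleA c d T : bop_scale c (bop_scale d T) = bop_scale (c * d) T.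
Proof. by apply: bopP => x /=; rewrite scalerA. Qed.
Fact bop_scale1 : left_id 1 bop_scale.
Proof. by move=> T; apply: bopP => x /=; rewrite scale1r. Qed.
Fact bop_scaleDr : right_distributive bop_scale +%R.
Proof. by move=> c S T; apply: bopP => x /=; rewrite scalerDr. Qed.
Fact bop_scaleDl T : {morph bop_scale^~ T : c d / c + d}.
Proof. by move=> c d; apply: bopP => x /=; rewrite scalerDl. Qed.

HB.instance Definition _ := GRing.Zmodule_isLmodule.Build R[i] (bop H)
  bop_scaleA bop_scale1 bop_scaleDr bop_scaleDl.

Lemma bappD T x y : T (x + y) = T x + T y.
Proof. by rewrite -[x]scale1r bapp_linear !scale1r. Qed.
Lemma bapp0 T : T 0 = 0.
Proof. by apply: (addrI (T 0)); rewrite -bappD !addr0. Qed.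
Lemma bappZ T c x : T (c *: x) = c *: T x.
Proof. by rewrite -[c *: x]addr0 bapp_linear bapp0 addr0. Qed.

Fact bop_mulA : associative bop_mul.
Proof. by move=> S T U; apply: bopP. Qed.
Fact bop_mulDl : left_distributive bop_mul +%R.
Proof. by move=> S T U; apply: bopP. Qed.
Fact bop_mulDr : right_distributive bop_mul +%R.
Proof. by move=> S T U; apply: bopP => x /=; rewrite bappD. Qed.
Fact bop_mulZl c S T : bop_mul (c *: S) T = c *: bop_mul S T.
Proof. exact: bopP. Qed.
Fact bop_mulZr c S T : bop_mul S (c *: T) = c *: bop_mul S T.
Proof. by apply: bopP => x /=; rewrite bappZ. Qed.
Fact bop_starK : involutive bop_star.
Proof. by move=> T; apply: bopP. Qed.
Fact bop_starD : {morph bop_star : S T / S + T}.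
Proof. by move=> S T; apply: bopP. Qed.
Fact bop_starZ c T : bop_star (c *: T) = c^* *: bop_star T.
Proof. exact: bopP. Qed.
Fact bop_starM S T : bop_star (bop_mul S T) = bop_mul (bop_star T) (bop_star S).
Proof. exact: bopP. Qed.

HB.instance Definition _ := Lmodule_isStarAlgebra.Build R (bop H)
  bop_mulA bop_mulDl bop_mulDr bop_mulZl bop_mulZr
  bop_starK bop_starD bop_starZ bop_starM.

Fact bop_mul1l : left_id bop_one (@smul R (bop H)).
Proof. by move=> T; apply: bopP. Qed.
Fact bop_mul1r : right_id bop_one (@smul R (bop H)).
Proof. by move=> T; apply: bopP. Qed.

HB.instance Definition _ := StarAlgebra_hasUnit.Build R (bop H)
  bop_mul1l bop_mul1r.

End BoundedOperators.

Definition nondegenerate_rep (R : realType) (A : cstarAlgType R)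
    (H : hilbertType R) (pi : A -> bop H) :=
  star_hom pi /\
  closed_span [set y | exists (a : A) (x : H), y = pi a x] = [set: H].

Definition nondegenerate_hom (R : realType) (A B : cstarAlgType R)
    (f : A -> B) :=
  star_hom f /\
  closed_span [set y | exists (a : A) (b : B), y = f a ** b] = [set: B].

(* [rhobar] is the extension of [rho] to the multiplier algebra (unique when *)
(* [rho] is nondegenerate).                                                  *)
Definition multiplier_extension (R : realType) (B : cstarAlgType R)
    (H : hilbertType R) (rho : B -> bop H) (rhobar : multiplier B -> bop H) :=
  star_hom rhobar /\ forall b, rhobar (mult_embed b) = rho b.

Definition partial_isometry (R : realType) (U : unitStarAlgType R) (v : U) :=
  v ** star v ** v = v.

Definition isometry (R : realType) (U : unitStarAlgType R) (v : U) :=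
  star v ** v = sone.

Section CrossedProducts.
Variables (R : realType) (G : orderedGroupType) (A : cstarAlgType R).
Variable alpha : posCone G -> A -> A.

Definition dynamical_system :=
  [/\ forall s, star_hom (alpha s),
      forall a, alpha 0 a = a,
      forall s t a, alpha (s + t) a = alpha s (alpha t a) &
      forall s, extendible (alpha s)].

Definition piso_representation (U : unitStarAlgType R) (V : posCone G -> U) :=
  (forall s, partial_isometry (V s)) /\ forall s t, V s ** V t = V (s + t).

Definition iso_representation (U : unitStarAlgType R) (V : posCone G -> U) :=
  (forall s, isometry (V s)) /\ forall s t, V s ** V t = V (s + t).

(* [U] will be either B(H) or a multiplier algebra. *)
Definition piso_covariant (U : unitStarAlgType R) (pi : A -> U)
    (V : posCone G -> U) :=
  piso_representation V /\
  forall s a, pi (alpha s a) = V s ** pi a ** star (V s) /\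
              star (V s) ** V s ** pi a = pi a ** (star (V s) ** V s).

Definition iso_covariant (U : unitStarAlgType R) (pi : A -> U)
    (V : posCone G -> U) :=
  iso_representation V /\
  forall s a, pi (alpha s a) = V s ** pi a ** star (V s).

Section Triple.
Variables (B : cstarAlgType R) (jA : A -> B) (jG : posCone G -> multiplier B).

Definition integrated_form (H : hilbertType R) (pi : A -> bop H)
    (V : posCone G -> bop H) (rho : B -> bop H) :=
  [/\ nondegenerate_rep rho,
      forall a, rho (jA a) = pi a &
      exists rhobar, multiplier_extension rho rhobar /\
        forall s, rhobar (jG s) = V s].

Definition generates :=
  closed_span [set b | exists (s : posCone G) (a : A) (t : posCone G),
    b = sandwich (star (jG s)) (jA a) (jG t)] = [set: B].

Definition piso_crossed_product :=
  [/\ nondegenerate_hom jA,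
      piso_covariant (fun a => mult_embed (jA a)) jG,
      forall (H : hilbertType R) (pi : A -> bop H) (V : posCone G -> bop H),
        nondegenerate_rep pi -> piso_covariant pi V ->
        exists rho, integrated_form pi V rho &
      generates].

Definition iso_crossed_product :=
  [/\ nondegenerate_hom jA /\ iso_covariant (fun a => mult_embed (jA a)) jG,
      forall (H : hilbertType R) (pi : A -> bop H) (V : posCone G -> bop H),
        nondegenerate_rep pi -> iso_covariant pi V ->
        exists! rho, integrated_form pi V rho,
      forall (H : hilbertType R) (rho : B -> bop H),
        nondegenerate_rep rho ->
        exists! piV : (A -> bop H) * (posCone G -> bop H),
          [/\ nondegenerate_rep piV.1, iso_covariant piV.1 piV.2 &
              integrated_form piV.1 piV.2 rho] &
      generates].

End Triple.
End CrossedProducts.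

(* Main.v *)
(* The generators of the right-hand side lie in the kernel since              *)
(* [j(a) j(t)^* = j(t)^* j(alpha_t(a))] and the [i(t)] are isometries.        *)
(* Conversely, moving [1 - j(t)^* j(t)] past the [j(s)] shows that their      *)
(* closed span [J] is a closed two-sided *-ideal of [B].  If [b x] is not in  *)
(* [J], a Hahn-Banach argument gives a positive functional [F] that vanishes  *)
(* on [J] but not at [(b x)^* (b x)].  In its GNS representation every [j(t)] *)
(* becomes an isometry, so the representation factors through [phi] by the    *)
(* universal property of the isometric crossed product, and [phi b <> 0].     *)
(* Hence [b x] is in [J] for all [x] when [phi b = 0], and [x = b^*] gives    *)
(* [b] in [J].                                                                *)
(* The C*-algebra theory needed for this is elementary: positive elements are *)
(* the squares of self-adjoint ones, square roots come from an iteration      *)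
(* dominated by its scalar case, and instead of a unitization we use the      *)
(* bounded multipliers of [B].                                                *)
Require Import Defs.
From HB Require Import structures.
From mathcomp Require Import all_boot all_order all_algebra.
From mathcomp Require Import all_classical all_reals all_analysis.
From mathcomp Require Import complex ring lra.
Import Order.TTheory GRing.Theory Num.Theory.
Import numFieldNormedType.Exports.
Local Open Scope classical_set_scope.
Local Open Scope ring_scope.
Local Notation "x %:C" := (real_complex _ x) : ring_scope.
Set Implicit Arguments.
Unset Strict Implicit.
Unset Printing Implicit Defensive.

(** Write q_t = 1 - j(t)^* j(t), and J for the closed span in question. Covariance turns a generator
    of J into j(x)^* j(a) j(y) - j(t+x)^* j(alpha_t a) j(t+y). Both terms have the same image
    because the i(t) are isometries ([phi_defect_generator]), so phi kills J.

    For the converse, the total order lets q_t pass every j(s) ([defect_move], resting on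
    [initial_final_commute]), which makes J a closed ideal. No quotient algebra is formed. Instead
    [exists_positive_functional] produces, for an element outside J, a positive functional F that
    vanishes on J. In its GNS representation the defects act as 0, since q_t y lies in J for every y
    ([gns_isometry]). The representation therefore factors through phi and is 0 on the kernel,
    whereas by [gns_rep_eq0] it does not kill b once F is non-zero at (b x)^* (b x).

    Two facts carry the separation: [pos_star_smul], that x^* x is the square of a self-adjoint
    element, and [mem_ideal_of_approx], that b lies in J as soon as b^* b + p + j can be made small
    with p positive and j self-adjoint in J. *)

Definition rnorm (R : realType) (V : normedModType R[i]) (x : V) : R :=
  complex.Re `|x|.

(** * The norm as a real number; completeness with a rate *)

Section RealNorm.
Variables (R : realType) (V : normedModType R[i]).
Implicit Types x y : V.

Lemma rnormE x : `|x| = (rnorm x)%:C.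
Proof. by rewrite RRe_real// ger0_real. Qed.

Lemma rnorm_ge0 x : 0 <= rnorm x.
Proof. by rewrite -ler0c -rnormE. Qed.

Lemma rnormD x y : rnorm (x + y) <= rnorm x + rnorm y.
Proof. by rewrite -lecR rmorphD /= -!rnormE ler_normD. Qed.

Lemma rnormN x : rnorm (- x) = rnorm x.
Proof. by rewrite /rnorm normrN. Qed.

Lemma rnormB x y : rnorm (x - y) <= rnorm x + rnorm y.
Proof. by rewrite (le_trans (rnormD _ _))// rnormN. Qed.

Lemma rnorm_distC x y : rnorm (x - y) = rnorm (y - x).
Proof. by rewrite -rnormN opprB. Qed.

Lemma rnormZ (r : R) x : 0 <= r -> rnorm (r%:C *: x) = r * rnorm x.
Proof.
move=> r0; apply: complexI; rewrite -rnormE normrZ rmorphM /= rnormE.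
by rewrite ger0_norm ?ler0c.
Qed.

Lemma rnorm0 : rnorm (0 : V) = 0.
Proof. by rewrite /rnorm normr0. Qed.

Lemma rnorm_eq0 x : rnorm x = 0 -> x = 0.
Proof. by move=> x0; apply/eqP; rewrite -normr_eq0 rnormE x0. Qed.

(** Limiting arguments end here: an identity is checked up to a fixed, possibly crude, multiple of
    every [e]. *)
Lemma rnorm_small x (M : R) :
  (forall e, 0 < e -> rnorm x <= M * e) -> x = 0.
Proof.
move=> xM; apply: rnorm_eq0; apply/eqP; rewrite eq_le rnorm_ge0 andbT.
apply/ler_addgt0Pr => e e0; rewrite add0r.
have M1 : 0 < `|M| + 1 by rewrite ltr_wpDl.
apply: (le_trans (xM (e / (`|M| + 1)) (divr_gt0 e0 M1))).
rewrite mulrA ler_pdivrMr// mulrC ler_wpM2l ?(ltW e0)//.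
by rewrite (le_trans (ler_norm M))// lerDl.
Qed.

Lemma ball_rnormP x y (r : R) : ball x r%:C y <-> rnorm (x - y) < r.
Proof. by rewrite -ball_normE /= rnormE ltcR. Qed.

Lemma closure_rnormP (S : set V) x :
  closure S x <-> forall e : R, 0 < e -> exists2 y, S y & rnorm (x - y) < e.
Proof.
split=> [clSx e e0|Sx U].
  have eC : 0 < e%:C by rewrite ltcR.
  have [y [Sy /ball_rnormP]] := clSx _ (nbhsx_ballx x e%:C eC).
  by exists y.
rewrite -nbhs_ballE => -[e /= e0 eU].
have [r er] : exists r : R, e = r%:C.
  by apply/complex_realP; rewrite gtr0_real.
move: e0 eU; rewrite {}er ltcR => r0 rU.
have [y Sy xy] := Sx _ r0.
by exists y; split=> //; apply/rU/ball_rnormP.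
Qed.

End RealNorm.

(** The limit keeps the rate as a non-strict bound, so that [d] is both the Cauchy modulus and the
    final error estimate. *)
Lemma complete_rate (R : realType) (V : completeNormedModType R[i])
    (u : nat -> V) (d : nat -> R) :
  (forall e, 0 < e -> exists n, d n < e) ->
  (forall m n, (m <= n)%N -> rnorm (u n - u m) <= d m) ->
  exists l, forall m, rnorm (l - u m) <= d m.
Proof.
move=> d0 ud.
have : cauchy (u @ \oo).
  apply/cauchy_ballP => e e0; rewrite near_simpl.
  have [r er] : exists r : R, e = r%:C.
    by apply/complex_realP; rewrite gtr0_real.
  rewrite {}er ltcR in e0 *.
  have [N dN] := d0 _ (divr_gt0 e0 (ltr0n _ 2)).
  exists ([set n | (N <= n)%N], [set n | (N <= n)%N]) => /=.
    by split; exists N.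
  move=> [m n] /= [mN nN]; rewrite -ball_normE /= rnormE ltcR.
  rewrite -[u m](subrK (u N)) -addrA; apply: (le_lt_trans (rnormD _ _)).
  rewrite [X in _ + rnorm X](_ : _ = u N - u n)//.
  rewrite [rnorm (u N - _)]rnorm_distC [ltRHS](splitr r).
  by rewrite ltrD// (le_lt_trans (ud _ _ _)).
move/cauchy_cvg; set l := lim _ => ul; exists l => m.
apply/ler_addgt0Pr => e e0.
have eC : 0 < e%:C by rewrite ltcR.
have /cvgrPdist_lt/(_ _ eC) [N _ uN] := ul.
have := uN (maxn m N) (leq_maxr _ _); rewrite /= rnormE ltcR => le.
rewrite -[l](subrK (u (maxn m N))) -addrA addrC.
apply: (le_trans (rnormD _ _)).
by apply: lerD; [exact: ud (leq_maxl _ _)|exact: ltW].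
Qed.

Section CStarNorm.
Variables (R : realType) (A : cstarAlgType R).
Implicit Types x y : A.

Lemma star0 (U : starAlgType R) : star 0 = 0 :> U.
Proof. by apply: (addrI (star 0)); rewrite -starD !addr0. Qed.

Lemma starN (U : starAlgType R) (x : U) : star (- x) = - star x.
Proof. by apply: (addrI (star x)); rewrite -starD !subrr star0. Qed.

Lemma rnormM x y : rnorm (x ** y) <= rnorm x * rnorm y.
Proof. by rewrite -lecR rmorphM /= -!rnormE normM_le. Qed.

Lemma rnorm_cstar x : rnorm (star x ** x) = rnorm x ^+ 2.
Proof. by apply: complexI; rewrite -rnormE cstar_norm rnormE rmorphXn. Qed.

(** The C*-identity gives |y|^2 = |y^* y| <= |y^*| |y|; cancel one factor, then exchange y and
    y^*. *)
Lemma rnorm_star x : rnorm (star x) = rnorm x.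
Proof.
have H y : rnorm y <= rnorm (star y).
  have [->|y0] := eqVneq y 0; first by rewrite star0.
  have y1 : 0 < rnorm y.
    by rewrite lt_def rnorm_ge0 andbT; apply: contra_neq y0 => /rnorm_eq0.
  by rewrite -(ler_pM2r y1) -expr2 -rnorm_cstar rnormM.
by apply/eqP; rewrite eq_le H -{2}[x]starK H.
Qed.

End CStarNorm.

(** * Bounded multipliers *)

Section Bounded.
Variables (R : realType) (A : cstarAlgType R).
Implicit Types (m n p : multiplier A) (a b : A) (c d e : R).

(** An explicit bound for the operator norm of [m]. Multipliers get no norm of their own; estimates
    carry such a constant instead. *)
Definition bnd m c := 0 <= c /\ forall b, rnorm (mull m b) <= c * rnorm b.

Lemma mull_inj m n : mull m =1 mull n -> m = n.
Proof.
move=> mn; apply: multiplierP => // a; apply: smul_injl => b.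
by rewrite -!mulrl mn.
Qed.

Lemma mult_star_smul_eq0 m : star m ** m = 0 -> m = 0.
Proof.
move=> m0; apply: mull_inj => b /=; apply: star_smul_eq0.
have : star b ** mull (star m) (mull m b) = 0.
  by rewrite -[RHS](smul0r (star b)) -[0 in RHS]/(mull 0 b) -m0.
by rewrite (mulrl (star m)) /= starK.
Qed.

Lemma star1 (U : unitStarAlgType R) : star (sone : U) = sone.
Proof. by rewrite -[LHS]smul1l -{1}[sone]starK -starM smul1l starK. Qed.

Lemma bnd_le m c d : bnd m c -> c <= d -> bnd m d.
Proof.
move=> [c0 mc] cd; split=> [|b]; first exact: le_trans cd.
by rewrite (le_trans (mc b))// ler_wpM2r ?rnorm_ge0.
Qed.

Lemma bnd1 : bnd sone 1.
Proof. by split=> // b; rewrite mul1r. Qed.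

Lemma bnd0 : bnd 0 0.
Proof. by split=> // b; rewrite /= rnorm0 mul0r. Qed.

Lemma bndD m n c d : bnd m c -> bnd n d -> bnd (m + n) (c + d).
Proof.
move=> [c0 mc] [d0 nd]; split=> [|b]; first exact: addr_ge0.
by rewrite /= (le_trans (rnormD _ _))// mulrDl lerD.
Qed.

Lemma bndN m c : bnd m c -> bnd (- m) c.
Proof. by move=> [c0 mc]; split=> // b; rewrite /= rnormN. Qed.

Lemma bndB m n c d : bnd m c -> bnd n d -> bnd (m - n) (c + d).
Proof. by move=> mc nd; apply: bndD => //; exact: bndN. Qed.

Lemma bndZ r m c : 0 <= r -> bnd m c -> bnd (r%:C *: m) (r * c).
Proof.
move=> r0 [c0 mc]; split=> [|b]; first exact: mulr_ge0.
by rewrite /= rnormZ// -mulrA ler_wpM2l.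
Qed.

Lemma bnd_i m c : bnd m c -> bnd ('i *: m) c.
Proof.
move=> [c0 mc]; split=> [//|b]; rewrite /=.
by rewrite (_ : rnorm _ = rnorm (mull m b))// /rnorm normrZ normCi mul1r.
Qed.

Lemma bndM m n c d : bnd m c -> bnd n d -> bnd (m ** n) (c * d).
Proof.
move=> [c0 mc] [d0 nd]; split=> [|b]; first exact: mulr_ge0.
by rewrite /= (le_trans (mc _))// -mulrA ler_wpM2l.
Qed.

Lemma rnorm_mull m b :
  rnorm (mull m b) ^+ 2 = rnorm (star b ** mull (star m ** m) b).
Proof.
rewrite -rnorm_cstar -[mull (_ ** _) b]/(mull (star m) (mull m b)).
by rewrite (mulrl (star m)) /= starK.
Qed.

(** The C*-identity for multipliers: |m b|^2 = |b^* (m^* m b)| <= |b| c^2 |b|. *)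
Lemma bnd_cstar m c : 0 <= c -> bnd (star m ** m) (c ^+ 2) -> bnd m c.
Proof.
move=> c0 [_ mc]; split=> // b.
rewrite -ler_sqr ?nnegrE ?mulr_ge0 ?rnorm_ge0//.
rewrite rnorm_mull (le_trans (rnormM _ _))// rnorm_star mulrC.
by rewrite exprMn [in leRHS]expr2 mulrA ler_wpM2r ?rnorm_ge0 ?mc.
Qed.

(** Here |m^* b|^2 = |b^* (m m^* b)| <= |b| c |m^* b|, and one factor cancels. *)
Lemma bnd_star m c : bnd m c -> bnd (star m) c.
Proof.
move=> [c0 mc]; split=> // b.
have [->|mb0] := eqVneq (mull (star m) b) 0.
  by rewrite rnorm0 mulr_ge0 ?rnorm_ge0.
have mb1 : 0 < rnorm (mull (star m) b).
  by rewrite lt_def rnorm_ge0 andbT; apply: contra_neq mb0 => /rnorm_eq0.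
rewrite -(ler_pM2r mb1) -expr2 rnorm_mull starK (le_trans (rnormM _ _))//.
by rewrite rnorm_star mulrC mulrAC ler_wpM2r ?rnorm_ge0 ?mc.
Qed.

Lemma bnd_embed a : bnd (mult_embed a) (rnorm a).
Proof. by split=> [|b]; rewrite ?rnorm_ge0// rnormM. Qed.

(** Testing a^* on a itself gives |a|^2 = |a^* a| <= c |a|. *)
Lemma bnd_embed_le a c : bnd (mult_embed a) c -> rnorm a <= c.
Proof.
move=> ac; have [c0] := bnd_star ac; move/(_ a) => /= ac'.
have [->|a0] := eqVneq a 0; first by rewrite rnorm0.
have a1 : 0 < rnorm a.
  by rewrite lt_def rnorm_ge0 andbT; apply: contra_neq a0 => /rnorm_eq0.
rewrite -(ler_pM2r a1) -expr2 -rnorm_cstar (le_trans _ ac')//.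
by rewrite starM starK.
Qed.

Lemma bnd_eq0 m c : (forall e, 0 < e -> bnd m (c * e)) -> m = 0.
Proof.
move=> mc; apply: mull_inj => b /=; apply: (@rnorm_small _ _ _ (c * rnorm b)) => e e0.
by rewrite mulrAC; have [_] := mc _ e0; exact.
Qed.

(** Both actions converge pointwise, and the limits again form a double centralizer. *)
Lemma bnd_complete (u : nat -> multiplier A) (d : nat -> R) :
  (forall e, 0 < e -> exists n : nat, d n < e) ->
  (forall m n : nat, (m <= n)%N -> bnd (u n - u m) (d m)) ->
  exists l, forall m : nat, bnd (l - u m) (d m).
Proof.
move=> d0 ud.
have dge0 (n : nat) : 0 <= d n by have [] := ud n n (leqnn n).
have db (b : A) (e : R) : 0 < e -> exists n : nat, d n * rnorm b < e.
  move=> e0; have b1 : 0 < rnorm b + 1 by rewrite ltr_wpDl// rnorm_ge0.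
  have [n] := d0 _ (divr_gt0 e0 b1); rewrite ltr_pdivlMr// => dn.
  by exists n; rewrite (le_lt_trans _ dn)// ler_wpM2l// lerDl.
have /choice[l ul] (b : A) :
    exists y, forall m : nat, rnorm (y - mull (u m) b) <= d m * rnorm b.
  apply: complete_rate; first exact: db.
  by move=> k n mn; have [_] := ud k n mn; exact.
have /choice[r ur] (b : A) :
    exists y, forall m : nat, rnorm (y - mulr (u m) b) <= d m * rnorm b.
  apply: complete_rate; first exact: db.
  move=> k n mn; have [_] := bnd_star (ud k n mn); move=> /(_ (star b)) /=.
  by rewrite starK !rnorm_star.
(* The identity holds for each [u n]; replacing a limit by [u n] costs at most d_n |a| |b| on either
   side. *)
have lr (a b : A) : a ** l b = r a ** b.
  apply/eqP; rewrite -subr_eq0; apply/eqP.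
  apply: (@rnorm_small _ _ _ 2) => e e0.
  have ab1 : 0 < rnorm a * rnorm b + 1 by rewrite ltr_wpDl// mulr_ge0 ?rnorm_ge0.
  have [n] := d0 _ (divr_gt0 e0 ab1); rewrite ltr_pdivlMr// => dn.
  have -> : a ** l b - r a ** b =
      a ** (l b - mull (u n) b) - (r a - mulr (u n) a) ** b.
    by rewrite smulDr smulDl smulNr smulNl mulrl opprB addrA subrK.
  apply: (le_trans (rnormB _ _)).
  have dab : d n * (rnorm a * rnorm b) <= e.
    by rewrite (le_trans _ (ltW dn))// ler_wpM2l// lerDl.
  rewrite mulrDl mul1r; apply: lerD; apply: (le_trans (rnormM _ _)).
    by rewrite (le_trans _ dab)// mulrCA ler_wpM2l ?rnorm_ge0.
  by rewrite (le_trans _ dab)// mulrA ler_wpM2r ?rnorm_ge0.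
exists (Multiplier lr) => k; split=> // b; exact: ul.
Qed.

Lemma mult_embedB a b : mult_embed (a - b) = mult_embed a - mult_embed b.
Proof.
have [embD _ _] := mult_embed_star_hom A.
by rewrite addrC -scaleN1r embD scaleN1r addrC.
Qed.

(** [A] is closed among its multipliers, because on [A] a multiplier bound is a norm bound
    ([bnd_embed_le]). *)
Lemma embed_closed m (u : nat -> A) (d : nat -> R) :
  (forall e, 0 < e -> exists n : nat, d n < e) ->
  (forall i j, (i <= j)%N -> d j <= d i) ->
  (forall n : nat, bnd (m - mult_embed (u n)) (d n)) ->
  exists a, m = mult_embed a.
Proof.
move=> d0 dd mu.
have [e e0||l lu] := @complete_rate R A u (fun n : nat => d n + d n).
- have [n dn] := d0 _ (divr_gt0 e0 (ltr0n R 2)).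
  by exists n; rewrite [ltRHS]splitr ltrD.
- move=> i j ij; apply: bnd_embed_le.
  rewrite mult_embedB -(subrK m (mult_embed (u j))) -addrA.
  apply: bndD => //.
  by rewrite -opprB; apply/bndN/(bnd_le (mu j))/dd.
exists l; apply/eqP; rewrite -subr_eq0; apply/eqP.
apply: (@bnd_eq0 _ 3) => e e0; have [n dn] := d0 _ e0.
rewrite -(subrK (mult_embed (u n)) m) -addrA -mult_embedB.
have dn0 : 0 <= d n by have [] := mu n.
apply: (@bnd_le _ (d n + (d n + d n))); last by lra.
apply: bndD => //; apply: bnd_le (bnd_embed _) _.
by rewrite rnorm_distC; exact: lu.
Qed.

End Bounded.

(** * Linear identities in star algebras *)

Section LinearExpressions.
Variables (K : comPzRingType) (V : lmodType K).

(** Syntax for the tactic [lmodule]. Atoms, among them products already expanded by [smulE], are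
    numbered by their place in a list, and expressions with equal coefficients at every atom have
    equal values. *)
Inductive lexpr :=
  | LVar of nat
  | LZero
  | LAdd of lexpr & lexpr
  | LOpp of lexpr
  | LScale of K & lexpr
  | LMuln of lexpr & nat.

Fixpoint lexpr_eval (env : seq V) e :=
  match e with
  | LVar i => env`_i
  | LZero => 0
  | LAdd e f => lexpr_eval env e + lexpr_eval env f
  | LOpp e => - lexpr_eval env e
  | LScale c e => c *: lexpr_eval env e
  | LMuln e n => lexpr_eval env e *+ n
  end.

Fixpoint lexpr_coef e i : K :=
  match e with
  | LVar j => if i == j then 1 else 0
  | LZero => 0
  | LAdd e f => lexpr_coef e i + lexpr_coef f i
  | LOpp e => - lexpr_coef e i
  | LScale c e => c * lexpr_coef e i
  | LMuln e n => lexpr_coef e i *+ n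
  end.

Lemma lexpr_evalE env e :
  lexpr_eval env e = \sum_(i < size env) lexpr_coef e i *: env`_i.
Proof.
elim: e => /= [j||e -> f ->|e ->|c e ->|e -> n].
- have [js|sj] := ltnP j (size env).
    rewrite (bigD1 (Ordinal js))//= eqxx scale1r big1 ?addr0// => i ij.
    by rewrite ifN ?scale0r//; apply: contra_neq ij => ij; apply: val_inj.
  rewrite nth_default// big1// => i _; rewrite ifN ?scale0r//.
  by rewrite neq_ltn (leq_trans (ltn_ord i) sj).
- by rewrite big1// => i _; rewrite scale0r.
- by rewrite -big_split; apply: eq_bigr => i _; rewrite scalerDl.
- by rewrite -sumrN; apply: eq_bigr => i _; rewrite scaleNr.
- by rewrite scaler_sumr; apply: eq_bigr => i _; rewrite scalerA.
- by rewrite -sumrMnl; apply: eq_bigr => i _; rewrite scalerMnl.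
Qed.

(** A nested conjunction, so that [simpl; repeat split] leaves one scalar equation per atom. *)
Fixpoint lexpr_coefs_eq n e f : Prop :=
  if n is n.+1 then
    lexpr_coef e n = lexpr_coef f n /\ lexpr_coefs_eq n e f
  else True.

Lemma lexpr_eq env e f :
  lexpr_coefs_eq (size env) e f -> lexpr_eval env e = lexpr_eval env f.
Proof.
move=> ef; rewrite !lexpr_evalE; apply: eq_bigr => -[i /= i_lt] _.
congr (_ *: _).
elim: (size env) ef i_lt => //= n IH [en ef].
by rewrite ltnS leq_eqVlt => /orP[/eqP->//|]; exact: IH.
Qed.

End LinearExpressions.

Ltac atom_index x env :=
  match env with
  | ?y :: _ => let u := match goal with _ => unify x y end in constr:(Some O)
  | _ :: ?env' => lazymatch atom_index x env' with
                  | Some ?i => constr:(Some (S i))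
                  | None => constr:(@None nat)
                  end
  | nil => constr:(@None nat)
  end.
Ltac add_atoms env t :=
  lazymatch t with
  | 0%R => env
  | (?a + ?b)%R => let env' := add_atoms env a in add_atoms env' b
  | (- ?a)%R => add_atoms env a
  | (_ *: ?a)%R => add_atoms env a
  | (?a *+ _)%R => add_atoms env a
  | _ => lazymatch atom_index t env with
         | Some _ => env
         | None => constr:(t :: env)
         end
  end.
Ltac reify_lexpr K env t :=
  lazymatch t with
  | 0%R => constr:(LZero K)
  | (?a + ?b)%R => let e := reify_lexpr K env a in
                   let f := reify_lexpr K env b in constr:(LAdd e f)
  | (- ?a)%R => let e := reify_lexpr K env a in constr:(LOpp e)
  | (?c *: ?a)%R => let e := reify_lexpr K env a in constr:(LScale (c : K) e)
  | (?a *+ ?n)%R => let e := reify_lexpr K env a in constr:(LMuln e n)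
  | _ => lazymatch atom_index t env with Some ?i => constr:(LVar K i) end
  end.
Ltac lmodule_coefs K :=
  lazymatch goal with
  | |- @eq ?V ?l ?r =>
    let env := add_atoms (@nil V) l in
    let env := add_atoms env r in
    let e := reify_lexpr K env l in
    let f := reify_lexpr K env r in
    apply: (@lexpr_eq K _ env e f); simpl; repeat split
  end.

(* Decides equality of linear combinations by comparing coefficients; scalar  *)
(* goals that [field] cannot solve are left open.                             *)
Ltac lmodule K :=
  lmodule_coefs K; try solve [field; rewrite ?fmorph_eq0 ?gt_eqF //].

Section StarAlgebraTheory.
Variables (R : realType) (U : starAlgType R).
Implicit Types (x y z : U).

Lemma starB x y : star (x - y) = star x - star y.
Proof. by rewrite starD starN. Qed.

Lemma starZr (r : R) x : star (r%:C *: x) = r%:C *: star x.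
Proof. by rewrite starZ conj_Creal// complex_real. Qed.

Lemma smul_0l x : 0 ** x = 0 :> U.
Proof. by apply: (addrI (0 ** x)); rewrite -smulDl !addr0. Qed.

Lemma smul_0r x : x ** 0 = 0 :> U.
Proof. by apply: (addrI (x ** 0)); rewrite -smulDr !addr0. Qed.

Lemma smul_Nl x y : (- x) ** y = - (x ** y) :> U.
Proof. by apply: (addrI (x ** y)); rewrite -smulDl !subrr smul_0l. Qed.

Lemma smul_Nr x y : x ** (- y) = - (x ** y) :> U.
Proof. by apply: (addrI (x ** y)); rewrite -smulDr !subrr smul_0r. Qed.

Lemma smulAr x y z : (x ** y) ** z = x ** (y ** z) :> U.
Proof. by rewrite smulA. Qed.

Definition smulE :=
  (@smulDl R U, @smulDr R U, smul_Nl, smul_Nr, @smulZl R U, @smulZr R U,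
   smul_0l, smul_0r, smulAr).

Definition commute x y := x ** y = y ** x.

Lemma commuteD x y z : commute x y -> commute x z -> commute x (y + z).
Proof. by rewrite /commute smulDl smulDr => -> ->. Qed.

Lemma commuteN x y : commute x y -> commute x (- y).
Proof. by rewrite /commute smul_Nl smul_Nr => ->. Qed.

Lemma commuteB x y z : commute x y -> commute x z -> commute x (y - z).
Proof. by move=> xy xz; apply/commuteD/commuteN. Qed.

Lemma commuteZ (c : R[i]) x y : commute x y -> commute x (c *: y).
Proof. by rewrite /commute smulZl smulZr => ->. Qed.

Lemma commuteM x y z : commute x y -> commute x z -> commute x (y ** z).
Proof. by rewrite /commute smulA => -> xz; rewrite -smulA xz smulA. Qed.

Lemma commute0 x : commute x 0.
Proof. by rewrite /commute smul_0l smul_0r. Qed.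

Lemma commute_sym x y : commute x y -> commute y x.
Proof. by []. Qed.

End StarAlgebraTheory.

Notation smul1E := (smul1l, smul1r, smulE).

Lemma commute1 (R : realType) (U : unitStarAlgType R) (x : U) : commute x sone.
Proof. by rewrite /commute smul1l smul1r. Qed.

(** * Square roots *)

(* The Newton-type iteration y := (x + y^2) / 2, whose limit y satisfies      *)
(* (1 - y)^2 = 1 - x; run at the real number 1 it dominates the iteration at  *)
(* any x of norm at most 1.                                                   *)
Section SquareRootIteration.
Variables (R : realType).

Fixpoint sqrt_iter (U : starAlgType R) (x : U) n : U :=
  if n is n.+1 then
    (2^-1 : R)%:C *: (x + sqrt_iter x n ** sqrt_iter x n)
  else 0.

Fixpoint sqrt_iterR n : R :=
  if n is n.+1 then 2^-1 * (1 + sqrt_iterR n ^+ 2) else 0.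

Lemma sqrt_iterR_bound n : 0 <= sqrt_iterR n <= 1.
Proof. by elim: n => /= [|n IH]; nra. Qed.

Lemma sqrt_iterR_step n : sqrt_iterR n <= sqrt_iterR n.+1.
Proof. by have := sqrt_iterR_bound n; rewrite /=; nra. Qed.

(** The tails [T - sqrt_iterR n] become the error rate of the iteration at every [x] of norm at most
    1. *)
Lemma sqrt_iterR_sup : exists2 T : R, T <= 1 &
  (forall n, sqrt_iterR n <= T) /\
  (forall e, 0 < e -> exists n, T - sqrt_iterR n < e).
Proof.
have hs : has_sup (range sqrt_iterR).
  split; first by exists 0; exists 0%N.
  by exists 1 => _ [n _ <-]; case/andP: (sqrt_iterR_bound n).
exists (sup (range sqrt_iterR)).
  by apply: ge_sup => [|_ [n _ <-]]; [case: hs|case/andP: (sqrt_iterR_bound n)].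
split=> [n|e e0]; first by apply: ub_le_sup; [case: hs|exists n].
have [_ [n _ <-]] := sup_adherent e0 hs.
by rewrite ltrBlDr addrC -ltrBlDr; exists n.
Qed.

Lemma sqrt_iter_star (U : starAlgType R) (x : U) n :
  star x = x -> star (sqrt_iter x n) = sqrt_iter x n.
Proof.
move=> xx; elim: n => /= [|n IH]; first by rewrite star0.
by rewrite starZr starD starM IH xx.
Qed.

Lemma sqrt_iter_commute (U : starAlgType R) (x z : U) n :
  commute z x -> commute z (sqrt_iter x n).
Proof.
move=> zx; elim: n => /= [|n IH]; first exact: commute0.
by apply/commuteZ/commuteD => //; exact: commuteM.
Qed.

Variable A : cstarAlgType R.
Implicit Types (x y z : multiplier A).

Lemma sqrt_iter_bnd x n : bnd x 1 -> bnd (sqrt_iter x n) (sqrt_iterR n).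
Proof.
move=> x1; elim: n => /= [|n IH]; first exact: bnd0.
by apply: bndZ; rewrite ?invr_ge0//; apply: bndD => //; exact: bndM.
Qed.

(** Consecutive iterates [y] and [z] commute, so the next difference is (y - z)(y + z)/2; the scalar
    difference factors in the same way and dominates it factor by factor. *)
Lemma sqrt_iter_step x n : bnd x 1 ->
  bnd (sqrt_iter x n.+1 - sqrt_iter x n) (sqrt_iterR n.+1 - sqrt_iterR n).
Proof.
move=> x1; elim: n => [|n IH].
  have := sqrt_iter_bnd 1 x1.
  by rewrite -[X in bnd X _]subr0 -[X in bnd _ X]subr0.
set y := sqrt_iter x n.+1; set z := sqrt_iter x n in IH *.
have yz : y ** z = z ** y.
  by apply/commute_sym/sqrt_iter_commute/commute_sym/sqrt_iter_commute.
have -> : sqrt_iter x n.+2 - y = (2^-1 : R)%:C *: ((y - z) ** (y + z)).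
  transitivity ((2^-1 : R)%:C *: (x + y ** y) - (2^-1 : R)%:C *: (x + z ** z)).
    by [].
  by move: (y) (z) yz => u v uv; rewrite !smulE -uv; lmodule R[i].
have -> : sqrt_iterR n.+2 - sqrt_iterR n.+1 = 2^-1 *
    ((sqrt_iterR n.+1 - sqrt_iterR n) * (sqrt_iterR n.+1 + sqrt_iterR n)).
  by rewrite /=; field.
apply: bndZ; rewrite ?invr_ge0//; apply: bndM => //.
by apply: bndD; exact: sqrt_iter_bnd.
Qed.

Lemma sqrt_iter_dist x m n : bnd x 1 -> (m <= n)%N ->
  bnd (sqrt_iter x n - sqrt_iter x m) (sqrt_iterR n - sqrt_iterR m).
Proof.
move=> x1 /subnK <-; elim: (n - m)%N => [|k IH].
  by rewrite !subrr; exact: bnd0.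
rewrite addSn -(subrK (sqrt_iter x (k + m)) (sqrt_iter x _)) -addrA.
rewrite -(subrK (sqrt_iterR (k + m)) (sqrt_iterR _.+1)) -[X in bnd _ X]addrA.
by apply: bndD => //; exact: sqrt_iter_step.
Qed.

(** Besides the equation of the limit, the error rate is returned: it lets [sqrt_quasi] conclude
    that the limit stays in [A]. *)
Lemma sqrt_iter_lim x : star x = x -> bnd x 1 ->
  exists y d, [/\ bnd y 1, star y = y,
    (sone - y) ** (sone - y) = sone - x,
    (forall z c, bnd z c -> commute z x -> commute z y) &
    [/\ (forall e, 0 < e -> exists n, d n < e),
       (forall i j, (i <= j)%N -> d j <= d i) &
       forall n, bnd (y - sqrt_iter x n) (d n : R)]].
Proof.
move=> xx x1; have [T T1 [tT Tt]] := sqrt_iterR_sup.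
set d := fun n => T - sqrt_iterR n.
have [m n mn|y yd] := bnd_complete (u := sqrt_iter x) Tt.
  by apply: bnd_le (sqrt_iter_dist x1 mn) _; rewrite lerD2r.
have dd : forall i j, (i <= j)%N -> d j <= d i.
  move=> i j /subnK <-; rewrite lerD2l lerN2.
  elim: (j - i)%N => //= k IH.
  exact: le_trans IH (sqrt_iterR_step _).
have y1 : bnd y 1.
  by apply: bnd_le T1; have := yd 0%N; rewrite !subr0.
(* [y - z'] and [y - z] are both bounded by [e], and the squares differ by y (y - z) + (y - z) z. *)
have y_fix : y = (2^-1 : R)%:C *: (x + y ** y).
  apply/eqP; rewrite -subr_eq0; apply/eqP; apply: (@bnd_eq0 _ _ _ 2) => e e0.
  have [n dn] := Tt _ e0.
  set z := sqrt_iter x n; set z' := sqrt_iter x n.+1.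
  have -> : y - (2^-1 : R)%:C *: (x + y ** y) =
      (y - z') - (2^-1 : R)%:C *: (y ** (y - z) + (y - z) ** z).
    by rewrite /z' /= -/z !smulE; lmodule R[i].
  have z1 : bnd z 1.
    apply: bnd_le (sqrt_iter_bnd _ x1) _.
    by case/andP: (sqrt_iterR_bound n).
  have yz : bnd (y - z) e by apply: bnd_le (yd n) _; exact: ltW.
  apply: (@bnd_le _ _ _ (e + 2^-1 * (1 * e + e * 1))); last by lra.
  apply: bndB.
    by apply: bnd_le (yd _) _; rewrite (le_trans _ (ltW dn))//; exact: dd.
  by apply: bndZ; rewrite ?invr_ge0//; apply: bndD; exact: bndM.
exists y, d; split => //.
- apply/eqP; rewrite -subr_eq0; apply/eqP; apply: (@bnd_eq0 _ _ _ 2) => e e0.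
  have [n dn] := Tt _ e0.
  have yz : bnd (y - sqrt_iter x n) e by apply: bnd_le (yd n) _; exact: ltW.
  have -> : star y - y = star (y - sqrt_iter x n) - (y - sqrt_iter x n).
    by rewrite starB sqrt_iter_star//; lmodule R[i].
  by rewrite mulr2n mulrDl mul1r; apply: bndB => //; exact: bnd_star.
- have -> : x = (2 : R)%:C *: y - y ** y.
    by rewrite {1}y_fix; lmodule R[i].
  by rewrite !smul1E; lmodule R[i].
- move=> z c zc zx.
  apply/eqP; rewrite -subr_eq0; apply/eqP.
  apply: (@bnd_eq0 _ _ _ (c + c)) => e e0; have [n dn] := Tt _ e0.
  have yz : bnd (y - sqrt_iter x n) e by apply: bnd_le (yd n) _; exact: ltW.
  have /(sqrt_iter_commute n) zn := zx.
  have -> : z ** y - y ** z =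
      z ** (y - sqrt_iter x n) - (y - sqrt_iter x n) ** z.
    by rewrite !smulE zn; lmodule R[i].
  by rewrite mulrDl; apply: bndB; [|rewrite mulrC]; exact: bndM.
Qed.

(** The root is 1 - y, with y the limit of the iteration at 1 - h. The bound on [sone - h] stands in
    for a condition on the spectrum. *)
Lemma sqrt_sone_sub h : star h = h -> bnd (sone - h) 1 ->
  exists k : multiplier A, [/\ star k = k, bnd (sone - k) 1, k ** k = h &
    forall z c, bnd z c -> commute z h -> commute z k].
Proof.
move=> hh h1.
have [|y [d [y1 yy yh yc _]]] := sqrt_iter_lim _ h1.
  by rewrite starB star1 hh.
exists (sone - y); split.
- by rewrite starB star1 yy.
- by rewrite subKr.
- by rewrite yh subKr.
- move=> z c zc zh; apply: commuteB; first exact: commute1.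
  by apply: yc zc _; apply: commuteB => //; exact: commute1.
Qed.

(** This is 1 - a = (1 - b)^2 without a unit. Iterates of an element of [A] stay in [A], so [b] is
    found where a homomorphism defined only on [A] can be applied to it. *)
Lemma sqrt_quasi (a : A) : star a = a -> rnorm a <= 1 ->
  exists2 b : A, star b = b & b + b - b ** b = a.
Proof.
move=> aa a1; have [_ embM embS] := mult_embed_star_hom A.
have [||y [d [_ yy yx _ [d0 dd yd]]]] := @sqrt_iter_lim (mult_embed a).
- by rewrite -embS aa.
- exact: bnd_le (bnd_embed a) a1.
have iterE n : sqrt_iter (mult_embed a) n = mult_embed (sqrt_iter a n).
  elim: n => /= [|n ->]; first by apply: mull_inj => b /=; rewrite smul0l.
  by apply: mull_inj => b /=; rewrite smulZl smulDl smulA.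
have [b yb] : exists b, y = mult_embed b.
  apply: (embed_closed (u := sqrt_iter a) d0 dd) => n.
  by rewrite -iterE.
exists b; apply: mult_embed_inj; first by rewrite embS -yb yy.
have -> : mult_embed a = y + y - y ** y.
  rewrite -[mult_embed a](subKr sone) -yx !smul1E; lmodule R[i].
by rewrite yb; apply: mull_inj => c /=; rewrite !smulE.
Qed.

End SquareRootIteration.

(** * Positive multipliers *)

Section Positivity.
Variables (R : realType) (A : cstarAlgType R).
Implicit Types (a b h k l m w x y z : multiplier A) (c d r M : R).

Definition bounded m := exists c, bnd m c.

Definition pos h := exists k, [/\ star k = k, bounded k & k ** k = h].

Lemma boundedD x y : bounded x -> bounded y -> bounded (x + y).
Proof. by move=> [c xc] [d yd]; exists (c + d); exact: bndD. Qed.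

Lemma boundedN x : bounded x -> bounded (- x).
Proof. by move=> [c xc]; exists c; exact: bndN. Qed.

Lemma boundedB x y : bounded x -> bounded y -> bounded (x - y).
Proof. by move=> bx b_y; apply/boundedD/boundedN. Qed.

Lemma boundedM x y : bounded x -> bounded y -> bounded (x ** y).
Proof. by move=> [c xc] [d yd]; exists (c * d); exact: bndM. Qed.

Lemma bounded_i x : bounded x -> bounded ('i *: x).
Proof. by move=> [c xc]; exists c; exact: bnd_i. Qed.

Lemma bounded_star x : bounded x -> bounded (star x).
Proof. by move=> [c xc]; exists c; exact: bnd_star. Qed.

Lemma boundedZ r x : bounded x -> bounded (r%:C *: x).
Proof.
move=> [c xc]; have [r0|r0] := leP 0 r; first by exists (r * c); exact: bndZ.
exists (- r * c); rewrite -[r]opprK rmorphN scaleNr; apply: bndN.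
by rewrite opprK; apply: bndZ => //; rewrite oppr_ge0 ltW.
Qed.

Lemma bounded1 : bounded sone. Proof. by exists 1; exact: bnd1. Qed.

Lemma bounded_pos x : bounded x -> exists2 c, 0 < c & bnd x c.
Proof.
move=> [c xc]; exists (c + 1); first by rewrite ltr_wpDl//; case: xc.
by apply: bnd_le xc _; rewrite lerDl.
Qed.

Lemma star_i (U : starAlgType R) (x : U) : star ('i *: x) = - ('i *: star x).
Proof. by rewrite starZ conjCi scaleNr. Qed.

Lemma scale_ii (U : starAlgType R) (x : U) : 'i *: ('i *: x) = - x.
Proof. by rewrite scalerA -expr2 sqrCi scaleN1r. Qed.

Lemma star_smul_addi k m : star k = k -> star m = m -> commute k m ->
  star (k + 'i *: m) ** (k + 'i *: m) = k ** k + m ** m.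
Proof.
move=> kk mm km; rewrite starD star_i kk mm !smulE -km scale_ii.
by lmodule R[i].
Qed.

(* [k] and [m] are the real and imaginary parts of the normal element         *)
(* [k + i m], whose square of the norm is that of [k^2 + m^2].                *)
Lemma bnd_sum_squares k m c : star k = k -> star m = m -> commute k m ->
  0 <= c -> bnd (k ** k + m ** m) (c ^+ 2) -> bnd k c.
Proof.
move=> kk mm km c0 kmc; set u := k + 'i *: m.
have uc : bnd u c by apply: bnd_cstar => //; rewrite star_smul_addi.
have -> : k = (2^-1 : R)%:C *: (u + star u).
  by rewrite /u starD star_i kk mm; lmodule R[i].
apply: (@bnd_le _ _ _ (2^-1 * (c + c))); last by lra.
by apply: bndZ; rewrite ?invr_ge0//; apply: bndD => //; exact: bnd_star.
Qed.

(** Write 1 - k^2 = m^2 with m commuting with k; then m^2 + k^2 = 1 bounds m by 1. *)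
Lemma bnd_sone_sub_square k :
  star k = k -> bnd k 1 -> bnd (sone - k ** k) 1.
Proof.
move=> kk k1; have kk1 : bnd (k ** k) 1 by rewrite -[1]mul1r; exact: bndM.
have [||m [mm _ mE mc]] := @sqrt_sone_sub _ _ (sone - k ** k).
- by rewrite starB star1 starM kk.
- by rewrite subKr.
rewrite -mE -[1]mul1r.
have km : commute k m.
  by apply: mc k1 _; apply: commuteB; [exact: commute1|exact: commuteM].
suff m1 : bnd m 1 by exact: bndM.
apply: (@bnd_sum_squares m k) => //.
by rewrite mE subrK expr1n; exact: bnd1.
Qed.

Lemma pos_star h : pos h -> star h = h.
Proof. by move=> [k [kk _ <-]]; rewrite starM kk. Qed.

Lemma pos_bounded h : pos h -> bounded h.
Proof. by move=> [k [_ bk <-]]; exact: boundedM. Qed.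

Lemma pos_square k : star k = k -> bounded k -> pos (k ** k).
Proof. by move=> kk bk; exists k. Qed.

Lemma pos0 : pos 0.
Proof. by exists 0; split; rewrite ?star0 ?smul_0l//; exists 0; exact: bnd0. Qed.

Lemma posZ r h : 0 <= r -> pos h -> pos (r%:C *: h).
Proof.
move=> r0 [k [kk bk <-]]; exists ((Num.sqrt r)%:C *: k); split.
- by rewrite starZr kk.
- exact: boundedZ.
- by rewrite smulZl smulZr scalerA -rmorphM -expr2 sqr_sqrtr.
Qed.

(** With [pos_of_bnd] this is a norm criterion for positivity, which makes sums tractable in [posD].
    The C*-identity bounds the root of [h] by the root of [c]. *)
Lemma pos_bnd_sone h c : pos h -> bnd h c -> 0 < c ->
  bnd (sone - (c^-1)%:C *: h) 1.
Proof.
move=> [k [kk bk <-]] hc c0; set r := Num.sqrt c.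
have r0 : 0 < r by rewrite sqrtr_gt0.
have kr : bnd k r.
  by apply: bnd_cstar; rewrite ?ltW// kk sqr_sqrtr ?ltW.
have -> : (c^-1)%:C *: (k ** k) = ((r^-1)%:C *: k) ** ((r^-1)%:C *: k).
  rewrite smulZl smulZr scalerA -rmorphM; congr (_%:C *: _).
  by rewrite -invfM -expr2 sqr_sqrtr ?ltW.
apply: bnd_sone_sub_square; first by rewrite starZr kk.
by rewrite -(@mulVf _ r) ?gt_eqF//; apply: bndZ => //; rewrite invr_ge0 ltW.
Qed.

Lemma sqrt_of_bnd h c : star h = h -> 0 < c ->
  bnd (sone - (c^-1)%:C *: h) 1 ->
  exists k, [/\ star k = k, bounded k, k ** k = h &
    forall z, bounded z -> commute z h -> commute z k].
Proof.
move=> hh c0 hc.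
have [|k [kk k1 kh kc]] := sqrt_sone_sub _ hc; first by rewrite starZr hh.
have bk : bounded k.
  by rewrite -(subKr sone k); apply: boundedB; [exact: bounded1|exists 1].
exists ((Num.sqrt c)%:C *: k); split.
- by rewrite starZr kk.
- exact: boundedZ.
- rewrite smulZl smulZr kh !scalerA -!rmorphM -expr2 sqr_sqrtr ?ltW//.
  by rewrite divff ?gt_eqF// rmorph1 scale1r.
- by move=> z [d zd] zh; apply/commuteZ/(kc _ _ zd)/commuteZ.
Qed.

Lemma pos_of_bnd h c : star h = h -> 0 < c ->
  bnd (sone - (c^-1)%:C *: h) 1 -> pos h.
Proof.
by move=> hh c0 /(sqrt_of_bnd hh c0)[k [kk bk kh _]]; exists k.
Qed.

Lemma pos_sqrt h : pos h -> exists k, [/\ star k = k, bounded k, k ** k = h &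
  forall z, bounded z -> commute z h -> commute z k].
Proof.
move=> ph; have [c c0 hc] := bounded_pos (pos_bounded ph).
exact: sqrt_of_bnd (pos_star ph) c0 (pos_bnd_sone ph hc c0).
Qed.

(** Convexity of the norm criterion: the element it tests for g + h, at twice the common bound c +
    d, is the average of those for g and for h. *)
Lemma posD g h : pos g -> pos h -> pos (g + h).
Proof.
move=> pg ph.
have [c c0 gc] := bounded_pos (pos_bounded pg).
have [d d0 hd] := bounded_pos (pos_bounded ph).
have cd0 := addr_gt0 c0 d0.
have gcd : bnd g (c + d) by apply: bnd_le gc _; rewrite lerDl ltW.
have hcd : bnd h (c + d) by apply: bnd_le hd _; rewrite lerDr ltW.
apply: (@pos_of_bnd _ ((c + d) * 2)); rewrite ?mulr_gt0//.
  by rewrite starD !pos_star.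
have -> : sone - (((c + d) * 2)^-1)%:C *: (g + h) = (2^-1 : R)%:C *:
    ((sone - ((c + d)^-1)%:C *: g) + (sone - ((c + d)^-1)%:C *: h)).
  by rewrite invfM; move: (c + d)^-1 => e; lmodule R[i].
apply: (@bnd_le _ _ _ (2^-1 * (1 + 1))); last by lra.
by apply: bndZ; rewrite ?invr_ge0//; apply: bndD; exact: pos_bnd_sone.
Qed.

Lemma pos_smul g h : pos g -> pos h -> commute g h -> pos (g ** h).
Proof.
move=> pg ph gh; have [k [kk bk kg kc]] := pos_sqrt pg.
have [l [ll bl lh lc]] := pos_sqrt ph.
have kl : commute k l.
  by apply/lc/commute_sym/kc/commute_sym => //; exact: pos_bounded.
exists (k ** l); split; first by rewrite starM kk ll.
- exact: boundedM.
- by rewrite -kg -lh -!smulA; congr (_ ** _); rewrite !smulA kl.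
Qed.

(** If h = k^2 and - h = l^2 with commuting k and l, then (k + i l)^* (k + i l) = 0, so k + i l and
    its real part k vanish. *)
Lemma pos_anti h : pos h -> pos (- h) -> h = 0.
Proof.
move=> ph pnh; have [k [kk bk kh kc]] := pos_sqrt ph.
have [l [ll bl lh lc]] := pos_sqrt pnh.
have kl : commute k l by apply: lc => //; apply/commuteN; rewrite -kh; exact: commuteM.
have u0 : k + 'i *: l = 0.
  by apply: mult_star_smul_eq0; rewrite star_smul_addi// kh lh subrr.
have : k + k = (k + 'i *: l) + star (k + 'i *: l).
  by rewrite starD star_i kk ll; lmodule R[i].
rewrite u0 star0 addr0 => k0; rewrite -kh.
have -> : k = (2^-1 : R)%:C *: (k + k) by lmodule R[i].
by rewrite k0 scaler0 smul_0l.
Qed.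

(** With a = k^2 and M - a = l^2, the relation k^2 + l^2 = M bounds k by the root of M. *)
Lemma pos_sub_bnd a M : pos a -> 0 <= M -> pos (M%:C *: sone - a) -> bnd a M.
Proof.
move=> pa M0 pMa; have [k [kk bk ka kc]] := pos_sqrt pa.
have [l [ll bl la lc]] := pos_sqrt pMa.
have kl : commute k l.
  apply: lc => //; apply: commuteB; first by apply/commuteZ/commute1.
  by rewrite -ka; exact: commuteM.
have kM : bnd k (Num.sqrt M).
  apply: (bnd_sum_squares kk ll kl); rewrite ?sqrtr_ge0//.
  rewrite ka la addrC subrK sqr_sqrtr// -{2}[M]mulr1.
  by apply: bndZ => //; exact: bnd1.
by rewrite -ka -{1}(sqr_sqrtr M0) expr2; exact: bndM.
Qed.

Lemma pos_bnd_sub a M : pos a -> bnd a M -> 0 < M -> pos (M%:C *: sone - a).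
Proof.
move=> pa aM M0; apply: (@pos_of_bnd _ M) => //.
  by rewrite starB starZr star1 pos_star.
rewrite (_ : _ - _ = (M^-1)%:C *: a).
  by rewrite -(@mulVf _ M) ?gt_eqF//; apply: bndZ => //; rewrite invr_ge0 ltW.
by lmodule R[i].
Qed.

Lemma pos_mono a b M : pos a -> pos b -> bnd (a + b) M -> 0 < M -> bnd a M.
Proof.
move=> pa pb abM M0; apply: pos_sub_bnd; rewrite ?ltW//.
have -> : M%:C *: sone - a = (M%:C *: sone - (a + b)) + b by lmodule R[i].
by apply: posD => //; apply: pos_bnd_sub => //; exact: posD.
Qed.

(* With [Y = y z], both [Y Y^*] and [Y^* Y] are negative, while               *)
(* [Y Y^* + Y^* Y] is positive.                                               *)
Lemma star_smul_opp_square y z : bounded y -> bounded z -> star z = z ->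
  star y ** y = - (z ** z) -> y = 0.
Proof.
move=> b_y bz zz yz; set Y := y ** z; set w := y ** star y.
have ww : star w = w by rewrite starM starK.
have bw : bounded w by apply/boundedM/bounded_star.
have YY : Y ** star Y = - (w ** w).
  have -> : w ** w = y ** (star y ** y) ** star y by rewrite !smulAr.
  by rewrite yz starM zz !smulE opprK.
have YY' : star Y ** Y = - ((z ** z) ** (z ** z)).
  rewrite starM zz; have -> : z ** star y ** Y = z ** (star y ** y) ** z.
    by rewrite !smulAr.
  by rewrite yz !smulE.
have bY : bounded Y by exact: boundedM.
have bY' : bounded (star Y) by exact: bounded_star.
have pYY : pos (star Y ** Y + Y ** star Y).
  (* The real and imaginary parts of [Y]. *)
  pose p := (2^-1 : R)%:C *: (Y + star Y).
  pose q := (2^-1 : R)%:C *: ('i *: (star Y - Y)).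
  have -> : star Y ** Y + Y ** star Y = (2 : R)%:C *: (p ** p + q ** q).
    rewrite /p /q !smulE.
    by lmodule_coefs R[i]; field: (@sqrCi R[i]).
  apply/posZ/posD => //; apply: pos_square; rewrite /p /q.
  - by rewrite starZr starD starK addrC.
  - by apply/boundedZ/boundedD.
  - by rewrite starZr star_i starB starK -scalerN opprB.
  - by apply/boundedZ/bounded_i/boundedB.
(* z^4 is positive, and - z^4 = Y^* Y is the sum of the positive elements Y^* Y + Y Y^* and w^2. *)
have z4 : (z ** z) ** (z ** z) = 0.
  apply: pos_anti; first by apply: pos_square; [rewrite starM zz|exact: boundedM].
  rewrite -YY'; have -> : star Y ** Y = (star Y ** Y + Y ** star Y) + w ** w.
    by rewrite YY; lmodule R[i].
  by apply: posD => //; exact: pos_square.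
have z2 : z ** z = 0 by apply: mult_star_smul_eq0; rewrite starM zz.
by apply: mult_star_smul_eq0; rewrite yz z2 oppr0.
Qed.

(** Scale x^* x to g with norm at most 1 and let r be the root of g^2, the absolute value of g. Then
    w = r - g is twice the negative part of g, and g w = - r w. With s the root of r, (x w)^* (x w)
    = - c (s w)^2, so x w = 0 by [star_smul_opp_square]. Hence g w = 0, w^2 = 0 and g = r = s^2. *)
Lemma pos_star_smul x : bounded x -> pos (star x ** x).
Proof.
move=> bx; set h := star x ** x.
have hh : star h = h by rewrite starM starK.
have bh : bounded h by apply/boundedM => //; exact: bounded_star.
have [c c0 hc] := bounded_pos bh.
pose g := (c^-1)%:C *: h.
have gg : star g = g by rewrite starZr hh.
have g1 : bnd g 1.
  by rewrite -(@mulVf _ c) ?gt_eqF//; apply: bndZ => //; rewrite invr_ge0 ltW.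
suff pg : pos g.
  have -> : h = c%:C *: g.
    by rewrite scalerA -rmorphM divff ?gt_eqF// rmorph1 scale1r.
  by apply: posZ => //; rewrite ltW.
have [||r [rr r1 rg rc]] := @sqrt_sone_sub _ _ (g ** g).
- by rewrite starM gg.
- exact: bnd_sone_sub_square.
have [s [ss s1 sr sc]] := sqrt_sone_sub rr r1.
have br : bounded r.
  by rewrite -(subKr sone r); apply: boundedB; [exact: bounded1|exists 1].
have bs : bounded s.
  by rewrite -(subKr sone s); apply: boundedB; [exact: bounded1|exists 1].
have gr : commute g r by apply: rc g1 _; exact: commuteM.
have gs : commute g s by exact: sc g1 gr.
have rs : commute r s.
  by have [d rd] := br; apply: sc rd _.
set w := r - g.
have ww : star w = w by rewrite starB rr gg.
have bw : bounded w by apply: boundedB => //; exists 1.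
have sw : commute s w by apply: commuteB; exact: commute_sym.
have gw : g ** w = - (r ** w).
  by rewrite /w 2!smulDr 2!smul_Nr rg gr opprB.
have y0 : x ** w = 0.
  apply: (@star_smul_opp_square _ ((Num.sqrt c)%:C *: (s ** w))).
  - exact: boundedM.
  - by apply/boundedZ/boundedM.
  - by rewrite starZr starM ss ww sw.
  have -> : star (x ** w) ** (x ** w) = c%:C *: (w ** (g ** w)).
    rewrite starM ww /g smulZl smulZr scalerA -rmorphM divff ?gt_eqF// rmorph1.
    by rewrite scale1r !smulAr.
  rewrite gw smulZl smulZr scalerA -rmorphM -expr2 sqr_sqrtr ?ltW//.
  rewrite smul_Nr scalerN -sr; congr (- (_ *: _)).
  by move: (w) sw => v sv; rewrite [X in _ = X ** _]sv !smulA.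
have w2 : w ** w = 0.
  have -> : w ** w = - (g ** w + g ** w).
    by rewrite {1}/w smulDl smul_Nl gw; lmodule R[i].
  have -> : g ** w = (c^-1)%:C *: (star x ** (x ** w)).
    by rewrite /g /h smulZl !smulAr.
  by rewrite y0 smul_0r scaler0 addr0 oppr0.
have w0 : w = 0 by apply: mult_star_smul_eq0; rewrite ww.
have -> : g = r by apply/esym/eqP; rewrite -subr_eq0 -/w w0.
by exists s.
Qed.

End Positivity.

(** * Closed ideals *)

Section ClosedIdeals.
Variables (R : realType) (B : cstarAlgType R).
Implicit Types (x y b p : B) (h k q m n : multiplier B).

Record closed_star_ideal (J : set B) : Prop := {
  csiD : forall x y, J x -> J y -> J (x + y);
  csiZ : forall (c : R[i]) x, J x -> J (c *: x);
  csiMl : forall b x, J x -> J (b ** x);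
  csiMr : forall b x, J x -> J (x ** b);
  csi_star : forall x, J x -> J (star x);
  csi_closure : closure J `<=` J;
  csi0 : J 0
}.

Variable J : set B.
Hypothesis J_ideal : closed_star_ideal J.

Lemma csiN x : J x -> J (- x).
Proof. by move=> Jx; rewrite -scaleN1r; apply: csiZ. Qed.

(* If [0 <= h <= M] then [0 <= h (1 - h / 2M) <= M / 2]; iterate. *)
Lemma ideal_approx_unit i h (M : R) : pos h -> bnd h M -> 0 < M ->
  (forall b, J (mulr h b)) ->
  exists q, [/\ bnd q 1, bnd (h ** q) (M / 2 ^+ i) &
    forall b, J (mulr q b - b)].
Proof.
elim: i h M => [|i IH] h M ph hM M0 Jh.
  exists sone; rewrite smul1r expr0 divr1; split => //; first exact: bnd1.
  by move=> b; rewrite subrr; exact: csi0.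
pose t := (2 * M)^-1; have t0 : 0 < t by rewrite invr_gt0 mulr_gt0.
pose g : multiplier B := sone - t%:C *: h.
have pg : pos g.
  have -> : g = t%:C *: ((2 * M)%:C *: sone - h).
    by rewrite /g /t; lmodule R[i].
  apply: posZ; rewrite ?ltW//; apply: pos_bnd_sub => //; last exact: mulr_gt0.
  by apply: bnd_le hM _; rewrite ler_peMl ?ltW// ltr1n.
have hg : commute h g.
  by apply: commuteB; [exact: commute1|exact: commuteZ].
have g1 : bnd g 1.
  apply: pos_sub_bnd => //; rewrite rmorph1 scale1r subKr.
  by apply: posZ => //; exact: ltW.
have phg : pos (h ** g) by exact: pos_smul.
have hgM : bnd (h ** g) (M / 2).
  apply: pos_sub_bnd => //; first by rewrite divr_ge0 ?ltW.
  have -> : (M / 2)%:C *: sone - h ** g =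
      t%:C *: ((M%:C *: sone - h) ** (M%:C *: sone - h)).
    by rewrite /g /t !smul1E; lmodule R[i].
  apply: posZ; rewrite ?ltW//; apply: pos_square.
    by rewrite starB starZr star1 pos_star.
  apply: boundedB; first by apply: boundedZ; exact: bounded1.
  exact: pos_bounded.
have M2 : 0 < M / 2 by rewrite divr_gt0.
have [|q [q1 hq Jq]] := IH (h ** g) (M / 2) phg hgM M2.
  by move=> b; rewrite hg; exact: Jh.
exists (g ** q); split.
- by rewrite -[1]mul1r; exact: bndM.
- by rewrite smulA exprS invfM mulrA.
move=> b; have -> : mulr (g ** q) b - b =
    (mulr q (mulr g b) - mulr g b) - t%:C *: mulr h b.
  transitivity (mulr q (mulr g b) - (b - t%:C *: mulr h b) - t%:C *: mulr h b).
    by lmodule R[i].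
  by [].
by apply: csiD => //; apply: csiN; exact: csiZ.
Qed.

Lemma mult_embed_mulr q b : mult_embed (mulr q b) = mult_embed b ** q.
Proof.
by apply: mull_inj => c /=; rewrite mulrl.
Qed.

(** The multiplier q that [ideal_approx_unit] gives for j^2 makes j q small while b - b q lies in J.
    Compressing b^* b + p + j by q then leaves (b q)^* (b q) + q^* p q small, and dropping the
    positive second term bounds b q. *)
Lemma mem_ideal_of_approx b :
  (forall e : R, 0 < e -> exists p j, [/\ pos (mult_embed p), J j, star j = j &
     rnorm (star b ** b + p + j) <= e]) -> J b.
Proof.
move=> bJ; apply: (csi_closure J_ideal); apply/closure_rnormP => e0 e00.
(* Chosen so that 4 e = (e0 / 2)^2, the bound wanted for (b q)^* (b q). *)
pose e := e0 ^+ 2 / 16; have e_gt0 : 0 < e by rewrite divr_gt0 ?exprn_gt0.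
have [p [j [pp Jj jj bpj]]] := bJ _ e_gt0.
have [embD embM embS] := mult_embed_star_hom B.
pose h := mult_embed (j ** j).
have ph : pos h.
  by rewrite /h embM -{1}jj embS; apply: pos_star_smul; eexists; exact: bnd_embed.
pose M := rnorm (j ** j) + 1.
have M0 : 0 < M by rewrite ltr_wpDl ?rnorm_ge0.
have hM : bnd h M by apply: bnd_le (bnd_embed _) _; rewrite lerDl.
have [i iM] : exists i, M / 2 ^+ i <= e ^+ 2.
  have e2 : 0 < e ^+ 2 by rewrite exprn_gt0.
  exists (Num.bound (M / e ^+ 2)).
  rewrite ler_pdivrMr ?exprn_gt0// mulrC -ler_pdivrMr//.
  apply: (le_trans (ltW (archi_boundP _))); first by rewrite divr_ge0 ?ltW.
  by rewrite -natrX ler_nat ltnW// ltn_expl.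
have [|q [q1 hq Jq]] := ideal_approx_unit i ph hM M0.
  by move=> c /=; apply: csiMl => //; exact: csiMl.
have jq : bnd (mult_embed j ** q) e.
  apply: bnd_cstar; rewrite ?ltW//.
  rewrite starM -embS jj -[_ ^+ 2]mul1r !smulAr; apply: bndM.
    exact: bnd_star.
  by rewrite smulA -embM; exact: bnd_le iM.
have qjq : bnd (star q ** (mult_embed j ** q)) e.
  by rewrite -[e]mul1r; apply: bndM => //; exact: bnd_star.
have bq : bnd (mult_embed b ** q) (e0 / 2).
  apply: bnd_cstar; first by rewrite divr_ge0 ?ltW.
  rewrite [_ ^+ 2](_ : _ = e * 4); last by rewrite /e; field.
  apply: (@bnd_le _ _ _ (e * 4)) => //.
  apply: (@pos_mono _ _ _ (star q ** mult_embed p ** q)).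
  - by apply: pos_star_smul; apply: boundedM; eexists; [exact: bnd_embed|exact: q1].
  - have [k [kk bk <-]] := pp.
    have -> : star q ** (k ** k) ** q = star (k ** q) ** (k ** q).
      by rewrite starM kk !smulAr.
    by apply: pos_star_smul; apply: boundedM => //; exists 1.
  - have -> : star (mult_embed b ** q) ** (mult_embed b ** q) +
        star q ** mult_embed p ** q =
        star q ** mult_embed (star b ** b + p + j) ** q -
        star q ** (mult_embed j ** q).
      have embA x y : mult_embed (x + y) = mult_embed x + mult_embed y.
        by rewrite -[x]scale1r embD !scale1r.
      by rewrite !embA embM embS starM !smulE; lmodule R[i].
    apply: (@bnd_le _ _ _ (1 * e * 1 + e)); last by lra.
    apply: bndB => //; apply: bndM => //; apply: bndM; first exact: bnd_star.
    exact: bnd_le (bnd_embed _) bpj.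
  - exact: mulr_gt0.
exists (b - mulr q b).
  by rewrite -opprB; apply: csiN; exact: Jq.
rewrite subKr; apply: (@le_lt_trans _ _ (e0 / 2)).
  by apply: bnd_embed_le; rewrite mult_embed_mulr.
by rewrite ltr_pdivrMr// ltr_pMr// ltr1n.
Qed.

End ClosedIdeals.

(** * The Hahn-Banach theorem *)

Section HahnBanach.
Variables (R : realType) (V : lmodType R[i]).
Implicit Types (p q : V -> R) (x y : V).

Definition sublinear p :=
  (forall x y, p (x + y) <= p x + p y) /\
  (forall (r : R) x, 0 < r -> p (r%:C *: x) <= r * p x).

Lemma sublinear0 p : sublinear p -> p 0 = 0.
Proof.
move=> [_ pZ]; have := pZ 2 0 (ltr0n _ 2); have := pZ 2^-1 0.
by rewrite !scaler0 invr_gt0 => /(_ (ltr0n _ 2)); lra.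
Qed.

Lemma sublinearN p x : sublinear p -> - p (- x) <= p x.
Proof.
move=> sp; have [pD _] := sp; have := pD x (- x).
by rewrite subrr sublinear0//; lra.
Qed.

Lemma sublinearZ p (r : R) x : sublinear p -> 0 < r -> p (r%:C *: x) = r * p x.
Proof.
move=> [_ pZ] r0; apply/eqP; rewrite eq_le pZ//=.
have := pZ r^-1 (r%:C *: x); rewrite invr_gt0 => /(_ r0).
by rewrite scalerA -rmorphM mulVf ?gt_eqF// rmorph1 scale1r ler_pdivlMl.
Qed.

(** A sublinear functional below [p] whose value at [- y] is at most [- p y]. Hence a linear
    functional below it takes the value [p y] at [y]. *)
Definition sublinear_shift p y x :=
  inf [set p (x + t%:C *: y) - t * p y | t in [set t : R | 0 <= t]].

Lemma sublinear_shift_lb p y x : sublinear p ->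
  lbound [set p (x + t%:C *: y) - t * p y | t in [set t : R | 0 <= t]]
    (- p (- x)).
Proof.
move=> sp _ [t /= t0 <-]; have [pD _] := sp.
have := pD (x + t%:C *: y) (- x); rewrite addrAC subrr add0r.
have [->|tn0] := eqVneq t 0.
  by rewrite scale0r addr0 sublinear0// mul0r subr0; have := sublinearN x sp; lra.
by rewrite sublinearZ// ?lt_def ?tn0//; lra.
Qed.

Lemma sublinear_shift_le p y x (t : R) : sublinear p -> 0 <= t ->
  sublinear_shift p y x <= p (x + t%:C *: y) - t * p y.
Proof.
move=> sp t0; apply: ge_inf; first by eexists; exact: sublinear_shift_lb.
by exists t.
Qed.

Lemma le_sublinear_shift p y x z :
  (forall t : R, 0 <= t -> z <= p (x + t%:C *: y) - t * p y) ->
  z <= sublinear_shift p y x.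
Proof.
move=> zp; apply: lb_le_inf; last by move=> _ [t /= t0 <-]; exact: zp.
by exists (p (x + (0 : R)%:C *: y) - 0 * p y); exists 0 => /=.
Qed.

Lemma sublinear_shift_sublinear p y :
  sublinear p -> sublinear (sublinear_shift p y).
Proof.
move=> sp; have [pD pZ] := sp; split=> [x x'|r x r0].
  rewrite -lerBlDr; apply: le_sublinear_shift => t t0.
  rewrite lerBlDr -lerBlDl; apply: le_sublinear_shift => s s0.
  rewrite lerBlDl (le_trans (@sublinear_shift_le _ _ _ (s + t) sp (addr_ge0 s0 t0)))//.
  have := pD (x' + s%:C *: y) (x + t%:C *: y).
  have -> : x + x' + (s + t)%:C *: y = x' + s%:C *: y + (x + t%:C *: y).
    by rewrite rmorphD scalerDl [x + _]addrC addrACA.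
  by lra.
rewrite -ler_pdivrMl//; apply: le_sublinear_shift => t t0.
rewrite ler_pdivrMl//.
rewrite (le_trans (@sublinear_shift_le _ _ _ (r * t) sp (mulr_ge0 (ltW r0) t0)))//.
rewrite rmorphM -scalerA -scalerDr.
by have := pZ r (x + t%:C *: y) r0; lra.
Qed.

Lemma sublinear_shift_le_self p y x : sublinear p ->
  sublinear_shift p y x <= p x.
Proof.
move=> sp; have := sublinear_shift_le y x sp (lexx 0).
by rewrite scale0r addr0 mul0r subr0.
Qed.

(** Zorn's lemma for the reversed pointwise order: a non-empty chain is bounded by its pointwise
    infimum, which is finite because [- p (- x)] is a lower bound at [x]. *)
Lemma sublinear_minimal p : sublinear p -> exists q,
  [/\ sublinear q, (forall x, q x <= p x) &
   forall q', sublinear q' -> (forall x, q' x <= q x) -> q' = q].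
Proof.
move=> sp; pose T := {q : V -> R | sublinear q /\ forall x, q x <= p x}.
pose le (q q' : T) := `[< forall x, sval q' x <= sval q x >].
have [| | |C totC|q qmin] := @Zorn T le.
- by move=> t; apply/asboolP.
- move=> r s t /asboolP rs /asboolP st; apply/asboolP => x.
  exact: le_trans (st x) (rs x).
- move=> s t /asboolP st /asboolP ts.
  apply: eq_sig_hprop => [? ? ?|]; first exact: Prop_irrelevance.
  by apply/funext => x; apply/eqP; rewrite eq_le st ts.
- have [[q0 Cq0]|/set0P/negP/negPn/eqP C0] := pselect (C !=set0); last first.
    have pp : sublinear p /\ forall x, p x <= p x by [].
    by exists (exist _ p pp) => s; rewrite C0.
  pose S x := [set sval (q : T) x | q in C].
  pose m x := inf (S x).
  have lbS x : has_lbound (S x).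
    exists (- p (- x)) => _ [q Cq <-]; have [sq qp] := svalP q.
    by rewrite (le_trans _ (sublinearN x sq))// lerN2.
  have mC x (q : T) : C q -> m x <= sval q x by move=> Cq; apply: ge_inf => //; exists q.
  have mP x z : (forall q : T, C q -> z <= sval q x) -> z <= m x.
    move=> zq; apply: lb_le_inf; first by exists (sval q0 x), q0.
    by move=> _ [q Cq <-]; exact: zq.
  have mp : sublinear m /\ forall x, m x <= p x.
    split; last by move=> x; rewrite (le_trans (mC x q0 Cq0))//; case: (svalP q0).
    split=> [x y|r x r0].
      rewrite -lerBlDr; apply/mP => q Cq; rewrite lerBlDr -lerBlDl.
      apply/mP => q' Cq'; rewrite lerBlDl.
      (* Two members of the chain are comparable, and the smaller one serves both summands. *)
      have [/asboolP le'|/asboolP le'] := totC q q' Cq Cq'.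
        have [[qD _] _] := svalP q'.
        rewrite (le_trans (mC _ _ Cq'))// (le_trans (qD _ _))// lerD2r.
        exact: le'.
      have [[qD _] _] := svalP q.
      rewrite (le_trans (mC _ _ Cq))// (le_trans (qD _ _))// lerD2l.
      exact: le'.
    rewrite -ler_pdivrMl//; apply/mP => q Cq; rewrite ler_pdivrMl//.
    by rewrite (le_trans (mC _ _ Cq))//; have [[_ qZ] _] := svalP q; exact: qZ.
  by exists (exist _ m mp) => s Cs; apply/asboolP => x /=; exact: mC.
exists (sval q); have [sq qp] := svalP q; split=> // q' sq' q'q.
have q'p : sublinear q' /\ forall x, q' x <= p x.
  by split=> // x; exact: le_trans (q'q x) (qp x).
by have /(congr1 sval) := qmin (exist _ q' q'p) (asboolT q'q).
Qed.

(* A minimal sublinear functional [q] coincides with its shift by any [y], so *)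
(* [q x <= q (x + y) - q y]. *)
Theorem hahn_banach p y : sublinear p -> exists f : V -> R,
  [/\ forall x x', f (x + x') = f x + f x',
      forall (r : R) x, f (r%:C *: x) = r * f x,
      forall x, f x <= p x & f y = p y].
Proof.
move=> sp; have [f [sf fp fmin]] := sublinear_minimal (sublinear_shift_sublinear y sp).
have [fD fZ] := sf.
have fA x x' : f (x + x') = f x + f x'.
  apply/eqP; rewrite eq_le fD -lerBrDr /=.
  have fx' : sublinear_shift f x' = f.
    apply: fmin; first exact: sublinear_shift_sublinear.
    by move=> z; exact: sublinear_shift_le_self.
  have := sublinear_shift_le x' x sf (ler0n R 1).
  by rewrite fx' rmorph1 scale1r mul1r.
have fN x : f (- x) = - f x.
  by apply/eqP; rewrite -addr_eq0 -fA addNr sublinear0.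
have flep x : f x <= p x.
  by rewrite (le_trans (fp x))// sublinear_shift_le_self.
exists f; split=> // [r x|].
  have [r0|r0|<-] := ltgtP 0 r; first exact: sublinearZ.
    rewrite -[r]opprK rmorphN scaleNr fN sublinearZ ?oppr_gt0//.
    by rewrite !mulNr.
  by rewrite scale0r mul0r sublinear0.
apply/eqP; rewrite eq_le flep /= -[f y]opprK -fN lerNr (le_trans (fp _))//.
have := sublinear_shift_le y (- y) sp (ler0n R 1).
by rewrite rmorph1 scale1r addNr mul1r sublinear0// sub0r.
Qed.

End HahnBanach.

(** * Positive functionals *)

Section DistanceToCone.
Variables (R : realType) (V : normedModType R[i]) (K : set V).
Hypothesis K0 : K 0.
Hypothesis KD : forall x y, K x -> K y -> K (x + y).
Hypothesis KZ : forall (r : R) x, 0 < r -> K x -> K (r%:C *: x).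

(** The sublinear functional for Hahn-Banach: a linear functional below it is bounded by the norm
    and is at most 0 on [K]. *)
Definition dist_cone x := inf [set rnorm (x - k) | k in K].

Lemma dist_cone_le x k : K k -> dist_cone x <= rnorm (x - k).
Proof.
move=> Kk; apply: ge_inf; last by exists k.
by exists 0 => _ [l _ <-]; exact: rnorm_ge0.
Qed.

Lemma le_dist_cone x z : (forall k, K k -> z <= rnorm (x - k)) -> z <= dist_cone x.
Proof.
move=> zk; apply: lb_le_inf; last by move=> _ [k Kk <-]; exact: zk.
by exists (rnorm (x - 0)), 0.
Qed.

Lemma dist_cone_sublinear : sublinear dist_cone.
Proof.
split=> [x y|r x r0].
  rewrite -lerBlDr; apply: le_dist_cone => k Kk; rewrite lerBlDr -lerBlDl.
  apply: le_dist_cone => l Kl; rewrite lerBlDl.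
  rewrite (le_trans (dist_cone_le _ (KD Kk Kl)))//.
  by rewrite opprD addrACA rnormD.
rewrite -ler_pdivrMl//; apply: le_dist_cone => k Kk; rewrite ler_pdivrMl//.
rewrite (le_trans (dist_cone_le _ (KZ r0 Kk)))//.
by rewrite -scalerBr rnormZ// ltW.
Qed.

End DistanceToCone.

Definition re_part (R : realType) (U : starAlgType R) (x : U) :=
  (2^-1 : R)%:C *: (x + star x).

Section PositiveFunctional.
Variables (R : realType) (B : cstarAlgType R).
Implicit Types (x y b p : B).

Record positive_functional (F : B -> R[i]) : Prop := {
  pfD : forall x y, F (x + y) = F x + F y;
  pfZ : forall (c : R[i]) x, F (c *: x) = c * F x;
  pf_star : forall x, F (star x) = (F x)^*;
  pf_ge0 : forall x, 0 <= F (star x ** x);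
  pf_bound : forall x, `|F x| <= (2 * rnorm x)%:C
}.

(** The complex linear functional with real part g. It is hermitian, and real at x^* x, because g
    vanishes on skew-adjoint elements. The factor 2 in [pf_bound] comes from |g x| + |g (i x)|. *)
Lemma complexification (g : B -> R) :
  (forall x y, g (x + y) = g x + g y) ->
  (forall (r : R) x, g (r%:C *: x) = r * g x) ->
  (forall x, star x = - x -> g x = 0) ->
  (forall x, 0 <= g (star x ** x)) ->
  (forall x, `|g x| <= rnorm x) ->
  positive_functional (fun x => (g x)%:C - 'i * (g ('i *: x))%:C).
Proof.
move=> gD gZ g_skew g_ge0 g_bound; set F := fun x : B => _.
have gN x : g (- x) = - g x.
  by rewrite -scaleN1r -(rmorphN1 (real_complex R)) gZ mulN1r.
have g_star x : g (star x) = g x.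
  apply/eqP; rewrite -subr_eq0 -gN -gD g_skew//.
  by rewrite starB starK opprB.
have FD x y : F (x + y) = F x + F y.
  by rewrite /F scalerDr !gD !rmorphD /=; ring.
have FR (r : R) x : F (r%:C *: x) = r%:C * F x.
  rewrite /F; have -> : 'i *: (r%:C *: x) = r%:C *: ('i *: x) by rewrite !scalerA mulrC.
  by rewrite !gZ !rmorphM /=; ring.
have Fi x : F ('i *: x) = 'i * F x.
  by rewrite /F scale_ii gN rmorphN /=; ring: (@sqrCi R[i]).
split=> //.
- move=> c x; rewrite [c]complexE complexiE scalerDl -scalerA FD Fi !FR.
  by rewrite mulrDl mulrA.
- move=> x; rewrite /F g_star.
  have -> : 'i *: star x = - star ('i *: x) by rewrite star_i opprK.
  rewrite gN g_star rmorphB rmorphM /= conjCi !conj_Creal ?complex_real//.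
  by rewrite rmorphN /=; ring.
- move=> x; rewrite /F [g ('i *: _)]g_skew ?mulr0 ?subr0 ?ler0c//.
  by rewrite star_i starM starK.
- move=> x; rewrite /F (le_trans (ler_normB _ _))// normrM normCi mul1r.
  rewrite mulr2n mulrDl mul1r rmorphD.
  have gle y : `|(g y)%:C : R[i]| <= (rnorm y)%:C.
    by rewrite normc_def /= expr0n addr0 sqrtr_sqr lecR.
  apply: lerD; first exact: gle.
  rewrite (le_trans (gle _))// (_ : rnorm ('i *: x) = rnorm x)//.
  by rewrite /rnorm normrZ normCi mul1r.
Qed.

Lemma re_part_bound x e : rnorm x <= e -> rnorm (re_part x) <= e.
Proof.
move=> xe; rewrite /re_part rnormZ ?invr_ge0//.
by have := rnormD x (star x); rewrite rnorm_star; lra.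
Qed.

(** Separate - b^* b from the cone K of sums of positive elements, elements of J and skew-adjoint
    elements. The last two kinds form subspaces, so the real functional vanishes on them; the
    skew-adjoint ones are included to make F hermitian. *)
Lemma exists_positive_functional (J : set B) b : closed_star_ideal J -> ~ J b ->
  exists F, [/\ positive_functional F, (forall x, J x -> F x = 0) &
    F (star b ** b) != 0].
Proof.
move=> JI nJb; have [embD embM embS] := mult_embed_star_hom B.
have embA x y : mult_embed (x + y) = mult_embed x + mult_embed y.
  by rewrite -[x]scale1r embD !scale1r.
have embZ (c : R[i]) x : mult_embed (c *: x) = c *: mult_embed x.
  by apply: mull_inj => y /=; rewrite smulZl.
have emb0 : mult_embed (0 : B) = 0.
  by apply: mull_inj => y /=; rewrite smul_0l.
have pos_sq x : pos (mult_embed (star x ** x)).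
  by rewrite embM embS; apply: pos_star_smul; eexists; exact: bnd_embed.
pose K := [set k : B | exists p j s, [/\ pos (mult_embed p), J j, star s = - s &
  k = p + j + s]].
have J0 := csi0 JI.
have K0 : K 0.
  by exists 0, 0, 0; rewrite emb0 star0 oppr0 !addr0; split => //; exact: pos0.
have KD x y : K x -> K y -> K (x + y).
  move=> [p [j [s [pp Jj ss ->]]]] [p' [j' [s' [pp' Jj' ss' ->]]]].
  exists (p + p'), (j + j'), (s + s'); split.
  - by rewrite embA; exact: posD.
  - exact: (csiD JI).
  - by rewrite starD ss ss' opprD.
  - by rewrite addrACA [X in X + _ = _]addrACA.
have KZ (r : R) x : 0 < r -> K x -> K (r%:C *: x).
  move=> r0 [p [j [s [pp Jj ss ->]]]].
  exists (r%:C *: p), (r%:C *: j), (r%:C *: s); split.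
  - by rewrite embZ; apply: posZ => //; exact: ltW.
  - exact: (csiZ JI).
  - by rewrite starZr ss scalerN.
  - by rewrite !scalerDr.
have Kpos p : pos (mult_embed p) -> K p.
  by move=> pp; exists p, 0, 0; rewrite star0 oppr0 !addr0.
have KJ j : J j -> K j.
  move=> Jj; exists 0, j, 0; rewrite star0 oppr0 !addr0 add0r emb0; split=> //.
  exact: pos0.
have Ks s : star s = - s -> K s.
  by move=> ss; exists 0, 0, s; rewrite !add0r emb0; split=> //; exact: pos0.
have sd := dist_cone_sublinear K0 KD KZ.
have [f [fD fZ fd fb]] := hahn_banach (- (star b ** b)) sd.
have fN x : f (- x) = - f x.
  by rewrite -scaleN1r -(rmorphN1 (real_complex R)) fZ mulN1r.
have fK k : K k -> f k <= 0.
  by move=> Kk; rewrite (le_trans (fd _))// (le_trans (dist_cone_le _ Kk))// subrr rnorm0.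
(* At distance 0, b^* b + p + j + s would be arbitrarily small for members p + j + s of K. Its
   self-adjoint part loses s, and [mem_ideal_of_approx] would put b in J. *)
have db : 0 < dist_cone K (- (star b ** b)).
  rewrite ltNge; apply/negP => db0; apply: nJb; apply: (mem_ideal_of_approx JI) => e e0.
  have [|_ [k Kk <-] ke] := inf_adherent e0 (E := [set rnorm (- (star b ** b) - k) | k in K]).
    split; first by exists (rnorm (- (star b ** b) - 0)), 0.
    by exists 0 => _ [l _ <-]; exact: rnorm_ge0.
  have [p [j [s [pp Jj ss kE]]]] := Kk.
  exists p, (re_part j); split=> //.
  - by apply: (csiZ JI); apply: (csiD JI) => //; exact: (csi_star JI).
  - by rewrite /re_part starZr starD starK addrC.
  have -> : star b ** b + p + re_part j = re_part (- (- (star b ** b) - k)).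
    have pS : star p = p by apply: mult_embed_inj; rewrite embS pos_star.
    rewrite kE /re_part !(starD, starN, starM, starK) pS ss.
    by lmodule R[i].
  apply: re_part_bound; rewrite rnormN (le_trans (ltW ke))//.
  by rewrite -[leRHS]add0r lerD2r.
pose g x := - f x.
have gK k : K k -> 0 <= g k by move=> /fK; rewrite oppr_ge0.
have g0 k : K k -> K (- k) -> g k = 0.
  move=> /gK gk /gK; rewrite /g fN opprK => fk.
  by apply/eqP; rewrite eq_le gk andbT oppr_le0.
eexists; split.
- apply: (@complexification g).
  + by move=> x y; rewrite /g fD opprD.
  + by move=> r x; rewrite /g fZ mulrN.
  + by move=> s ss; apply: g0; apply: Ks => //; rewrite starN ss.
  + by move=> x; apply/gK/Kpos.
  + move=> x; have fx y : f y <= rnorm y.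
      by rewrite (le_trans (fd y))// -[leRHS](congr1 (@rnorm _ _) (subr0 y)) dist_cone_le.
    by rewrite /g ler_norml lerN2 fx /= -fN -rnormN fx.
- move=> x Jx; have gJ y : J y -> g y = 0.
    by move=> Jy; apply: g0; apply: KJ => //; rewrite -scaleN1r; exact: (csiZ JI).
  by rewrite !gJ ?mulr0 ?subr0//; exact: (csiZ JI).
- have -> : g ('i *: (star b ** b)) = 0.
    by apply: g0; apply: Ks; rewrite ?starN star_i starM starK.
  by rewrite mulr0 subr0 fmorph_eq0 oppr_eq0 -oppr_eq0 -fN fb gt_eqF.
Qed.

End PositiveFunctional.

(** * Completion of a semi-inner product space *)

Section ComplexModulus.
Variable R : realType.
Implicit Types z w : R[i].

Definition cabs z : R := @rnorm R (R[i]^o) z.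

Lemma cabsE z : `|z| = (cabs z)%:C.
Proof. exact: (@rnormE R (R[i]^o)). Qed.

Lemma cabs_ge0 z : 0 <= cabs z.
Proof. exact: rnorm_ge0. Qed.

Lemma cabsD z w : cabs (z + w) <= cabs z + cabs w.
Proof. exact: (@rnormD R (R[i]^o)). Qed.

Lemma cabsN z : cabs (- z) = cabs z.
Proof. exact: (@rnormN R (R[i]^o)). Qed.

Lemma cabsB z w : cabs (z - w) <= cabs z + cabs w.
Proof. exact: (@rnormB R (R[i]^o)). Qed.

Lemma cabs0 : cabs 0 = 0. Proof. exact: (@rnorm0 R (R[i]^o)). Qed.

Lemma cabs_eq0 z : cabs z = 0 -> z = 0.
Proof. exact: (@rnorm_eq0 R (R[i]^o)). Qed.

Lemma cabs_small z (M : R) : (forall e, 0 < e -> cabs z <= M * e) -> z = 0.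
Proof. exact: (@rnorm_small R (R[i]^o)). Qed.

Lemma cabsM z w : cabs (z * w) = cabs z * cabs w.
Proof. by apply: complexI; rewrite rmorphM /= -!cabsE normrM. Qed.

Lemma cabs_conj z : cabs z^* = cabs z.
Proof. by apply: complexI; rewrite -!cabsE norm_conjC. Qed.

Lemma cabs_real (r : R) : 0 <= r -> cabs r%:C = r.
Proof. by move=> r0; apply: complexI; rewrite -cabsE ger0_norm// ler0c. Qed.

Lemma Re_le_cabs z : complex.Re z <= cabs z.
Proof. by rewrite (le_trans (ler_norm _))// -lecR -cabsE normc_ge_Re. Qed.

Lemma Im_le_cabs z : `|complex.Im z| <= cabs z.
Proof.
have := normc_ge_Re ('i * z); rewrite normrM normCi mul1r cabsE lecR.
by rewrite -complexiE mulrC ReiNIm normrN.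
Qed.

Lemma cabs_le_ReIm z : cabs z <= `|complex.Re z| + `|complex.Im z|.
Proof.
rewrite -lecR -cabsE {1}[z]complexE (le_trans (ler_normD _ _))//.
rewrite normrM complexiE normCi mul1r rmorphD; apply: lerD.
  by rewrite normc_def /= expr0n addr0 sqrtr_sqr.
by rewrite normc_def /= expr0n addr0 sqrtr_sqr.
Qed.

Lemma real_of_conj z : z^* = z -> z = (complex.Re z)%:C.
Proof. by move=> zz; rewrite RRe_real// CrealE zz. Qed.

(** The intervals [r n - d n, r n + d n] meet pairwise, so the supremum of the left ends lies in all
    of them. *)
Lemma real_complete_rate (r d : nat -> R) :
  (forall m n, (m <= n)%N -> `|r n - r m| <= d m) ->
  exists a, forall m, `|a - r m| <= d m.
Proof.
move=> rd; have d0 n : 0 <= d n by have := rd n n (leqnn n); exact: le_trans.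
have ub m n : r n - d n <= r m + d m.
  have := d0 m; have := d0 n.
  have [mn|/ltnW nm] := leqP m n.
    by have := rd _ _ mn; rewrite ler_norml => /andP[_]; lra.
  by have := rd _ _ nm; rewrite ler_norml => /andP[]; lra.
exists (sup (range (fun n => r n - d n))) => m.
rewrite ler_norml; apply/andP; split.
  rewrite lerBrDl -[_ + _]/(r m - d m); apply: ub_le_sup; last by exists m.
  by exists (r m + d m) => _ [n _ <-].
rewrite lerBlDl; apply: ge_sup; first by exists (r m - d m), m.
by move=> _ [n _ <-].
Qed.

Lemma complex_complete_rate (u : nat -> R[i]) (d : nat -> R) :
  (forall m n, (m <= n)%N -> cabs (u n - u m) <= d m) ->
  exists l, forall m, cabs (l - u m) <= 2 * d m.
Proof.
move=> ud.
have [|a au] := @real_complete_rate (fun n => complex.Re (u n)) d.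
  move=> m n mn; rewrite -raddfB; apply: le_trans (ud _ _ mn).
  by rewrite -lecR -cabsE normc_ge_Re.
have [|b bu] := @real_complete_rate (fun n => complex.Im (u n)) d.
  by move=> m n mn; rewrite -raddfB; apply: le_trans (ud _ _ mn); exact: Im_le_cabs.
exists (a%:C + 'i * b%:C) => m.
rewrite (le_trans (cabs_le_ReIm _))// mulr2n mulrDl mul1r.
rewrite -complexiE; case: (u m) (au m) (bu m) => x y /= ax b_y.
by rewrite !(mul0r, mulr0, mul1r, addr0, add0r, subr0); apply: lerD.
Qed.

End ComplexModulus.

Record semi_inner (R : realType) (E : lmodType R[i]) := SemiInner {
  sip :> E -> E -> R[i];
  sipDl : forall x y z, sip (x + y) z = sip x z + sip y z;
  sipZl : forall c x z, sip (c *: x) z = c * sip x z;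
  sipC : forall x y, sip y x = (sip x y)^*;
  sip_ge0 : forall x, 0 <= sip x x
}.

Section SemiInnerTheory.
Variables (R : realType) (E : lmodType R[i]) (ip : semi_inner E).
Implicit Types (x y z : E).

Definition seminorm x : R := Num.sqrt (complex.Re (ip x x)).

Lemma sipDr x y z : ip x (y + z) = ip x y + ip x z.
Proof. by rewrite sipC sipDl rmorphD /= -!sipC. Qed.

Lemma sipZr c x y : ip x (c *: y) = c^* * ip x y.
Proof. by rewrite sipC sipZl rmorphM /= -sipC. Qed.

Lemma sipNl x y : ip (- x) y = - ip x y.
Proof. by rewrite -scaleN1r sipZl mulN1r. Qed.

Lemma sipNr x y : ip x (- y) = - ip x y.
Proof. by rewrite sipC sipNl rmorphN /= -sipC. Qed.

Lemma Re_sip_ge0 x : 0 <= complex.Re (ip x x).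
Proof. by have := sip_ge0 ip x; rewrite lecE => /andP[]. Qed.

Lemma seminorm_ge0 x : 0 <= seminorm x.
Proof. exact: sqrtr_ge0. Qed.

Lemma sip_seminorm x : ip x x = (seminorm x ^+ 2)%:C.
Proof.
rewrite sqr_sqrtr ?Re_sip_ge0//; apply: real_of_conj.
by rewrite -sipC.
Qed.

(** Expand the non-negative square of x - t <x,y> y; the factor <x,y> lets a real parameter t
    suffice. *)
Lemma cauchy_schwarz x y : cabs (ip x y) <= seminorm x * seminorm y.
Proof.
rewrite -ler_sqr ?nnegrE ?mulr_ge0 ?seminorm_ge0 ?cabs_ge0// exprMn.
set a := seminorm x ^+ 2; set b := seminorm y ^+ 2; set N := cabs _ ^+ 2.
have quad (t : R) : 0 <= a - 2 * t * N + t ^+ 2 * N * b.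
  have := sip_ge0 ip (x - (t%:C * ip x y) *: y).
  have zz : ip x y * (ip x y)^* = N%:C.
    by rewrite rmorphXn /= -cabsE normCK.
  rewrite sipDl !sipDr !sipNl !sipNr sipZl !sipZr sipZl !sip_seminorm -/a -/b.
  rewrite (sipC ip x y).
  have -> : (t%:C * ip x y)^* = t%:C * (ip x y)^*.
    by rewrite rmorphM; congr (_ * _); apply: conj_Creal; rewrite complex_real.
  suff -> : a%:C - t%:C * (ip x y)^* * ip x y + (- (t%:C * ip x y * (ip x y)^*) -
      - (t%:C * (ip x y)^* * (t%:C * ip x y * b%:C))) =
      (a - 2 * t * N + t ^+ 2 * N * b)%:C by rewrite ler0c.
  by rewrite opprK; ring: zz.
have a0 : 0 <= a by rewrite exprn_ge0 ?seminorm_ge0.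
have b0 : 0 <= b by rewrite exprn_ge0 ?seminorm_ge0.
have N0 : 0 <= N by rewrite exprn_ge0 ?cabs_ge0.
have [b1|b1] := ltP 0 b.
  have := quad b^-1; rewrite (_ : _ + _ = a - N / b); last by field; rewrite gt_eqF.
  by rewrite subr_ge0 ler_pdivrMr.
have b_eq0 : b = 0 by apply/eqP; rewrite eq_le b1 b0.
rewrite b_eq0 mulr0 leNgt; apply/negP => N1.
(* For b = 0 the quadratic is affine in t, and this t makes it - 1. *)
have := quad ((a + 1) / (2 * N)); rewrite b_eq0.
rewrite mulr0 addr0 (_ : _ - _ = - 1); last by field; rewrite gt_eqF.
by rewrite oppr_ge0 ler10.
Qed.

Lemma seminorm_sqr x : seminorm x ^+ 2 = complex.Re (ip x x).
Proof. by rewrite sip_seminorm. Qed.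

Lemma seminormD x y : seminorm (x + y) <= seminorm x + seminorm y.
Proof.
rewrite -ler_sqr ?nnegrE ?addr_ge0 ?seminorm_ge0//.
rewrite seminorm_sqr sipDl !sipDr !raddfD /= -!seminorm_sqr.
have := le_trans (Re_le_cabs _) (cauchy_schwarz x y).
have := le_trans (Re_le_cabs _) (cauchy_schwarz y x).
by rewrite sqrrD; lra.
Qed.

Lemma seminormZ c x : seminorm (c *: x) = cabs c * seminorm x.
Proof.
apply/eqP; rewrite -(@eqrXn2 _ 2)// ?mulr_ge0 ?seminorm_ge0 ?cabs_ge0//.
apply/eqP/complexI; rewrite -sip_seminorm sipZl sipZr sip_seminorm.
have cc : c * c^* = (cabs c)%:C ^+ 2 by rewrite -cabsE normCK.
by ring: cc.
Qed.

Lemma seminorm_le x (d : R) : 0 <= d ->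
  cabs (ip x x) <= d * seminorm x -> seminorm x <= d.
Proof.
move=> d0; rewrite sip_seminorm cabs_real ?exprn_ge0 ?seminorm_ge0// expr2.
have [->//|x0] := eqVneq (seminorm x) 0.
by rewrite ler_pM2r// lt_def x0 seminorm_ge0.
Qed.

End SemiInnerTheory.

Section Approximation.
Variables (R : realType) (E : lmodType R[i]) (ip : semi_inner E).
Implicit Types (phi psi : E -> R[i]) (x y z : E) (d : R).

(** [phi] is within [d] of the functional of [x] in the norm of the antidual. *)
Definition approx phi x d := forall y, cabs (phi y - ip x y) <= d * seminorm ip y.

Definition approximable phi := forall d, 0 < d -> exists x, approx phi x d.

Lemma approx_combination (c : R[i]) phi psi x y d d' :
  approx phi x d -> approx psi y d' ->
  approx (fun z => c * phi z + psi z) (c *: x + y) (cabs c * d + d').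
Proof.
move=> px py z; rewrite sipDl sipZl mulrDl.
have -> : c * phi z + psi z - (c * ip x z + ip y z) =
  c * (phi z - ip x z) + (psi z - ip y z) by ring.
by rewrite (le_trans (cabsD _ _))// lerD// cabsM -mulrA ler_wpM2l ?cabs_ge0.
Qed.

Lemma approx_le phi x d d' : approx phi x d -> d <= d' -> approx phi x d'.
Proof.
by move=> px dd y; rewrite (le_trans (px y))// ler_wpM2r ?seminorm_ge0.
Qed.

Lemma approx_refl x : approx (ip x) x 0.
Proof. by move=> y; rewrite subrr cabs0 mul0r. Qed.

Lemma approximable_combination (c : R[i]) phi psi :
  approximable phi -> approximable psi ->
  approximable (fun z => c * phi z + psi z).
Proof.
move=> aphi apsi d d0.
have c1 : 0 < cabs c + 1 by rewrite ltr_wpDl ?cabs_ge0.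
have [x px] := aphi _ (divr_gt0 d0 (mulr_gt0 c1 (ltr0n _ 2))).
have [y py] := apsi _ (divr_gt0 d0 (ltr0n _ 2)).
exists (c *: x + y); refine (approx_le (approx_combination c px py) _).
have -> : cabs c * (d / ((cabs c + 1) * 2)) = cabs c / (cabs c + 1) * (d / 2).
  by field; rewrite gt_eqF.
rewrite -lerBrDr; have -> : d - d / 2 = d / 2 by field.
by rewrite ler_piMl ?divr_ge0 ?(ltW d0)// ler_pdivrMr// mul1r lerDl.
Qed.

Lemma approximable_sip x : approximable (ip x).
Proof. by move=> d d0; exists x; exact: approx_le (approx_refl x) (ltW d0). Qed.

Lemma approximableB phi y y' :
  approximable phi -> phi (y - y') = phi y - phi y'.
Proof.
move=> aphi; apply/eqP; rewrite -subr_eq0; apply/eqP.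
apply: (@cabs_small _ _ (seminorm ip (y - y') + (seminorm ip y + seminorm ip y'))).
move=> e e0; have [x px] := aphi _ e0.
have -> : phi (y - y') - (phi y - phi y') = (phi (y - y') - ip x (y - y')) -
    ((phi y - ip x y) - (phi y' - ip x y')).
  by rewrite sipDr sipNr; ring.
rewrite (le_trans (cabsB _ _))// mulrDl; apply: lerD; first by rewrite mulrC.
by rewrite (le_trans (cabsB _ _))// mulrDl; apply: lerD; rewrite mulrC.
Qed.

Lemma approximable_bounded phi : approximable phi ->
  exists2 C, 0 <= C & forall y, cabs (phi y) <= C * seminorm ip y.
Proof.
move=> aphi; have [x px] := aphi 1 ltr01.
exists (1 + seminorm ip x); first by rewrite addr_ge0 ?seminorm_ge0.
move=> y; rewrite -[phi y](subrK (ip x y)) (le_trans (cabsD _ _))// mulrDl.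
by apply: lerD; [exact: px|exact: cauchy_schwarz].
Qed.

Lemma approx_dist phi x x' d d' : 0 <= d -> 0 <= d' ->
  approx phi x d -> approx phi x' d' -> seminorm ip (x - x') <= d + d'.
Proof.
move=> d0 d0' px px'; apply: seminorm_le; first exact: addr_ge0.
rewrite sipDl sipNl.
have -> : ip x (x - x') - ip x' (x - x') =
   (phi (x - x') - ip x' (x - x')) - (phi (x - x') - ip x (x - x')) by ring.
by rewrite (le_trans (cabsB _ _))// mulrDl addrC lerD.
Qed.

Lemma approx_seminorm phi x C d : 0 <= C -> 0 <= d ->
  (forall y, cabs (phi y) <= C * seminorm ip y) -> approx phi x d ->
  seminorm ip x <= C + d.
Proof.
move=> C0 d0 phiC px; apply: seminorm_le; first exact: addr_ge0.
have {1}-> : ip x x = phi x - (phi x - ip x x) by ring.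
by rewrite (le_trans (cabsB _ _))// mulrDl lerD.
Qed.

(** [phi x] is the inner product of [phi] with the vector [x], and [c] is its limit as [x] tends to
    [psi]. The linear rate makes uniqueness and linearity direct, and allowing [d = 0] gives exact
    values on [E] in [cinner_embed]. *)
Definition is_inner phi psi (c : R[i]) := exists C : R, forall x d,
  0 <= d -> approx psi x d -> cabs (phi x - c) <= C * d.

Lemma is_inner_unique phi psi c c' : approximable psi ->
  is_inner phi psi c -> is_inner phi psi c' -> c = c'.
Proof.
move=> apsi [C phiC] [C' phiC']; apply/eqP; rewrite -subr_eq0; apply/eqP.
apply: (@cabs_small _ _ (C' + C)) => e e0; have [x px] := apsi _ e0.
have -> : c - c' = (phi x - c') - (phi x - c) by ring.
rewrite (le_trans (cabsB _ _))// mulrDl lerD//.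
  by apply: phiC' px; exact: ltW.
by apply: phiC px; exact: ltW.
Qed.

Lemma exists_inner phi psi : approximable phi -> approximable psi ->
  exists c, is_inner phi psi c.
Proof.
move=> aphi apsi; have [C C0 phiC] := approximable_bounded aphi.
pose d (n : nat) : R := n.+1%:R^-1.
have d0 n : 0 < d n by rewrite invr_gt0.
have d_le m n : (m <= n)%N -> d n <= d m by move=> mn; rewrite lef_pV2 ?posrE// ler_nat.
have /choice[x px] n : exists x, approx psi x (d n) by exact: apsi.
have [m n mn|c cx] := @complex_complete_rate R (phi \o x) (fun n => C * (2 * d n)).
  rewrite /= -approximableB// (le_trans (phiC _))// ler_wpM2l//.
  have := approx_dist (ltW (d0 n)) (ltW (d0 m)) (px n) (px m).
  by have := d_le _ _ mn; lra.
exists c, C => y e e0 py.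
apply/ler_addgt0Pr => e1 e10.
(* C d_n comes from [y - x n] and 4 C d_n from the convergence of [phi (x n)]; the 1 keeps the
   divisor positive. *)
have C1 : 0 < 5 * C + 1 by rewrite ltr_wpDl// mulr_ge0.
have [n dn] : exists n, d n < e1 / (5 * C + 1).
  have [n _ nP] := near_infty_natSinv_lt (PosNum (divr_gt0 e10 C1)).
  by exists n; exact: (nP n (leqnn n)).
have -> : phi y - c = phi (y - x n) - (c - phi (x n)).
  by rewrite approximableB//; ring.
rewrite (le_trans (cabsB _ _))//.
have := cx n; have := phiC (y - x n).
have := approx_dist e0 (ltW (d0 n)) py (px n) => /(ler_wpM2l C0) h1 h2 /= h3.
have : (5 * C + 1) * d n < e1 by rewrite mulrC -ltr_pdivlMr.
by have := d0 n; nra.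
Qed.

End Approximation.

(* The completion of [E] for a semi-inner product, realized as the closure of *)
(* the functionals [ip x] in the antidual of [E].                             *)
Record completion (R : realType) (E : lmodType R[i]) (ip : semi_inner E) :=
  Completion {
    cfun :> E -> R[i]^o;
    cfunP : `[< approximable ip cfun >]
  }.

Section CompletionModule.
Variables (R : realType) (E : lmodType R[i]) (ip : semi_inner E).

HB.instance Definition _ := [isSub for @cfun R E ip].
HB.instance Definition _ := [Choice of completion ip by <:].

Lemma completion_submod_closed :
  GRing.submod_closed (fun phi : E -> R[i]^o => `[< approximable ip phi >]).
Proof.
split=> [|c phi psi]; rewrite !unfold_in.
  apply/asboolP => d d0; exists 0 => y.
  by rewrite -(scale0r (0 : E)) sipZl mul0r subrr cabs0 mulr_ge0 ?seminorm_ge0 ?ltW.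
by move=> /asboolP aphi /asboolP apsi; apply/asboolP; exact: approximable_combination.
Qed.

HB.instance Definition _ := GRing.SubChoice_isSubLmodule.Build R[i]
  (E -> R[i]^o) _ (completion ip) completion_submod_closed.

End CompletionModule.

Section CompletionHilbert.
Variables (R : realType) (E : lmodType R[i]) (ip : semi_inner E).
Implicit Types (phi psi : completion ip) (x y : E).

Lemma cfun_approx phi : approximable ip phi.
Proof. exact/asboolP/cfunP. Qed.

Lemma cfun_inj phi psi : phi =1 psi -> phi = psi.
Proof. by move=> pp; apply: val_inj; apply/funext. Qed.

Lemma cfunDE phi psi y : (phi + psi) y = phi y + psi y.
Proof. by []. Qed.

Lemma cfunZE c phi y : (c *: phi) y = c * phi y.
Proof. by []. Qed.

Lemma cfunNE phi y : (- phi) y = - phi y.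
Proof. by []. Qed.

Definition cinner phi psi : R[i] :=
  sval (cid (exists_inner (cfun_approx phi) (cfun_approx psi))).

Lemma cinnerP phi psi : is_inner ip phi psi (cinner phi psi).
Proof. by rewrite /cinner; case: cid. Qed.

Lemma cinner_unique phi psi c : is_inner ip phi psi c -> cinner phi psi = c.
Proof. exact: is_inner_unique (cfun_approx psi) (cinnerP phi psi). Qed.

Lemma cinnerDl phi phi' psi : cinner (phi + phi') psi = cinner phi psi + cinner phi' psi.
Proof.
apply: cinner_unique; have [C phiC] := cinnerP phi psi.
have [C' phiC'] := cinnerP phi' psi; exists (C + C') => x d d0 px.
rewrite cfunDE opprD addrACA (le_trans (cabsD _ _))// mulrDl.
by rewrite lerD ?phiC ?phiC'.
Qed.

Lemma cinnerZl c phi psi : cinner (c *: phi) psi = c * cinner phi psi.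
Proof.
apply: cinner_unique; have [C phiC] := cinnerP phi psi.
exists (cabs c * C) => x d d0 px.
by rewrite cfunZE -mulrBr cabsM -mulrA ler_wpM2l ?cabs_ge0 ?phiC.
Qed.

(** For x near phi and y near psi, both phi y and the conjugate of psi x are near ip x y. *)
Lemma cinnerC phi psi : cinner psi phi = (cinner phi psi)^*.
Proof.
have [C phiC] := cinnerP phi psi; have [C' psiC] := cinnerP psi phi.
have [L L0 phiL] := approximable_bounded (cfun_approx phi).
have [M M0 psiM] := approximable_bounded (cfun_approx psi).
apply/eqP; rewrite -subr_eq0; apply/eqP.
apply: (@cabs_small _ _ (`|C'| + (L + 1) + (M + 1) + `|C|)) => e0 e00.
(* The cap at 1 bounds the seminorms of [x] and [y] by [L + 1] and [M + 1]. *)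
pose e := Num.min e0 1; have e_gt0 : 0 < e by rewrite lt_min e00 ltr01.
have e_le1 : e <= 1 by rewrite ge_min lexx orbT.
have e_le : e <= e0 by rewrite ge_min lexx.
have [x px] := cfun_approx phi e_gt0; have [y py] := cfun_approx psi e_gt0.
have snx := approx_seminorm L0 (ltW e_gt0) phiL px.
have sny := approx_seminorm M0 (ltW e_gt0) psiM py.
have -> : cinner psi phi - (cinner phi psi)^* = - (psi x - cinner psi phi) +
    (psi x - ip y x) - (phi y - ip x y)^* + (phi y - cinner phi psi)^*.
  by rewrite !rmorphB /= -(sipC ip x y); ring.
apply: (@le_trans _ _ ((`|C'| + (L + 1) + (M + 1) + `|C|) * e)); last first.
  by rewrite ler_wpM2l// !addr_ge0.
have e_ge0 := ltW e_gt0.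
rewrite (le_trans (cabsD _ _))// mulrDl cabs_conj lerD//; last first.
  by rewrite (le_trans (phiC _ _ e_ge0 py))// ler_wpM2r ?ler_norm.
rewrite (le_trans (cabsB _ _))// mulrDl cabs_conj lerD//; last first.
  by rewrite (le_trans (px y))// mulrC ler_wpM2r// (le_trans sny)// lerD2l.
rewrite (le_trans (cabsD _ _))// mulrDl cabsN lerD//.
  by rewrite (le_trans (psiC _ _ e_ge0 px))// ler_wpM2r ?ler_norm.
by rewrite (le_trans (py x))// mulrC ler_wpM2r// (le_trans snx)// lerD2l.
Qed.

Lemma cinner_ge0 phi : 0 <= cinner phi phi.
Proof.
have [C phiC] := cinnerP phi phi.
have [L L0 phiL] := approximable_bounded (cfun_approx phi).
rewrite (real_of_conj (esym (cinnerC phi phi))) ler0c.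
apply/ler_addgt0Pr => e0 e00.
pose K := `|C| + (L + 1); have K0 : 0 < K.
  by rewrite /K; have := normr_ge0 C; lra.
pose e := Num.min (e0 / K) 1; have e_gt0 : 0 < e by rewrite lt_min divr_gt0 ?ltr01.
have e_le1 : e <= 1 by rewrite ge_min lexx orbT.
have e_le : e * K <= e0 by rewrite -ler_pdivlMr// ge_min lexx.
have [x px] := cfun_approx phi e_gt0.
have snx := approx_seminorm L0 (ltW e_gt0) phiL px.
have h : cabs (ip x x - cinner phi phi) <= e * K.
  have -> : ip x x - cinner phi phi =
    (phi x - cinner phi phi) - (phi x - ip x x) by ring.
  rewrite (le_trans (cabsB _ _))// mulrC mulrDl lerD//.
    by rewrite (le_trans (phiC _ _ (ltW e_gt0) px))// ler_wpM2r ?ler_norm ?ltW.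
  rewrite (le_trans (px x))// [leLHS]mulrC.
  by apply: ler_wpM2r; rewrite ?(ltW e_gt0)// (le_trans snx)// lerD2l.
have := Re_le_cabs (ip x x - cinner phi phi); rewrite raddfB /=.
by have := Re_sip_ge0 ip x; lra.
Qed.

Definition completion_inner := SemiInner cinnerDl cinnerZl cinnerC cinner_ge0.

Definition cnorm phi : R := seminorm completion_inner phi.

Lemma cinner_cnorm phi : cinner phi phi = (cnorm phi ^+ 2)%:C.
Proof. exact: (sip_seminorm completion_inner). Qed.

Lemma cembedP x : `[< approximable ip (ip x) >].
Proof. by apply/asboolP; exact: approximable_sip. Qed.

Definition cembed x : completion ip := Completion (cembedP x).

Lemma cinner_embed phi y : cinner phi (cembed y) = phi y.
Proof.
have [C phiC] := cinnerP phi (cembed y).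
apply/esym/eqP; rewrite -subr_eq0; apply/eqP/cabs_eq0/eqP.
rewrite eq_le cabs_ge0 andbT.
by have := phiC y 0 (lexx 0) (approx_refl ip y); rewrite mulr0.
Qed.

Lemma cnorm_embed x : cnorm (cembed x) = seminorm ip x.
Proof. by rewrite /cnorm /seminorm /= cinner_embed. Qed.

Lemma cfun_le phi y : cabs (phi y) <= cnorm phi * seminorm ip y.
Proof.
rewrite -cinner_embed -cnorm_embed.
exact: (cauchy_schwarz completion_inner phi (cembed y)).
Qed.

(** With [cfun_le]: the Hilbert norm of phi is its norm as a functional. For x within e of phi,
    <phi,phi> is near phi x, and |phi x| <= d (d + e). *)
Lemma cnorm_le phi (d : R) : 0 <= d ->
  (forall y, cabs (phi y) <= d * seminorm ip y) -> cnorm phi <= d.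
Proof.
move=> d0 phid; have [C phiC] := cinnerP phi phi.
rewrite -ler_sqr ?nnegrE ?seminorm_ge0//.
apply/ler_addgt0Pr => e0 e00.
pose K := `|C| + d + 1; have K0 : 0 < K.
  by rewrite /K; have := normr_ge0 C; lra.
pose e := e0 / K; have e_gt0 : 0 < e by rewrite divr_gt0.
have [x px] := cfun_approx phi e_gt0.
have snx := approx_seminorm d0 (ltW e_gt0) phid px.
rewrite -[cnorm phi ^+ 2]cabs_real ?exprn_ge0 ?seminorm_ge0// -cinner_cnorm.
have -> : cinner phi phi = phi x - (phi x - cinner phi phi) by ring.
rewrite (le_trans (cabsB _ _))//.
have h1 : cabs (phi x - cinner phi phi) <= `|C| * e.
  by rewrite (le_trans (phiC _ _ (ltW e_gt0) px))// ler_wpM2r ?ler_norm ?ltW.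
have h2 : cabs (phi x) <= d * (d + e) by rewrite (le_trans (phid x))// ler_wpM2l.
have h3 : e * K = e0 by rewrite /e mulfVK ?gt_eqF.
by rewrite /K in h3; nra.
Qed.

Lemma approx_cnorm phi x (d : R) : 0 <= d -> approx ip phi x d ->
  cnorm (phi - cembed x) <= d.
Proof. by move=> d0 px; apply: cnorm_le. Qed.

Lemma cnorm_triangle phi psi :
  (cnorm (phi + psi))%:C <= (cnorm phi)%:C + (cnorm psi)%:C.
Proof. by rewrite -rmorphD lecR /cnorm (seminormD completion_inner). Qed.

Lemma cnormZ (c : R[i]) phi : (cnorm (c *: phi))%:C = `|c| * (cnorm phi)%:C.
Proof. by rewrite cabsE -rmorphM /cnorm (seminormZ completion_inner). Qed.

Lemma cnorm_eq0 phi : (cnorm phi)%:C = 0 -> phi = 0.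
Proof.
move/complexI => phi0; apply: cfun_inj => y; apply/cabs_eq0/eqP.
by rewrite eq_le cabs_ge0 andbT (le_trans (cfun_le _ _))// phi0 mul0r.
Qed.

HB.instance Definition _ := Lmodule_isNormed.Build R[i] (completion ip)
  cnorm_triangle cnormZ cnorm_eq0.

Lemma rnorm_completion phi : rnorm phi = cnorm phi.
Proof. by []. Qed.

(** Elements [u n] chosen at scale 1 / (n + 1) converge pointwise on [E]; the limit functional is
    again approximable and within 4 d_n of [u n] in norm. *)
Lemma completion_complete (F : set_system (completion ip)) :
  ProperFilter F -> cauchy F -> cvg F.
Proof.
move=> PF /cauchyP Fc.
pose d (n : nat) : R := n.+1%:R^-1.
have d0 n : 0 < d n by rewrite invr_gt0.
have d_le m n : (m <= n)%N -> d n <= d m by move=> mn; rewrite lef_pV2 ?posrE// ler_nat.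
have /choice[u uF] n : exists phi, F (ball phi (d n)%:C).
  by apply: Fc; rewrite ltcR.
have u_dist m n : cnorm (u m - u n) <= d m + d n.
  have [phi [/ball_rnormP/ltW mphi /ball_rnormP/ltW nphi]] :=
    filter_ex (filterI (uF m) (uF n)).
  rewrite -rnorm_completion -(subrK phi (u m)) -addrA (le_trans (rnormD _ _))//.
  by apply: lerD => //; rewrite rnorm_distC.
have /choice[l ul] y : exists l, forall m,
    cabs (l - u m y) <= 2 * (2 * d m * seminorm ip y).
  apply: (@complex_complete_rate _ (fun n => u n y)) => m n mn.
  rewrite -cfunNE -cfunDE (le_trans (cfun_le _ _))// ler_wpM2r ?seminorm_ge0//.
  by rewrite (le_trans (u_dist _ _))// mulr2n mulrDl mul1r lerD2r d_le.
have dlim (e : R) : 0 < e -> exists n, d n < e.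
  by move=> e0; have [n _ nP] := near_infty_natSinv_lt (PosNum e0);
    exists n; exact: (nP n (leqnn n)).
have al : `[< approximable ip l >].
  apply/asboolP => e e0; have [n dn] := dlim _ (divr_gt0 e0 (ltr0n R 5)).
  have [x px] := cfun_approx (u n) (d0 n).
  exists x => y; rewrite -[l y](subrK (u n y)) -addrA (le_trans (cabsD _ _))//.
  have := ul y n; have := px y; have := seminorm_ge0 ip y.
  have : 5 * d n < e by rewrite -ltr_pdivlMl// mulrC.
  by move=> *; nra.
pose phi : completion ip := Completion al.
have phi_u n : cnorm (phi - u n) <= 4 * d n.
  apply: cnorm_le => [|y]; first by rewrite mulr_ge0// ltW.
  by rewrite cfunDE cfunNE (le_trans (ul y n))// !mulrA -natrM.
apply/cvg_ex; exists phi; apply/cvg_ballP => e e0; rewrite near_simpl.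
have [r er] : exists r : R, e = r%:C by apply/complex_realP; rewrite gtr0_real.
move: e0; rewrite {}er ltcR => r0.
have [n dn] := dlim _ (divr_gt0 r0 (ltr0n R 5)).
apply: filterS (uF n) => psi /ball_rnormP npsi; apply/ball_rnormP.
rewrite -(subrK (u n) phi) -addrA (le_lt_trans (rnormD _ _))//.
have := phi_u n; rewrite -rnorm_completion.
have : 5 * d n < r by rewrite -ltr_pdivlMl// mulrC.
by move: npsi; lra.
Qed.

HB.instance Definition _ := Uniform_isComplete.Build (completion ip)
  completion_complete.

Lemma cinner_linear (c : R[i]) phi psi chi :
  cinner (c *: phi + psi) chi = c * cinner phi chi + cinner psi chi.
Proof. by rewrite cinnerDl cinnerZl. Qed.

Lemma cinner_norm phi : cinner phi phi = `|phi| ^+ 2.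
Proof. by rewrite cinner_cnorm rnormE rmorphXn. Qed.

HB.instance Definition _ := CompleteNormedModule_isHilbert.Build R
  (completion ip) cinner_linear cinnerC cinner_norm.

End CompletionHilbert.

(** * Adjointable operators on the completion *)

Section CompletionOperators.
Variables (R : realType) (E : lmodType R[i]) (ip : semi_inner E).
Implicit Types (phi psi : completion ip).

Definition adjointable (m m' : E -> E) :=
  (forall x y, ip (m x) y = ip x (m' y)) /\
  exists2 c : R, 0 <= c & forall x, seminorm ip (m' x) <= c * seminorm ip x.

Lemma approx_comp m m' (phi : E -> R[i]) x (c d : R) :
  (forall x y, ip (m x) y = ip x (m' y)) ->
  (forall x, seminorm ip (m' x) <= c * seminorm ip x) -> 0 <= d ->
  approx ip phi x d -> approx ip (phi \o m') (m x) (d * c).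
Proof.
move=> mm' m'c d0 px y; rewrite /= mm' (le_trans (px _))// -mulrA.
exact: ler_wpM2l.
Qed.

Lemma cop_subproof m m' phi : adjointable m m' ->
  `[< approximable ip (phi \o m') >].
Proof.
move=> [mm' [c c0 m'c]]; apply/asboolP => d d0.
have c1 : 0 < c + 1 by rewrite ltr_wpDl.
have [x px] := cfun_approx phi (divr_gt0 d0 c1).
exists (m x); apply: (approx_le (approx_comp mm' m'c _ px)).
  by rewrite divr_ge0 ?ltW.
by rewrite mulrAC ler_pdivrMr// ler_pM2l// lerDl.
Qed.

(** Precomposition with [m'] extends [m], because ip (m x) y = ip x (m' y); this is why
    [adjointable] bounds [m']. *)
Definition cop m m' (mm' : adjointable m m') phi : completion ip :=
  Completion (cop_subproof phi mm').

Lemma cop_linear m m' (mm' : adjointable m m') : linear (cop mm').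
Proof. by move=> c phi psi; apply: cfun_inj. Qed.

Lemma cop_bound m m' (mm' : adjointable m m') (c : R) phi : 0 <= c ->
  (forall x, seminorm ip (m' x) <= c * seminorm ip x) ->
  rnorm (cop mm' phi) <= c * rnorm phi.
Proof.
move=> c0 m'c; apply: cnorm_le => [|y]; first by rewrite mulr_ge0 ?rnorm_ge0.
rewrite -[cop mm' phi y]/(phi (m' y)) (le_trans (cfun_le _ _))//.
rewrite rnorm_completion.
rewrite (_ : c * _ * _ = cnorm phi * (c * seminorm ip y)); last by ring.
by apply: ler_wpM2l; [exact: seminorm_ge0|exact: m'c].
Qed.

Lemma bounded_linear_cvg (V W : normedModType R[i]) (f : V -> W) (c : R) :
  linear f -> (forall x, rnorm (f x) <= c * rnorm x) -> continuous f.
Proof.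
move=> fl fc x; apply/cvgrPdist_lt => e e0.
have [r er] : exists r : R, e = r%:C by apply/complex_realP; rewrite gtr0_real.
move: e0; rewrite {}er ltcR => r0.
have c1 : 0 < `|c| + 1 by rewrite ltr_wpDl.
have d0 : 0 < (r / (`|c| + 1))%:C by rewrite ltcR divr_gt0.
apply: filterS (nbhsx_ballx x _ d0) => y.
rewrite -ball_normE /= !rnormE !ltcR ltr_pdivlMr// => xy.
have -> : f x - f y = f (x - y).
  by rewrite [x - y]addrC -[- y]scaleN1r fl scaleN1r addrC.
rewrite (le_lt_trans (fc _))// (le_lt_trans _ xy)// mulrC.
by rewrite ler_wpM2l ?rnorm_ge0// (le_trans (ler_norm _))// lerDl.
Qed.

Lemma cop_continuous m m' (mm' : adjointable m m') : continuous (cop mm').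
Proof.
have [_ [c c0 m'c]] := mm'; apply: bounded_linear_cvg; first exact: cop_linear.
by move=> phi; apply: cop_bound c0 m'c.
Qed.

Lemma copP m m' (mm' : adjointable m m') (m'm : adjointable m' m) phi psi :
  inner (cop mm' phi) psi = inner phi (cop m'm psi).
Proof.
apply: cinner_unique; have [C phiC] := cinnerP phi (cop m'm psi).
have [mm'E [c c0 m'c]] := m'm; exists (c * `|C|) => x d d0 px.
rewrite (le_trans (phiC _ (d * c) _ _)) ?mulr_ge0//.
  exact: (approx_comp mm'E m'c).
rewrite (_ : c * `|C| * d = `|C| * (d * c)); last by ring.
by apply: ler_wpM2r; [exact: mulr_ge0|exact: ler_norm].
Qed.

Definition cbop m m' (mm' : adjointable m m') (m'm : adjointable m' m) :
    bop (completion ip) :=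
  Bop (@cop_linear _ _ mm') (@cop_linear _ _ m'm) (@cop_continuous _ _ mm')
    (@cop_continuous _ _ m'm) (copP mm' m'm).

End CompletionOperators.

(** * Contractivity of star homomorphisms *)

Section LinearMaps.
Variables (R : realType) (V W : lmodType R[i]) (f : V -> W).
Hypothesis fl : linear f.

Lemma lin0 : f 0 = 0.
Proof. by have := fl (- 1) 0 0; rewrite scaler0 addr0 scaleN1r addNr. Qed.

Lemma linD x y : f (x + y) = f x + f y.
Proof. by have := fl 1 x y; rewrite !scale1r. Qed.

Lemma linZ c x : f (c *: x) = c *: f x.
Proof. by have := fl c x 0; rewrite !addr0 lin0 addr0. Qed.

Lemma linN x : f (- x) = - f x.
Proof. by rewrite -scaleN1r linZ scaleN1r. Qed.

Lemma linB x y : f (x - y) = f x - f y.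
Proof. by rewrite linD linN. Qed.

End LinearMaps.

Section StarHomContractions.
Variables (R : realType) (B : cstarAlgType R).

(* [1 - b^* b / c^2] is the square of the self-adjoint [1 - y]. *)
Lemma star_smul_sqrt (b : B) (c : R) : rnorm b <= c -> 0 < c ->
  exists2 y, star y = y & y + y - y ** y = ((c ^+ 2)^-1)%:C *: (star b ** b).
Proof.
move=> bc c0; apply: sqrt_quasi; first by rewrite starZr starM starK.
rewrite rnormZ ?invr_ge0 ?exprn_ge0 ?(ltW c0)// rnorm_cstar.
by rewrite ler_pdivrMl ?exprn_gt0// mulr1 ler_sqr ?nnegrE ?rnorm_ge0 ?(ltW c0).
Qed.

(** With 1 - b^* b / c^2 = (1 - y)^2, the number |xi|^2 - |sigma b xi|^2 / c^2 is the square of the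
    norm of xi - sigma y xi. *)
Lemma star_hom_bop_contraction (H : hilbertType R) (sigma : B -> bop H) b xi :
  star_hom sigma -> rnorm (sigma b xi) <= rnorm b * rnorm xi.
Proof.
move=> [sl sM sS].
suff H1 c : rnorm b <= c -> 0 < c -> rnorm (sigma b xi) <= c * rnorm xi.
  apply/ler_addgt0Pr => e e0; have xi1 : 0 < rnorm xi + 1.
    by rewrite ltr_wpDl ?rnorm_ge0.
  have e1 : 0 < e / (rnorm xi + 1) by rewrite divr_gt0.
  rewrite (le_trans (H1 (rnorm b + e / (rnorm xi + 1)) _ _))//.
  - by rewrite lerDl ltW.
  - by rewrite ltr_wpDl ?rnorm_ge0.
  rewrite mulrDl lerD2l mulrAC ler_pdivrMr// ler_wpM2l ?(ltW e0)//.
  by rewrite lerDl.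
move=> bc c0; have [y yy yb] := star_smul_sqrt bc c0.
have sqn (x : H) : inner x x = (rnorm x ^+ 2)%:C.
  by rewrite inner_norm rnormE rmorphXn.
have Yadj x : badj (sigma y) x = sigma y x.
  by rewrite -[in RHS]yy sS.
have hE : inner xi (sigma (star b ** b) xi) =
    inner (sigma b xi) (sigma b xi) by rewrite badjP sM sS.
pose eta := xi - sigma y xi.
have etaC : inner eta eta =
    inner xi xi - ((c ^+ 2)^-1)%:C * inner (sigma b xi) (sigma b xi).
  rewrite -hE.
  have -> : ((c ^+ 2)^-1)%:C * inner xi (sigma (star b ** b) xi) =
      inner xi (sigma (y + y - y ** y) xi).
    by rewrite yb (linZ sl) /= innerZr conj_Creal ?complex_real.
  rewrite (linB sl) (linD sl) sM /= innerDr innerNr innerDr.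
  rewrite /eta !(innerDl, innerDr, innerNl, innerNr) !badjP !Yadj.
  by ring.
have etaE : rnorm eta ^+ 2 = rnorm xi ^+ 2 - (c ^+ 2)^-1 * rnorm (sigma b xi) ^+ 2.
  by apply: complexI; rewrite -sqn etaC !sqn; ring.
have := sqr_ge0 (rnorm eta); rewrite etaE subr_ge0 ler_pdivrMl ?exprn_gt0//.
by rewrite -exprMn ler_sqr ?nnegrE ?mulr_ge0 ?rnorm_ge0 ?(ltW c0).
Qed.

(** The same root shows that c^2 - X^* X = c^2 (1 - Y)^2 is positive, for the multipliers X of phi b
    and Y of phi y. *)
Lemma star_hom_contraction (C : cstarAlgType R) (phi : B -> C) b :
  star_hom phi -> rnorm (phi b) <= rnorm b.
Proof.
move=> [pl pM pS]; have [embD embM embS] := mult_embed_star_hom C.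
apply/ler_addgt0Pr => e e0; set c := rnorm b + e.
have c0 : 0 < c by rewrite ltr_wpDl ?rnorm_ge0.
have [|y yy yb] := @star_smul_sqrt b c _ c0; first by rewrite lerDl ltW.
pose Y := mult_embed (phi y); pose X := mult_embed (phi b).
have YY : star Y = Y by rewrite /Y -embS -pS yy.
have bX : bounded X by eexists; exact: bnd_embed.
have XY : star X ** X = (c ^+ 2)%:C *: (Y + Y - Y ** Y).
  have -> : Y + Y - Y ** Y = mult_embed (phi (y + y - y ** y)).
    by rewrite (linB pl) (linD pl) pM mult_embedB (linD embD) embM.
  rewrite yb (linZ pl) (linZ embD) scalerA -rmorphM divff ?gt_eqF ?exprn_gt0//.
  by rewrite rmorph1 scale1r pM pS embM embS.
suff : bnd X c by exact: bnd_embed_le.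
apply: bnd_cstar; first exact: ltW.
apply: pos_sub_bnd; [exact: pos_star_smul|by rewrite exprn_ge0 ?ltW|].
have -> : (c ^+ 2)%:C *: sone - star X ** X =
    (c ^+ 2)%:C *: ((sone - Y) ** (sone - Y)).
  by rewrite XY !smul1E; lmodule R[i].
apply: posZ; first by rewrite exprn_ge0 ?ltW.
apply: pos_square; first by rewrite starB star1 YY.
by apply: boundedB; [exact: bounded1|eexists; exact: bnd_embed].
Qed.

End StarHomContractions.

(** * Closed spans and closed subspaces *)

Section ClosedSpan.
Variables (R : realType) (V : normedModType R[i]).
Implicit Types (S P : set V) (x y : V).

Record closed_subspace P : Prop := {
  cs0 : P 0;
  csD : forall x y, P x -> P y -> P (x + y);
  csZ : forall (c : R[i]) x, P x -> P (c *: x);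
  cs_closure : closure P `<=` P
}.

Lemma closed_span_le S P : closed_subspace P -> S `<=` P -> closed_span S `<=` P.
Proof.
move=> Pcs SP x; move=> /(closure_subset _) Sx; apply: (cs_closure Pcs); apply: Sx.
move=> _ [n [c [v [Sv ->]]]].
by elim/big_ind: _ => [|y z|i _]; [exact: cs0|exact: csD|apply: csZ => //; exact: SP].
Qed.

Lemma mem_closed_span S x : S x -> closed_span S x.
Proof.
move=> Sx; apply: subset_closure; exists 1%N, (fun=> 1), (fun=> x).
by rewrite big_ord1 scale1r.
Qed.

Lemma closed_span_subspace S : closed_subspace (closed_span S).
Proof.
split.
- by apply: subset_closure; exists 0%N, (fun=> 0), (fun=> 0); rewrite big_ord0; split=> // -[].
- move=> x y /closure_rnormP Sx /closure_rnormP Sy; apply/closure_rnormP => e e0.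
  have e2 : 0 < e / 2 by rewrite divr_gt0.
  have [x' [n [c [v [Sv x'E]]]] xx'] := Sx _ e2.
  have [y' [m [d [w [Sw y'E]]]] yy'] := Sy _ e2.
  exists (x' + y'); last first.
    by rewrite opprD addrACA (le_lt_trans (rnormD _ _))// [ltRHS]splitr ltrD.
  exists (n + m)%N, (fun i : 'I_(n + m) => match fintype.split i with inl i => c i | inr i => d i end),
    (fun i : 'I_(n + m) => match fintype.split i with inl i => v i | inr i => w i end); split.
    by move=> i; case: fintype.split.
  rewrite big_split_ord/= x'E y'E; congr (_ + _); apply: eq_bigr => i _.
    by rewrite (unsplitK (inl i)).
  by rewrite (unsplitK (inr i)).
- move=> a x /closure_rnormP Sx; apply/closure_rnormP => e e0.
  have a1 : 0 < cabs a + 1 by rewrite ltr_wpDl ?cabs_ge0.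
  have [x' [n [c [v [Sv x'E]]]] xx'] := Sx _ (divr_gt0 e0 a1).
  exists (a *: x').
    exists n, (fun i => a * c i), v; split=> //.
    by rewrite x'E scaler_sumr; apply: eq_bigr => i _; rewrite scalerA.
  move: xx'; rewrite ltr_pdivlMr// => xx'.
  rewrite -scalerBr (le_lt_trans _ xx')//.
  have -> : rnorm (a *: (x - x')) = cabs a * rnorm (x - x').
    by apply: complexI; rewrite -rnormE normrZ cabsE rnormE rmorphM.
  by rewrite mulrC ler_wpM2l ?rnorm_ge0// lerDl.
- by rewrite /closed_span; set T := [set x | _]; have /closure_id <- := @closed_closure _ T.
Qed.

End ClosedSpan.

(** Used with [closed_span_le] to pass from spanning elements to a whole closed span along a bounded
    linear map. *)
Lemma closed_subspace_preimage (R : realType) (V W : normedModType R[i])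
    (f : W -> V) (c : R) (P : set V) :
  linear f -> (forall z : W, rnorm (f z) <= c * rnorm z) ->
  closed_subspace P -> closed_subspace (f @^-1` P).
Proof.
move=> fl fc Pcs; split => /=.
- by rewrite (lin0 fl); exact: cs0.
- by move=> x y Px Py; rewrite (linD fl); exact: csD.
- by move=> a x Px; rewrite (linZ fl); exact: csZ.
move=> x /closure_rnormP Px; apply: (cs_closure Pcs); apply/closure_rnormP => e e0.
have c1 : 0 < `|c| + 1 by rewrite ltr_wpDl.
have [y Py xy] := Px _ (divr_gt0 e0 c1); exists (f y) => //.
move: xy; rewrite ltr_pdivlMr// => xy.
rewrite -(linB fl) (le_lt_trans (fc _))// (le_lt_trans _ xy)// mulrC.
by rewrite ler_wpM2l ?rnorm_ge0// (le_trans (ler_norm _))// lerDl.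
Qed.

(** * The GNS representation *)

Section OperatorEvaluation.
Variables (R : realType) (H : hilbertType R).
Implicit Types (S T : bop H) (x : H).

Lemma bopDE S T x : (S + T) x = S x + T x. Proof. by []. Qed.
Lemma bopZE c T x : (c *: T) x = c *: T x. Proof. by []. Qed.
Lemma bopME S T x : (S ** T) x = S (T x). Proof. by []. Qed.
Lemma bop_starE T x : star T x = badj T x. Proof. by []. Qed.
Lemma bop1E x : (sone : bop H) x = x. Proof. by []. Qed.
Lemma bop0E x : (0 : bop H) x = 0. Proof. by []. Qed.

End OperatorEvaluation.

Section MultiplierEvaluation.
Variables (R : realType) (B : cstarAlgType R).
Implicit Types (m n : multiplier B) (x : B).

Lemma mullDE m n x : mull (m + n) x = mull m x + mull n x. Proof. by []. Qed.
Lemma mullZE c m x : mull (c *: m) x = c *: mull m x. Proof. by []. Qed.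
Lemma mullME m n x : mull (m ** n) x = mull m (mull n x). Proof. by []. Qed.

End MultiplierEvaluation.

Section GNS.
Variables (R : realType) (B : cstarAlgType R) (F : B -> R[i]).
Hypothesis Fpos : positive_functional F.
Implicit Types (x y b : B) (m n : multiplier B).

Definition gns_form x y : R[i] := F (star y ** x).

Lemma gns_formDl x y z : gns_form (x + y) z = gns_form x z + gns_form y z.
Proof. by rewrite /gns_form smulDr (pfD Fpos). Qed.

Lemma gns_formZl c x z : gns_form (c *: x) z = c * gns_form x z.
Proof. by rewrite /gns_form smulZr (pfZ Fpos). Qed.

Lemma gns_formC x y : gns_form y x = (gns_form x y)^*.
Proof. by rewrite /gns_form -(pf_star Fpos) starM starK. Qed.

Definition gns_inner := SemiInner gns_formDl gns_formZl gns_formC (pf_ge0 Fpos).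

Definition gns_space := completion gns_inner.

Local Notation sn := (seminorm gns_inner).

Lemma gns_seminorm_le x : sn x <= 2 * rnorm x.
Proof.
rewrite -ler_sqr ?nnegrE ?mulr_ge0 ?seminorm_ge0 ?rnorm_ge0//.
rewrite -[leLHS]cabs_real ?exprn_ge0 ?seminorm_ge0// -sip_seminorm.
rewrite -lecR -cabsE (le_trans (pf_bound Fpos _))// lecR rnorm_cstar.
by have := sqr_ge0 (rnorm x); lra.
Qed.

Lemma gns_mull_adjoint m x y : gns_form (mull m x) y = gns_form x (mull (star m) y).
Proof. by rewrite /gns_form mulrl /= !starK. Qed.

(** Positivity of F at (k x)^* (k x), where k^2 = c^2 - m^* m. *)
Lemma gns_mull_bound m (c : R) x : 0 < c -> bnd m c -> sn (mull m x) <= c * sn x.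
Proof.
move=> c0 mc.
have bm : bounded m by exists c.
have mmc : bnd (star m ** m) (c ^+ 2) by apply: bndM => //; exact: bnd_star.
have [k [kk bk kE]] := pos_bnd_sub (pos_star_smul bm) mmc (exprn_gt0 2 c0).
have kx : gns_form (mull k x) (mull k x) =
    (c ^+ 2)%:C * gns_form x x - gns_form (mull m x) (mull m x).
  rewrite !gns_mull_adjoint kk -[mull k (mull k x)]/(mull (k ** k) x) kE.
  rewrite -[mull _ x]/((c ^+ 2)%:C *: x - mull (star m) (mull m x)).
  have := sipDr gns_inner x; rewrite /= => ->.
  have := sipNr gns_inner x; rewrite /= => ->.
  have := sipZr gns_inner; rewrite /= => ->.
  by rewrite conj_Creal ?complex_real.
have := Re_sip_ge0 gns_inner (mull k x); rewrite /= kx.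
rewrite [gns_form x x](sip_seminorm gns_inner x).
rewrite [gns_form (mull m x) _](sip_seminorm gns_inner (mull m x)).
rewrite -rmorphM -rmorphB /= subr_ge0 -exprMn.
by rewrite ler_sqr ?nnegrE ?mulr_ge0 ?seminorm_ge0 ?(ltW c0).
Qed.

Lemma gns_adjointable m : bounded m -> adjointable gns_inner (mull m) (mull (star m)).
Proof.
move=> bm; split; first exact: gns_mull_adjoint.
have [c c0 mc] := bounded_pos (bounded_star bm).
by exists c => [|x]; [exact: ltW|exact: gns_mull_bound].
Qed.

Lemma gns_adjointable_star m :
  bounded m -> adjointable gns_inner (mull (star m)) (mull m).
Proof. by move=> /bounded_star /gns_adjointable; rewrite starK. Qed.

(* Junk value [0] at unbounded multipliers. *)
Definition gns_op m : bop gns_space :=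
  if pselect (bounded m) is left bm then
    cbop (gns_adjointable bm) (gns_adjointable_star bm)
  else 0.

Lemma gns_opE m (phi : gns_space) y : bounded m ->
  gns_op m phi y = phi (mull (star m) y).
Proof. by move=> bm; rewrite /gns_op; case: pselect. Qed.

Lemma gns_op_adjE m (phi : gns_space) y : bounded m ->
  badj (gns_op m) phi y = phi (mull m y).
Proof. by move=> bm; rewrite /gns_op; case: pselect. Qed.

(** Antilinearity is inherited from the inner product, since phi y is that of phi with the vector of
    y. *)
Lemma cfun_conj (phi : gns_space) c x y : phi (c *: x + y) = c^* * phi x + phi y.
Proof.
have cembed_lin : cembed gns_inner (c *: x + y) =
    c *: cembed gns_inner x + cembed gns_inner y.
  by apply: cfun_inj => z; rewrite cfunDE cfunZE /= gns_formDl gns_formZl.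
have := sipDr (completion_inner gns_inner) phi (c *: cembed gns_inner x) (cembed gns_inner y).
have := sipZr (completion_inner gns_inner) c phi (cembed gns_inner x).
by rewrite /= -cembed_lin !cinner_embed => ->.
Qed.

Lemma gns_op_linear c m n : bounded (c *: m) -> bounded m -> bounded n ->
  gns_op (c *: m + n) = c *: gns_op m + gns_op n.
Proof.
move=> bcm bm bn; apply: bopP => phi; apply: cfun_inj => y.
rewrite gns_opE; last exact: boundedD.
rewrite bopDE bopZE cfunDE cfunZE !gns_opE//.
by rewrite starD starZ mullDE mullZE cfun_conj conjCK.
Qed.

Lemma gns_opM m n : bounded m -> bounded n -> gns_op (m ** n) = gns_op m ** gns_op n.
Proof.
move=> bm bn; apply: bopP => phi; apply: cfun_inj => y.
rewrite gns_opE; last exact: boundedM.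
by rewrite bopME !gns_opE// starM.
Qed.

Lemma gns_op_star m : bounded m -> gns_op (star m) = star (gns_op m).
Proof.
move=> bm; apply: bopP => phi; apply: cfun_inj => y.
by rewrite gns_opE; [rewrite starK bop_starE gns_op_adjE|exact: bounded_star].
Qed.

Lemma gns_op_embed m x : bounded m ->
  gns_op m (cembed gns_inner x) = cembed gns_inner (mull m x).
Proof.
by move=> bm; apply: cfun_inj => y; rewrite gns_opE//= gns_mull_adjoint.
Qed.

Definition gns_rep b : bop gns_space := gns_op (mult_embed b).

Lemma bounded_embed b : bounded (mult_embed b).
Proof. by eexists; exact: bnd_embed. Qed.

Lemma gns_rep_star_hom : star_hom gns_rep.
Proof.
have [embD embM embS] := mult_embed_star_hom B; split=> [c x y|x y|x].
- rewrite /gns_rep embD gns_op_linear//; try exact: bounded_embed.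
  by rewrite -(linZ embD); exact: bounded_embed.
- by rewrite /gns_rep embM gns_opM//; exact: bounded_embed.
- by rewrite /gns_rep embS gns_op_star//; exact: bounded_embed.
Qed.

(** F at (b x)^* (b x) is the squared norm of the image under b of the vector of x. Without a unit
    there is no vector of 1 to start from, which is why products b x are tested. *)
Lemma gns_rep_eq0 b x : gns_rep b = 0 -> F (star (b ** x) ** (b ** x)) = 0.
Proof.
move=> b0; have := gns_op_embed x (bounded_embed b).
rewrite -/(gns_rep b) b0 bop0E.
by move=> /(congr1 (fun phi : gns_space => phi (b ** x)))/esym.
Qed.

Lemma gns_space_dense (P : set gns_space) : closed_subspace P ->
  (forall x, P (cembed gns_inner x)) -> P = [set: gns_space].
Proof.
move=> Pcs Px; apply/seteqP; split=> // phi _; apply: (cs_closure Pcs).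
apply/closure_rnormP => e e0; have e2 : 0 < e / 2 by rewrite divr_gt0.
have [x px] := cfun_approx phi e2; exists (cembed gns_inner x) => //.
by rewrite (le_lt_trans (approx_cnorm (ltW e2) px))// ltr_pdivrMr// ltr_pMr// ltr1n.
Qed.

Lemma cembed_linear : linear (cembed gns_inner).
Proof.
by move=> c x y; apply: cfun_inj => z; rewrite cfunDE cfunZE /= gns_formDl gns_formZl.
Qed.

Lemma cembed_bound x : rnorm (cembed gns_inner x) <= 2 * rnorm x.
Proof. by rewrite rnorm_completion cnorm_embed gns_seminorm_le. Qed.

Lemma gns_rep_nondegenerate (A : cstarAlgType R) (j : A -> B) :
  nondegenerate_hom j -> nondegenerate_rep (gns_rep \o j).
Proof.
move=> [[jl jM jS] jspan]; have [rl rM rS] := gns_rep_star_hom.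
split.
  split=> [c x y|x y|x] /=; first by rewrite jl rl.
    by rewrite jM rM.
  by rewrite jS rS.
set S := [set y | _]; have Wcs := closed_span_subspace S.
apply: gns_space_dense => // x.
suff : [set: B] `<=` cembed gns_inner @^-1` closed_span S by exact.
rewrite -jspan; apply: closed_span_le.
  exact: closed_subspace_preimage cembed_linear cembed_bound Wcs.
move=> _ [a [b ->]] /=; apply: mem_closed_span; exists a, (cembed gns_inner b).
by rewrite gns_op_embed//; exact: bounded_embed.
Qed.

End GNS.

(** * Partial isometries *)

Section Sandwich.
Variables (R : realType) (B : cstarAlgType R).
Implicit Types (x : B) (m n : multiplier B).

Lemma mulr_sandwich m x n n' : mulr n' (sandwich m x n) = sandwich m x (n ** n').
Proof. by []. Qed.

Lemma mull_mulr m n x : mull m (mulr n x) = mulr n (mull m x).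
Proof. by apply: smul_injr => b; rewrite mulrl -!mulrrM mulrl. Qed.

Lemma mull_sandwich m x n n' : mull n' (sandwich m x n) = sandwich (n' ** m) x n.
Proof. by rewrite /sandwich mull_mulr. Qed.

Lemma sandwich_shift m p n x : p ** mult_embed x = mult_embed x ** p ->
  sandwich (m ** p) x n = sandwich m x (p ** n).
Proof.
move=> px; apply: mult_embed_inj; rewrite !mult_embed_sandwich.
by rewrite -[m ** p ** _]smulA px !smulA.
Qed.

Lemma sandwich0l x n : sandwich 0 x n = 0.
Proof. by rewrite /sandwich /= mulrr0. Qed.

Lemma sandwich0r x m : sandwich m x 0 = 0.
Proof. by []. Qed.

Lemma mulr_bound n (c : R) x : bnd n c -> rnorm (mulr n x) <= c * rnorm x.
Proof.
move=> nc; have [_ /(_ (star x))] := bnd_star nc.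
by rewrite /= starK !rnorm_star.
Qed.

End Sandwich.

Section PartialIsometries.
Variables (R : realType) (B : cstarAlgType R).
Implicit Types (v p r : multiplier B).

(** For p = v^* v one has p^* p = p, so |p b|^2 = |b^* (p b)| <= |b| |p b|. *)
Lemma bnd_partial_isometry v : partial_isometry v -> bnd v 1.
Proof.
move=> vp; apply: bnd_cstar => //; rewrite expr1n; set p := star v ** v.
have pp : star p ** p = p.
  by rewrite starM starK /p -smulA [v ** (star v ** v)]smulA vp.
split=> // b; rewrite mul1r.
have [->|pb0] := eqVneq (rnorm (mull p b)) 0; first exact: rnorm_ge0.
have pb1 : 0 < rnorm (mull p b) by rewrite lt_def pb0 rnorm_ge0.
rewrite -(ler_pM2r pb1) -expr2 rnorm_mull pp (le_trans (rnormM _ _))//.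
by rewrite rnorm_star.
Qed.

(* The compression [p r p] is a projection and [p r - p r p] is killed by its *)
(* adjoint. *)
Lemma projections_commute p r : star p = p -> p ** p = p -> star r = r ->
  r ** r = r -> p ** r ** p ** r = p ** r -> p ** r = r ** p.
Proof.
move=> sp pp sr rr prpr.
have kk : p ** r ** p ** (r ** p) = p ** r ** p by rewrite smulA prpr.
have rp : r ** p = p ** r ** p.
  apply/eqP; rewrite -subr_eq0; apply/eqP/mult_star_smul_eq0.
  have -> : star (r ** p - p ** r ** p) = p ** r - p ** r ** p.
    by rewrite starB !starM sp sr !smulAr.
  rewrite smulDl !smulDr !smul_Nl !smul_Nr.
  have -> : p ** r ** (r ** p) = p ** r ** p by rewrite smulA -[p ** r ** r]smulA rr.
  have -> : p ** r ** (p ** r ** p) = p ** r ** p by rewrite !smulA prpr.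
  have -> : p ** r ** p ** (p ** r ** p) = p ** r ** p.
    by rewrite !smulA -[p ** r ** p ** p]smulA pp prpr.
  by rewrite kk; lmodule R[i].
have := congr1 star rp; rewrite !starM sp sr => pr.
by rewrite [RHS]rp [LHS]pr smulA.
Qed.

End PartialIsometries.

Section PartialIsometricRepresentation.
Variables (R : realType) (G : orderedGroupType) (B : cstarAlgType R).
Variable v : posCone G -> multiplier B.
Hypothesis v_rep : piso_representation v.
Implicit Types s t u : posCone G.

Let v_partial s : v s ** star (v s) ** v s = v s.
Proof. by have [H _] := v_rep; exact: H. Qed.

Let vD s t : v s ** v t = v (s + t).
Proof. by have [_ H] := v_rep; exact: H. Qed.

Definition initial_proj s := star (v s) ** v s.
Definition final_proj s := v s ** star (v s).

Lemma initial_proj_star s : star (initial_proj s) = initial_proj s.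
Proof. by rewrite starM starK. Qed.

(** Let p be the initial projection of v_s and r the final projection of v_t. That v_s v_t = v_{s+t}
    is a partial isometry gives p r p r = p r, to which [projections_commute] applies. *)
Lemma initial_final_commute s t :
  initial_proj s ** final_proj t = final_proj t ** initial_proj s.
Proof.
apply: projections_commute.
- exact: initial_proj_star.
- by rewrite /initial_proj -smulA [v s ** (_ ** _)]smulA v_partial.
- by rewrite starM starK.
- by rewrite /final_proj smulA v_partial.
have vst := v_partial (s + t).
rewrite -vD starM in vst.
have -> : initial_proj s ** final_proj t ** initial_proj s ** final_proj t =
    star (v s) ** (v s ** v t ** (star (v t) ** star (v s)) ** (v s ** v t)) ** star (v t).
  by rewrite !smulA.
by rewrite vst !smulA.
Qed.

Lemma posCone_le_total s t : (exists u, t = u + s) \/ (exists u, s = u + t).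
Proof.
have sub s' t' : pos_val s' <= pos_val t' -> exists u, t' = u + s'.
  move=> st; have u0 : 0 <= pos_val t' - pos_val s'.
    by rewrite addrC -(addNr (pos_val s')) og_leD2l.
  by exists (PosCone u0); apply: val_inj; rewrite /= subrK.
by have /orP[/sub|/sub] := og_le_total (pos_val s) (pos_val t); [left|right].
Qed.

(* [1 - v_t^* v_t] moves to the left of [v_s]: it becomes [1 - v_u^* v_u]     *)
(* when [t = u + s], and vanishes when [s = u + t].                           *)
Lemma defect_move s t : v s ** (sone - initial_proj t) = 0 \/
  exists u, v s ** (sone - initial_proj t) = (sone - initial_proj u) ** v s.
Proof.
have [[u ->]|[u ->]] := posCone_le_total s t; [right; exists u|left].
  rewrite smulDr smulDl smul_Nr smul_Nl smul1r smul1l; congr (_ - _).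
  have -> : v s ** initial_proj (u + s) = final_proj s ** initial_proj u ** v s.
    by rewrite /initial_proj -vD starM !smulA.
  by rewrite -initial_final_commute -smulA v_partial.
by rewrite -vD smulDr smul_Nr smul1r /initial_proj -smulA [v t ** (_ ** _)]smulA v_partial subrr.
Qed.

Lemma bnd_piso s : bnd (v s) 1.
Proof. exact: bnd_partial_isometry (v_partial s). Qed.

Lemma defect_star s : star (sone - initial_proj s) = sone - initial_proj s.
Proof. by rewrite starB star1 initial_proj_star. Qed.

Lemma bnd_defect s : bnd (sone - initial_proj s) 2.
Proof.
rewrite (_ : 2 = 1 + 1 * 1); last by rewrite mul1r.
apply: bndB; first exact: bnd1.
by apply: bndM; [apply: bnd_star|]; exact: bnd_piso.
Qed.

End PartialIsometricRepresentation.

(** * The defect ideal *)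

Section DefectIdeal.
Variables (R : realType) (G : orderedGroupType) (A : cstarAlgType R).
Variable alpha : posCone G -> A -> A.
Variables (B : cstarAlgType R) (jA : A -> B) (jG : posCone G -> multiplier B).
Hypothesis j_cov : piso_covariant alpha (fun a => mult_embed (jA a)) jG.
Hypothesis j_gen : generates jA jG.
Implicit Types (a : A) (b : B) (s t x y : posCone G).

Let j_rep : piso_representation jG. Proof. by case: j_cov. Qed.
Let q t : multiplier B := sone - star (jG t) ** jG t.

Definition defect_generators := [set b : B | exists (a : A) (x y t : posCone G),
  b = sandwich (star (jG x)) (jA a) ((sone - star (jG t) ** jG t) ** jG y)].

Definition defect_ideal := closed_span defect_generators.

Let J_subspace : closed_subspace defect_ideal.
Proof. exact: closed_span_subspace. Qed.

Let gen_mem a x y t : defect_ideal (sandwich (star (jG x)) (jA a) (q t ** jG y)).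
Proof. by apply: mem_closed_span; exists a, x, y, t. Qed.

Lemma defect_commute t a : q t ** mult_embed (jA a) = mult_embed (jA a) ** q t.
Proof.
have [_ /(_ t a)[_ qa]] := j_cov.
by rewrite /q smulDl smulDr smul1l smul1r smul_Nl smul_Nr qa.
Qed.

Lemma dense_ind (P : set B) : closed_subspace P ->
  (forall s a t, P (sandwich (star (jG s)) (jA a) (jG t))) -> forall b, P b.
Proof.
move=> Pcs PS b; suff : [set: B] `<=` P by exact.
rewrite -j_gen; apply: closed_span_le => // _ [s [a [t ->]]]; exact: PS.
Qed.

Lemma closed_subspace_mull m (P : set B) : bounded m -> closed_subspace P ->
  closed_subspace (mull m @^-1` P).
Proof.
move=> [c [_ mc]]; apply: closed_subspace_preimage mc.
exact: mull_linear.
Qed.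

Lemma closed_subspace_mulr m (P : set B) : bounded m -> closed_subspace P ->
  closed_subspace (mulr m @^-1` P).
Proof.
move=> [c mc]; apply: closed_subspace_preimage; first exact: mulr_linear.
by move=> z; apply: mulr_bound mc.
Qed.

Let bounded_j s : bounded (jG s).
Proof. by exists 1; exact: bnd_piso j_rep s. Qed.

Let bounded_q t : bounded (q t).
Proof. by exists 2; exact: bnd_defect j_rep t. Qed.

(** On a spanning element the factor j(u) q_t j(x) is 0 or q_w j(u + x), by [defect_move]. *)
Lemma mulr_defect_mem t x b : defect_ideal (mulr (q t ** jG x) b).
Proof.
apply: (@dense_ind (mulr (q t ** jG x) @^-1` defect_ideal)).
  by apply: closed_subspace_mulr => //; exact: boundedM (bounded_q t) (bounded_j x).
move=> s a u; rewrite -[preimage _ _ _]/(defect_ideal (mulr _ _)).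
rewrite mulr_sandwich smulA.
have [->|[w ->]] := defect_move j_rep u t.
  by rewrite smul_0l sandwich0r; exact: cs0 J_subspace.
rewrite smulAr; have [_ ->] := j_rep; exact: gen_mem.
Qed.

(** The adjoint form of [defect_move] makes q_t j(s)^* either 0 or j(s)^* q_w, and q_w commutes with
    j(a). *)
Lemma mull_defect_mem t b : defect_ideal (mull (q t) b).
Proof.
apply: (@dense_ind (mull (q t) @^-1` defect_ideal)).
  exact: closed_subspace_mull (bounded_q t) J_subspace.
move=> s a u; rewrite -[preimage _ _ _]/(defect_ideal (mull _ _)).
rewrite mull_sandwich.
have -> : q t ** star (jG s) = star (jG s ** q t).
  by rewrite starM (defect_star jG).
have [->|[w ->]] := defect_move j_rep s t.
  by rewrite star0 sandwich0l; exact: cs0 J_subspace.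
rewrite starM (defect_star jG) sandwich_shift; last exact: defect_commute.
exact: gen_mem.
Qed.

(** In m j(x)^* j(a) q_t j(y) the part before q_t is an element of [B], so [mulr_defect_mem]
    applies. *)
Lemma mull_defect_ideal m b : bounded m -> defect_ideal b -> defect_ideal (mull m b).
Proof.
move=> bm; apply: (@closed_span_le _ _ _ (mull m @^-1` defect_ideal)).
  exact: closed_subspace_mull.
move=> _ [a [x [y [t ->]]]]; rewrite -[preimage _ _ _]/(defect_ideal (mull _ _)).
by rewrite /sandwich mull_mulr; exact: mulr_defect_mem.
Qed.

Lemma smul_defect_ideal c b : defect_ideal b -> defect_ideal (c ** b).
Proof.
by move=> Jb; apply: (@mull_defect_ideal (mult_embed c)) => //; exact: bounded_embed.
Qed.

Lemma star_closed_subspace (P : set B) : closed_subspace P ->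
  closed_subspace (@star R B @^-1` P).
Proof.
move=> Pcs; split => /=.
- by rewrite star0; exact: cs0.
- by move=> b c Pb Pc; rewrite starD; exact: csD.
- by move=> r b Pb; rewrite starZ; exact: csZ.
move=> b /closure_rnormP Pb; apply: (cs_closure Pcs); apply/closure_rnormP => e e0.
have [c Pc bc] := Pb e e0; exists (star c) => //.
by rewrite -starB rnorm_star.
Qed.

Lemma defect_ideal_closed_star_ideal : closed_star_ideal defect_ideal.
Proof.
split.
- exact: csD J_subspace.
- exact: csZ J_subspace.
- exact: smul_defect_ideal.
- move=> b c; apply: (@closed_span_le _ _ _ (mulr (mult_embed b) @^-1` defect_ideal)).
    by apply: closed_subspace_mulr => //; exact: bounded_embed.
  move=> _ [a [x [y [t ->]]]]; rewrite -[preimage _ _ _]/(defect_ideal (_ ** b)).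
  by rewrite /sandwich -mulrl mullME; exact/smul_defect_ideal/mull_defect_mem.
- move=> c; apply: (@closed_span_le _ _ _ (@star R B @^-1` defect_ideal)).
    exact: star_closed_subspace.
  move=> _ [a [x [y [t ->]]]]; rewrite -[preimage _ _ _]/(defect_ideal (star _)).
  rewrite /sandwich; set z := mull _ _.
  have -> : star (mulr (q t ** jG y) z) = mull (star (jG y)) (mull (q t) (star z)).
    rewrite -mullME -[X in mull (_ ** X)](defect_star jG t) -starM /=.
    by rewrite starK.
  apply: mull_defect_ideal; first exact: bounded_star.
  exact: mull_defect_mem.
- exact: cs_closure J_subspace.
- exact: cs0 J_subspace.
Qed.

End DefectIdeal.

(** * The kernel *)

Lemma closed_subspace0 (R : realType) (V : normedModType R[i]) :
  closed_subspace [set (0 : V)].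
Proof.
split => //= [_ _ -> ->|c _ ->|x /closure_rnormP x0]; rewrite ?addr0 ?scaler0//.
apply: (@rnorm_small _ _ _ 1) => e e0; have [_ -> ] := x0 e e0.
by rewrite subr0 mul1r => /ltW.
Qed.

(** V^* = V^* V V^*, and V^* V commutes with pi a, so pi a V^* = V^* (V pi a V^* ). *)
Lemma piso_intertwine (R : realType) (G : orderedGroupType) (A : cstarAlgType R)
    (alpha : posCone G -> A -> A) (U : unitStarAlgType R) (pi : A -> U)
    (V : posCone G -> U) t a : piso_covariant alpha pi V ->
  pi a ** star (V t) = star (V t) ** pi (alpha t a).
Proof.
move=> [[Vp _] cov]; have [-> pV] := cov t a.
have VVV : star (V t) ** V t ** star (V t) = star (V t).
  by rewrite -[RHS](congr1 star (Vp t)) !starM starK smulA.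
by rewrite !smulA pV -[RHS]smulA VVV.
Qed.

Section KernelContainsDefect.
Variables (R : realType) (G : orderedGroupType) (A : cstarAlgType R).
Variable alpha : posCone G -> A -> A.
Variables (B : cstarAlgType R) (jA : A -> B) (jG : posCone G -> multiplier B).
Variables (C : cstarAlgType R) (iA : A -> C) (iG : posCone G -> multiplier C).
Variable phi : B -> C.
Hypothesis j_cov : piso_covariant alpha (fun a => mult_embed (jA a)) jG.
Hypothesis i_cov : iso_covariant alpha (fun a => mult_embed (iA a)) iG.
Hypothesis hphi : star_hom phi.
Hypothesis phiE : forall (a : A) (x y : posCone G),
  phi (sandwich (star (jG x)) (jA a) (jG y)) =
  sandwich (star (iG x)) (iA a) (iG y).

(** The subtracted term equals j(t+x)^* j(alpha_t a) j(t+y). Its image contains i(t)^* i(t) = 1 on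
    both sides of i(a) and reduces to i(x)^* i(a) i(y). *)
Lemma phi_defect_generator a x y t :
  phi (sandwich (star (jG x)) (jA a)
    ((sone - star (jG t) ** jG t) ** jG y)) = 0.
Proof.
have [phil _ _] := hphi.
have jD s s' : jG s ** jG s' = jG (s + s') by case: j_cov => -[_ H] _; exact: H.
have iD s s' : iG s ** iG s' = iG (s + s') by case: i_cov => -[_ H] _; exact: H.
have iiso s : star (iG s) ** iG s = sone by case: i_cov => -[H _] _; exact: H.
have icov s c : mult_embed (iA (alpha s c)) = iG s ** mult_embed (iA c) ** star (iG s).
  by case: i_cov => _; exact.
have -> : sandwich (star (jG x)) (jA a) ((sone - star (jG t) ** jG t) ** jG y) =
    sandwich (star (jG x)) (jA a) (jG y) -
    sandwich (star (jG (t + x))) (jA (alpha t a)) (jG (t + y)).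
  have -> : sandwich (star (jG (t + x))) (jA (alpha t a)) (jG (t + y)) =
      sandwich (star (jG x)) (jA a) (star (jG t) ** jG t ** jG y).
    apply: mult_embed_inj; rewrite !mult_embed_sandwich -!jD starM !smulA.
    congr (_ ** _ ** _); rewrite -!smulA; congr (_ ** _).
    by rewrite (piso_intertwine t a j_cov).
  by rewrite smulDl smul1l smul_Nl.
rewrite (linB phil) !phiE; apply/eqP; rewrite subr_eq0; apply/eqP.
apply: mult_embed_inj; rewrite !mult_embed_sandwich icov -!iD starM.
rewrite !smulA -[star (iG x) ** star (iG t) ** iG t]smulA iiso smul1r.
by rewrite -[_ ** star (iG t) ** iG t]smulA iiso smul1r.
Qed.

Lemma defect_ideal_sub_kernel b : defect_ideal jA jG b -> phi b = 0.
Proof.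
have [phil _ _] := hphi.
apply: (@closed_span_le _ _ _ (phi @^-1` [set 0])).
  apply: (closed_subspace_preimage phil (c := 1)); last exact: closed_subspace0.
  by move=> z; rewrite mul1r; exact: star_hom_contraction.
by move=> _ [a [x [y [t ->]]]]; exact: phi_defect_generator.
Qed.

End KernelContainsDefect.

(** * The GNS representation of a functional that vanishes on the defect ideal *)

Section DefectRepresentation.
Variables (R : realType) (G : orderedGroupType) (A : cstarAlgType R).
Variable alpha : posCone G -> A -> A.
Variables (B : cstarAlgType R) (jA : A -> B) (jG : posCone G -> multiplier B).
Hypothesis j_cov : piso_covariant alpha (fun a => mult_embed (jA a)) jG.
Hypothesis j_gen : generates jA jG.
Variable F : B -> R[i].
Hypothesis Fpos : positive_functional F.
Hypothesis F_J : forall b, defect_ideal jA jG b -> F b = 0.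

Let JI := defect_ideal_closed_star_ideal j_cov j_gen.

Let bounded_j s : bounded (jG s).
Proof. by exists 1; apply: bnd_piso; case: j_cov. Qed.

(** xi z is a limit of values F (z^* x), and z^* x lies in the ideal. *)
Lemma gns_vanish (xi : gns_space Fpos) z : defect_ideal jA jG z -> xi z = 0.
Proof.
move=> Jz; apply: (@cabs_small _ _ (seminorm (gns_inner Fpos) z)) => e e0.
have [x px] := cfun_approx xi e0; rewrite mulrC (le_trans _ (px z))//.
rewrite /= /gns_form F_J ?subr0//.
by apply: (csiMr JI); exact: (csi_star JI).
Qed.

(** Evaluated at y, the two sides differ by the value of xi at (1 - j(s)^* j(s)) y, an element of
    the ideal. *)
Lemma gns_isometry s :
  star (gns_op Fpos (jG s)) ** gns_op Fpos (jG s) = sone.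
Proof.
have bs := bounded_star (bounded_j s).
rewrite -gns_op_star// -gns_opM//; apply: bopP => xi; apply: cfun_inj => y.
rewrite gns_opE; last exact: boundedM.
rewrite bop1E starM starK.
have := cfun_conj xi 1 (mull (sone - star (jG s) ** jG s) y) (mull (star (jG s) ** jG s) y).
rewrite scale1r rmorph1 mul1r -mullDE subrK => ->.
by rewrite (gns_vanish _ (@mull_defect_mem _ _ _ _ _ _ _ j_cov j_gen s y)) add0r.
Qed.

Lemma gns_iso_covariant :
  iso_covariant alpha (gns_rep Fpos \o jA) (fun s => gns_op Fpos (jG s)).
Proof.
have jD s s' : jG s ** jG s' = jG (s + s') by case: j_cov => -[_ H] _; exact: H.
split; first split.
- exact: gns_isometry.
- by move=> s t; rewrite -gns_opM// jD.
move=> s a; rewrite /= /gns_rep; have [_ /(_ s a)[-> _]] := j_cov.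
have ba := bounded_embed (jA a); have bs := bounded_star (bounded_j s).
by rewrite gns_opM ?gns_opM ?gns_op_star//; exact: boundedM.
Qed.

Lemma gns_rep_sandwich s a t : gns_rep Fpos (sandwich (star (jG s)) (jA a) (jG t)) =
  star (gns_op Fpos (jG s)) ** gns_rep Fpos (jA a) ** gns_op Fpos (jG t).
Proof.
have ba := bounded_embed (jA a); have bs := bounded_star (bounded_j s).
rewrite /gns_rep mult_embed_sandwich gns_opM//; last exact: boundedM.
by rewrite gns_opM// gns_op_star.
Qed.

End DefectRepresentation.

Lemma star_hom_eq_on_generators (R : realType) (G : orderedGroupType)
    (A B : cstarAlgType R) (jA : A -> B) (jG : posCone G -> multiplier B)
    (H : hilbertType R) (sigma tau : B -> bop H) :
  generates jA jG -> star_hom sigma -> star_hom tau ->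
  (forall s a t, sigma (sandwich (star (jG s)) (jA a) (jG t)) =
                 tau (sandwich (star (jG s)) (jA a) (jG t))) ->
  sigma =1 tau.
Proof.
move=> gen hs ht st b; apply: bopP => xi.
have [sl _ _] := hs; have [tl _ _] := ht.
pose f b := sigma b xi - tau b xi.
suff /eqP : f b = 0 by rewrite subr_eq0 => /eqP.
apply: (dense_ind gen (P := f @^-1` [set 0])) => [|s a t]; last first.
  by rewrite /preimage /= /f st subrr.
apply: (closed_subspace_preimage (c := 2 * rnorm xi)); last exact: closed_subspace0.
  move=> c x y; rewrite /f sl tl !bopDE !bopZE scalerBr.
  by rewrite opprD addrACA.
move=> z; rewrite /f (le_trans (rnormB _ _))//.
have := star_hom_bop_contraction z xi hs; have := star_hom_bop_contraction z xi ht.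
by lra.
Qed.

Theorem proposition2p3 (R : realType) (G : orderedGroupType)
    (A : cstarAlgType R) (alpha : posCone G -> A -> A)
    (B : cstarAlgType R) (jA : A -> B) (jG : posCone G -> multiplier B)
    (C : cstarAlgType R) (iA : A -> C) (iG : posCone G -> multiplier C)
    (phi : B -> C)
    (halpha : dynamical_system alpha)
    (hB : piso_crossed_product alpha jA jG)
    (hC : iso_crossed_product alpha iA iG)
    (hphi : star_hom phi)
    (phi_surj : forall c : C, exists b : B, phi b = c)
    (phiE : forall (a : A) (x y : posCone G),
      phi (sandwich (star (jG x)) (jA a) (jG y)) =
      sandwich (star (iG x)) (iA a) (iG y)) :
  [set b : B | phi b = 0] =
  closed_span [set b : B | exists (a : A) (x y t : posCone G),
    b = sandwich (star (jG x)) (jA a)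
          ((sone - star (jG t) ** jG t) ** jG y)].
Proof.
have [jA_nd j_cov _ j_gen] := hB; have [[_ i_cov] iso_univ _ _] := hC.
have JI := defect_ideal_closed_star_ideal j_cov j_gen.
rewrite -/(defect_generators jA jG) -/(defect_ideal jA jG).
apply/seteqP; split=> [b /= b0|b]; last exact: (defect_ideal_sub_kernel j_cov i_cov hphi phiE).
have Jbx x : defect_ideal jA jG (b ** x).
  apply: contrapT => nJ.
  have [F [Fpos FJ F0]] := exists_positive_functional JI nJ.
  have [rho [[rho_nd rhoA [rhobar [[[rbl rbM rbS] rhobarE] rhobarG]]] _]] :=
    iso_univ _ _ _ (gns_rep_nondegenerate Fpos jA_nd)
      (gns_iso_covariant j_cov j_gen Fpos FJ).
  have [rho_hom _] := rho_nd.
  (* Both sides send a spanning element to the same product of operators, [rho] through its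
     extension to the multipliers. *)
  have eqrho : rho \o phi =1 gns_rep Fpos.
    apply: (star_hom_eq_on_generators j_gen); last 1 first.
    - move=> s a t; rewrite /= phiE (gns_rep_sandwich j_cov).
      rewrite -rhobarE mult_embed_sandwich !rbM rbS rhobarE.
      by rewrite rhoA !rhobarG.
    - have [rl rM rS] := rho_hom; have [pl pM pS] := hphi.
      split=> [c y z|y z|y] /=; first by rewrite pl rl.
        by rewrite pM rM.
      by rewrite pS rS.
    - exact: gns_rep_star_hom.
  have rb0 : gns_rep Fpos b = 0.
    by rewrite -eqrho /= b0; have [rl _ _] := rho_hom; exact: lin0.
  by move: F0; rewrite (gns_rep_eq0 x rb0) eqxx.
(* [Jbx] at x = b^* gives b b^* in J; then p = 0 and j = - b b^* satisfy the criterion for b^* with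
   error 0. *)
rewrite -[b]starK; apply: (csi_star JI); apply: (mem_ideal_of_approx JI) => e e0.
exists 0, (- (star (star b) ** star b)); split.
- have -> : mult_embed (0 : B) = 0 by apply: mull_inj => y /=; rewrite smul_0l.
  exact: pos0.
- by apply: (csiN JI); rewrite starK.
- by rewrite starN starM !starK.
- by rewrite addr0 subrr rnorm0 ltW.
Qed.
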